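(* Let $\mathfrak{g}$ be a complex simple finite-dimensional Lie algebra with a Cartan subalgebra $\mathfrak{h}$ and corresponding triangular decomposition $\mathfrak{g}=\overline{\mathfrak{n}}\oplus\mathfrak{h}\oplus\mathfrak{n}$. Let $\theta$ be the maximal root in $\Delta^+$ and $\Delta^+_\theta=\Delta^+\setminus\{\theta\}$. If $\lambda\in\mathfrak{h}^*$, then the vector space $\mathbb{C}[\partial_{x_\alpha},\alpha\in\Delta^+_\theta,\,x_\theta]$ has the structure of a cyclic $\theta$-Gelfand--Tsetlin $\mathfrak{g}$-module on which every element $a\in\mathfrak{g}$ acts as the differential operator $$a\mapsto -\sum_{\alpha\in\Delta^+}\bigg[\frac{\operatorname{ad}(u(x))e^{\operatorname{ad}(u(x))}}{e^{\operatorname{ad}(u(x))}-\mathrm{id}}\,(e^{-\operatorname{ad}(u(x))}a)_{\overline{\mathfrak{n}}}\bigg]_\alpha\partial_{x_\alpha}+(\lambda+2\rho)\big((e^{-\operatorname{ad}(u(x))}a)_{\mathfrak{h}}\big).$$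
   Context: $\Delta$ is the root system of $\mathfrak{g}$ with respect to $\mathfrak{h}$, $\Delta^+$ a positive system, $\mathfrak{n}=\bigoplus_{\alpha\in\Delta^+}\mathfrak{g}_\alpha$, $\overline{\mathfrak{n}}=\bigoplus_{\alpha\in\Delta^+}\mathfrak{g}_{-\alpha}$, $\rho=\frac12\sum_{\alpha\in\Delta^+}\alpha$, and $\theta$ is the maximal root (highest weight of the adjoint representation). $\{f_\alpha;\,\alpha\in\Delta^+\}$ is a root basis of $\overline{\mathfrak{n}}$ ($f_\alpha\in\mathfrak{g}_{-\alpha}$), $x=\{x_\alpha;\,\alpha\in\Delta^+\}$ are the corresponding linear coordinate functions on $\overline{\mathfrak{n}}$, and $u(x)=\sum_{\alpha\in\Delta^+}x_\alpha f_\alpha\in\mathbb{C}[\overline{\mathfrak{n}}]\otimes_{\mathbb{C}}\mathfrak{g}$, so $\operatorname{ad}(u(x))$ is a nilpotent linear map on the Lie algebra $\mathbb{C}[\overline{\mathfrak{n}}]\otimes\mathfrak{g}$; the fraction means the power series $te^t/(e^t-1)$ evaluated at $t=\operatorname{ad}(u(x))$. $[a]_\alpha$ is the $\alpha$-th coordinate of $a\in\overline{\mathfrak{n}}$ with respect to $\{f_\alpha\}$, and $a_{\overline{\mathfrak{n}}}$, $a_{\mathfrak{h}}$ are the $\overline{\mathfrak{n}}$-part and $\mathfrak{h}$-part of $a$ with respect to $\mathfrak{g}=\overline{\mathfrak{n}}\oplus\mathfrak{h}\oplus\mathfrak{n}$ (all extended $\mathbb{C}[\overline{\mathfrak{n}}]$-linearly,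 as are elements of $\mathfrak{h}^*$). The Weyl algebra $\mathcal{A}$ of $\overline{\mathfrak{n}}$ is generated by $x_\alpha,\partial_{x_\alpha}$ ($\alpha\in\Delta^+$) with the canonical commutation relations. The vector space $\mathbb{C}[\partial_{x_\alpha},\alpha\in\Delta^+_\theta,\,x_\theta]$ is identified with the left $\mathcal{A}$-module $\mathcal{A}/\mathcal{I}_{\rm GT}$, where $\mathcal{I}_{\rm GT}$ is the left ideal generated by $x_\alpha$ ($\alpha\in\Delta^+_\theta$) and $\partial_{x_\theta}$; differential operators act through this $\mathcal{A}$-module structure. A module is cyclic if it is generated by one vector. Let $(e_\theta,h_\theta,f_\theta)$ be an $\mathfrak{sl}(2,\mathbb{C})$-triple associated to $\theta$, with span $\mathfrak{s}_\theta$, and let $\Gamma_\theta\subset U(\mathfrak{g})$ be the commutative subalgebra generated by $\mathfrak{h}$ and the center of $U(\mathfrak{s}_\theta)$. For a character $\chi$ of $\Gamma_\theta$ (a $\mathbb{C}$-algebra homomorphism $\Gamma_\theta\to\mathbb{C}$) and a module $M$ put $M_\chi=\{v\in M;\,(\exists k\in\mathbb{N})(\forall a\in\Gamma_\theta)\,(a-\chi(a))^kv=0\}$. A $\mathfrak{g}$-module $M$ is a $\theta$-Gelfand--Tsetlin module if $M=\bigoplus_{\chi}M_\chi$, the sum over all characters of $\Gamma_\theta$. *)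

(* Defs.v *)
From HB Require Import structures.
From mathcomp Require Import all_boot all_order all_algebra.
From mathcomp Require Import boolp classical_sets reals complex mpoly.

Set Implicit Arguments.
Unset Strict Implicit.
Unset Printing Implicit Defensive.

Import GRing.Theory.
Local Open Scope ring_scope.
Local Open Scope quotient_scope.

Inductive aterm (F X : Type) : Type :=
| AVar of X
| AScal of F
| AAdd of aterm F X & aterm F X
| AMul of aterm F X & aterm F X.
Arguments AVar {F X}.
Arguments AScal {F X}.
Arguments AAdd {F X}.
Arguments AMul {F X}.

HB.instance Definition _ (F X : Type) := gen_eqMixin (aterm F X).
HB.instance Definition _ (F X : Type) := gen_choiceMixin (aterm F X).

Section PresentedAlgebra.
Variables (F : fieldType) (X : Type).
Variable R : aterm F X -> aterm F X -> Prop.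

(* The least congruence containing R whose quotient is an associative unital
   F-algebra. *)
Inductive acongr : aterm F X -> aterm F X -> Prop :=
| acongr_rel s t : R s t -> acongr s t
| acongr_refl s : acongr s s
| acongr_sym s t : acongr s t -> acongr t s
| acongr_trans s t u : acongr s t -> acongr t u -> acongr s u
| acongr_add s s' t t' :
    acongr s s' -> acongr t t' -> acongr (AAdd s t) (AAdd s' t')
| acongr_mul s s' t t' :
    acongr s s' -> acongr t t' -> acongr (AMul s t) (AMul s' t')
| acongr_addA s t u : acongr (AAdd s (AAdd t u)) (AAdd (AAdd s t) u)
| acongr_addC s t : acongr (AAdd s t) (AAdd t s)
| acongr_add0 s : acongr (AAdd (AScal 0) s) s
| acongr_mulA s t u : acongr (AMul s (AMul t u)) (AMul (AMul s t) u)
| acongr_mul0 s : acongr (AMul (AScal 0) s) (AScal 0)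
| acongr_mul1 s : acongr (AMul (AScal 1) s) s
| acongr_mulDl s t u : acongr (AMul (AAdd s t) u) (AAdd (AMul s u) (AMul t u))
| acongr_mulDr s t u : acongr (AMul s (AAdd t u)) (AAdd (AMul s t) (AMul s u))
| acongr_scalD c d : acongr (AScal (c + d)) (AAdd (AScal c) (AScal d))
| acongr_scalM c d : acongr (AScal (c * d)) (AMul (AScal c) (AScal d))
| acongr_scalC c s : acongr (AMul (AScal c) s) (AMul s (AScal c)).

Definition acongrb s t := `[< acongr s t >].

Lemma acongrb_equiv : equiv_class_of acongrb.
Proof.
split=> [s|s t|t s u].
- exact/asboolP/acongr_refl.
- by apply/asboolP/asboolP; apply: acongr_sym.
- by move=> /asboolP st /asboolP tu; apply/asboolP; apply: acongr_trans tu.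
Qed.

Canonical acongr_equivRel := EquivRelPack acongrb_equiv.

Definition palg := {eq_quot acongrb}.
HB.instance Definition _ := Choice.on palg.
HB.instance Definition _ := EqQuotient.on palg.

Definition pcls (t : aterm F X) : palg := \pi_palg t.

Lemma pclsP s t : acongr s t <-> pcls s = pcls t.
Proof.
split=> [st|]; first by apply/eqmodP/asboolP.
by move/eqmodP/asboolP.
Qed.

Lemma pcls_repr (a : palg) : pcls (repr a) = a.
Proof. exact: reprK. Qed.

Definition padd (a b : palg) := pcls (AAdd (repr a) (repr b)).
Definition pmul (a b : palg) := pcls (AMul (repr a) (repr b)).
Definition popp (a : palg) := pcls (AMul (AScal (-1)) (repr a)).
Definition pscale (c : F) (a : palg) := pcls (AMul (AScal c) (repr a)).

Lemma repr_pcls t : acongr (repr (pcls t)) t.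
Proof. by apply/pclsP; rewrite pcls_repr. Qed.

Lemma pclsD s t : padd (pcls s) (pcls t) = pcls (AAdd s t).
Proof. by apply/pclsP; apply: acongr_add; apply: repr_pcls. Qed.
Lemma pclsM s t : pmul (pcls s) (pcls t) = pcls (AMul s t).
Proof. by apply/pclsP; apply: acongr_mul; apply: repr_pcls. Qed.
Lemma pclsZ c t : pscale c (pcls t) = pcls (AMul (AScal c) t).
Proof.
by apply/pclsP; apply: acongr_mul; [apply: acongr_refl | apply: repr_pcls].
Qed.
Lemma pclsN t : popp (pcls t) = pcls (AMul (AScal (-1)) t).
Proof. exact: pclsZ. Qed.

Lemma pclsW (P : palg -> Prop) : (forall t, P (pcls t)) -> forall a, P a.
Proof. by move=> PP a; rewrite -(pcls_repr a). Qed.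

Fact paddA : associative padd.
Proof.
elim/pclsW=> s; elim/pclsW=> t; elim/pclsW=> u; rewrite !pclsD.
exact/pclsP/acongr_addA.
Qed.
Fact paddC : commutative padd.
Proof.
by elim/pclsW=> s; elim/pclsW=> t; rewrite !pclsD; apply/pclsP/acongr_addC.
Qed.
Fact padd0 : left_id (pcls (AScal 0)) padd.
Proof. by elim/pclsW=> s; rewrite pclsD; apply/pclsP/acongr_add0. Qed.
Fact paddN : left_inverse (pcls (AScal 0)) popp padd.
Proof.
elim/pclsW=> s; rewrite pclsN pclsD; apply/pclsP.
apply: acongr_trans (acongr_mul0 s).
apply: acongr_trans
  (_ : acongr _ (AAdd (AMul (AScal (-1)) s) (AMul (AScal 1) s))) _.
  by apply: acongr_add; [apply: acongr_refl | apply/acongr_sym/acongr_mul1].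
apply: acongr_trans (acongr_sym (acongr_mulDl _ _ _)) _.
apply: acongr_mul; last exact: acongr_refl.
by rewrite -(addNr 1); apply/acongr_sym/acongr_scalD.
Qed.

HB.instance Definition _ := GRing.isZmodule.Build palg paddA paddC padd0 paddN.

Fact pmulA : associative pmul.
Proof.
elim/pclsW=> s; elim/pclsW=> t; elim/pclsW=> u; rewrite !pclsM.
exact/pclsP/acongr_mulA.
Qed.
Fact pmul1 : left_id (pcls (AScal 1)) pmul.
Proof. by elim/pclsW=> s; rewrite pclsM; apply/pclsP/acongr_mul1. Qed.
Fact pmulr1 : right_id (pcls (AScal 1)) pmul.
Proof.
elim/pclsW=> s; rewrite pclsM; apply/pclsP.
exact: acongr_trans (acongr_sym (acongr_scalC _ _)) (acongr_mul1 _).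
Qed.
Fact pmulDl : left_distributive pmul +%R.
Proof.
elim/pclsW=> s; elim/pclsW=> t; elim/pclsW=> u.
rewrite /GRing.add/= pclsD !pclsM pclsD.
exact/pclsP/acongr_mulDl.
Qed.
Fact pmulDr : right_distributive pmul +%R.
Proof.
elim/pclsW=> s; elim/pclsW=> t; elim/pclsW=> u.
rewrite /GRing.add/= pclsD !pclsM pclsD.
exact/pclsP/acongr_mulDr.
Qed.

HB.instance Definition _ := GRing.Zmodule_isPzRing.Build palg
  pmulA pmul1 pmulr1 pmulDl pmulDr.

Fact pscaleA c d a : pscale c (pscale d a) = pscale (c * d) a.
Proof.
elim/pclsW: a => t; rewrite !pclsZ; apply/pclsP.
apply: acongr_trans (acongr_mulA _ _ _) _.
apply: acongr_mul; last exact: acongr_refl.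
exact/acongr_sym/acongr_scalM.
Qed.
Fact pscale1 : left_id 1 pscale.
Proof. by elim/pclsW=> t; rewrite pclsZ; apply/pclsP/acongr_mul1. Qed.
Fact pscaleDr : right_distributive pscale +%R.
Proof.
move=> c; elim/pclsW=> s; elim/pclsW=> t.
rewrite /GRing.add/= pclsD !pclsZ pclsD.
exact/pclsP/acongr_mulDr.
Qed.
Fact pscaleDl a : {morph pscale^~ a : c d / c + d}.
Proof.
elim/pclsW: a => t c d; rewrite {2}/GRing.add/= !pclsZ pclsD; apply/pclsP.
apply: acongr_trans (acongr_mulDl _ _ _).
by apply: acongr_mul; [apply: acongr_scalD | apply: acongr_refl].
Qed.

HB.instance Definition _ := GRing.Zmodule_isLmodule.Build F palg
  pscaleA pscale1 pscaleDr pscaleDl.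

Fact pscaleAl c (a b : palg) : c *: (a * b) = (c *: a) * b.
Proof.
elim/pclsW: a => s; elim/pclsW: b => t.
rewrite /GRing.scale /GRing.mul/= pclsM !pclsZ pclsM; apply/pclsP.
exact: acongr_mulA.
Qed.
Fact pscaleAr c (a b : palg) : c *: (a * b) = a * (c *: b).
Proof.
elim/pclsW: a => s; elim/pclsW: b => t.
rewrite /GRing.scale /GRing.mul/= pclsM !pclsZ pclsM; apply/pclsP.
apply: acongr_trans (acongr_mulA _ _ _) _.
apply: acongr_trans (_ : acongr _ (AMul (AMul s (AScal c)) t)) _.
  by apply: acongr_mul; [apply: acongr_scalC | apply: acongr_refl].
exact/acongr_sym/acongr_mulA.
Qed.

Definition pgen (x : X) : palg := pcls (AVar x).

Lemma pcls_scal c : pcls (AScal c) = c *: (1 : palg).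
Proof.
rewrite /GRing.scale /GRing.one/= pclsZ; apply/pclsP.
exact: acongr_trans (acongr_sym (acongr_mul1 _)) (acongr_scalC _ _).
Qed.

Lemma palg_ind (P : palg -> Prop) :
  (forall x, P (pgen x)) -> P 1 -> (forall a b, P a -> P b -> P (a + b)) ->
  (forall a b, P a -> P b -> P (a * b)) -> (forall c a, P a -> P (c *: a)) ->
  forall a, P a.
Proof.
move=> Pg P1 PD PM PZ; elim/pclsW; elim=> [x|c|s Ps t Pt|s Ps t Pt].
- exact: Pg.
- by rewrite pcls_scal; apply: PZ.
- by rewrite -pclsD; apply: PD.
- by rewrite -pclsM; apply: PM.
Qed.

(* A family pi of operators on M indexed by the generators extends to all
   terms; the value on a class is read off an arbitrary representative, which
   is legitimate under the hypotheses of the lemmas below. *)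
Section Action.
Variables (M : lmodType F) (pi : X -> M -> M).

Fixpoint aterm_act (t : aterm F X) (v : M) : M :=
  match t with
  | AVar x => pi x v
  | AScal c => c *: v
  | AAdd s t => aterm_act s v + aterm_act t v
  | AMul s t => aterm_act s (aterm_act t v)
  end.

Definition palg_act (a : palg) (v : M) : M := aterm_act (repr a) v.

Hypothesis pi_lin : forall x c v w, pi x (c *: v + w) = c *: pi x v + pi x w.
Hypothesis pi_rel : forall s t, R s t -> aterm_act s =1 aterm_act t.

Lemma aterm_act_lin t c v w :
  aterm_act t (c *: v + w) = c *: aterm_act t v + aterm_act t w.
Proof.
elim: t v w => [x|d|s IHs t IHt|s IHs t IHt] v w /=.
- exact: pi_lin.
- by rewrite scalerDr !scalerA mulrC.
- by rewrite IHs IHt scalerDr addrACA.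
- by rewrite IHt IHs.
Qed.

Lemma aterm_act_congr s t : acongr s t -> aterm_act s =1 aterm_act t.
Proof.
have linD u v w : aterm_act u (v + w) = aterm_act u v + aterm_act u w.
  by rewrite -{1}(scale1r v) aterm_act_lin scale1r.
have lin0 u : aterm_act u 0 = 0 by apply: (addIr (aterm_act u 0)); rewrite -linD !add0r.
have linZ u c v : aterm_act u (c *: v) = c *: aterm_act u v.
  by rewrite -{1}(addr0 (c *: v)) aterm_act_lin lin0 addr0.
elim=> {s t} /=.
- exact: pi_rel.
- by [].
- by move=> s t _ IH v; rewrite IH.
- by move=> s t u _ IH1 _ IH2 v; rewrite IH1.
- by move=> s s' t t' _ IH1 _ IH2 v; rewrite IH1 IH2.
- by move=> s s' t t' _ IH1 _ IH2 v; rewrite IH2 IH1.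
- by move=> s t u v; rewrite addrA.
- by move=> s t v; rewrite addrC.
- by move=> s v; rewrite scale0r add0r.
- by [].
- by move=> s v; rewrite !scale0r.
- by move=> s v; rewrite scale1r.
- by [].
- by move=> s t u v; rewrite linD.
- by move=> c d v; rewrite scalerDl.
- by move=> c d v; rewrite scalerA.
- by move=> c s v; rewrite linZ.
Qed.

Lemma palg_act_pcls t : palg_act (pcls t) =1 aterm_act t.
Proof. exact/aterm_act_congr/repr_pcls. Qed.
Lemma palg_act_gen x : palg_act (pgen x) =1 pi x.
Proof. exact: palg_act_pcls. Qed.
Lemma palg_act1 v : palg_act 1 v = v.
Proof. by rewrite [LHS]palg_act_pcls /= scale1r. Qed.
Lemma palg_actDl a b v : palg_act (a + b) v = palg_act a v + palg_act b v.
Proof. by rewrite [LHS]palg_act_pcls. Qed.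
Lemma palg_actM a b v : palg_act (a * b) v = palg_act a (palg_act b v).
Proof. by rewrite [LHS]palg_act_pcls. Qed.
Lemma palg_actZl c a v : palg_act (c *: a) v = c *: palg_act a v.
Proof. by rewrite [LHS]palg_act_pcls. Qed.
Lemma palg_act_lin a c v w :
  palg_act a (c *: v + w) = c *: palg_act a v + palg_act a w.
Proof. exact: aterm_act_lin. Qed.

End Action.
End PresentedAlgebra.

Section Subobjects.
Variables (F : fieldType) (A : algType F).

Inductive subalg_gen (S : A -> Prop) : A -> Prop :=
| subalg_gen_mem a : S a -> subalg_gen S a
| subalg_gen1 : subalg_gen S 1
| subalg_genD a b : subalg_gen S a -> subalg_gen S b -> subalg_gen S (a + b)
| subalg_genM a b : subalg_gen S a -> subalg_gen S b -> subalg_gen S (a * b)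
| subalg_genZ c a : subalg_gen S a -> subalg_gen S (c *: a).

Definition center_of (B : A -> Prop) (z : A) :=
  B z /\ forall b, B b -> z * b = b * z.

Inductive left_ideal_gen (S : A -> Prop) : A -> Prop :=
| left_ideal_gen_mem a : S a -> left_ideal_gen S a
| left_ideal_gen0 : left_ideal_gen S 0
| left_ideal_genD a b :
    left_ideal_gen S a -> left_ideal_gen S b -> left_ideal_gen S (a + b)
| left_ideal_genM a b : left_ideal_gen S b -> left_ideal_gen S (a * b).

(* Only the values of chi on the subalgebra G matter. *)
Definition is_character (G : A -> Prop) (chi : A -> F) :=
  [/\ chi 1 = 1,
      forall a b, G a -> G b -> chi (a + b) = chi a + chi b,
      forall a b, G a -> G b -> chi (a * b) = chi a * chi b
    & forall c a, G a -> chi (c *: a) = c * chi a].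

End Subobjects.

Section Weyl.
Variables (F : fieldType) (N : nat).

Inductive weyl_rel : aterm F ('I_N + 'I_N) -> aterm F ('I_N + 'I_N) -> Prop :=
| weyl_xx i j :
    weyl_rel (AMul (AVar (inl i)) (AVar (inl j)))
             (AMul (AVar (inl j)) (AVar (inl i)))
| weyl_dd i j :
    weyl_rel (AMul (AVar (inr i)) (AVar (inr j)))
             (AMul (AVar (inr j)) (AVar (inr i)))
| weyl_dx i j :
    weyl_rel (AMul (AVar (inr i)) (AVar (inl j)))
             (AAdd (AMul (AVar (inl j)) (AVar (inr i))) (AScal (i == j)%:R)).

Definition weyl := palg weyl_rel.
HB.instance Definition _ := GRing.PzRing.on weyl.
HB.instance Definition _ := GRing.Lmodule.on weyl.

Definition wx (i : 'I_N) : weyl := pgen weyl_rel (inl i).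
Definition wd (i : 'I_N) : weyl := pgen weyl_rel (inr i).

Lemma wdx i j : wd i * wx j = wx j * wd i + (i == j)%:R *: (1 : weyl).
Proof.
rewrite /wd /wx /pgen -pcls_scal [LHS]pclsM [X in X + _]pclsM [RHS]pclsD.
exact/pclsP/acongr_rel/weyl_dx.
Qed.
Lemma wxx i j : wx i * wx j = wx j * wx i.
Proof. by rewrite [LHS]pclsM [RHS]pclsM; apply/pclsP/acongr_rel/weyl_xx. Qed.
Lemma wdd i j : wd i * wd j = wd j * wd i.
Proof. by rewrite [LHS]pclsM [RHS]pclsM; apply/pclsP/acongr_rel/weyl_dd. Qed.

Notation poly := {mpoly F[N]}.

(* The action of the Weyl algebra on polynomials in commuting indeterminates
   standing for x_i (i in T) and d_i (i not in T). *)
Definition fourier_op (T : pred 'I_N) (z : 'I_N + 'I_N) (p : poly) : poly :=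
  match z with
  | inl i => if T i then 'X_i * p else - mderiv i p
  | inr i => if T i then mderiv i p else 'X_i * p
  end.

Lemma fourier_op_lin T z c p q :
  fourier_op T z (c *: p + q) = c *: fourier_op T z p + fourier_op T z q.
Proof.
by case: z => i /=; case: ifP => _;
   rewrite ?linearP //= ?mulrDr ?scalerAr ?opprD ?scalerN.
Qed.

Lemma mderivXM i j (p : poly) :
  mderiv i ('X_j * p) = (i == j)%:R *: p + 'X_j * mderiv i p.
Proof.
rewrite mderivM mderivX mnmE eq_sym; congr (_ + _).
case: eqP => [->|_]; last by rewrite !scale0r mul0r.
rewrite !scale1r -[RHS]mul1r -mpolyX0; congr ('X_[_] * _).
by apply/mnmP=> k; rewrite mnmBE subnn mnmE.
Qed.

Lemma fourier_op_rel T s t :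
  weyl_rel s t -> aterm_act (fourier_op T) s =1 aterm_act (fourier_op T) t.
Proof.
have TN i j : T i != T j -> (i == j = false) * (j == i = false).
  by rewrite (eq_sym j); case: (eqVneq i j) => // ->; rewrite eqxx.
case=> i j p /=; have := TN i j; case Ti: (T i); case Tj: (T j) => /= E;
  first [have {}E := E isT | clear E]; rewrite ?mderivXM ?mderivN ?mulrN;
  try rewrite !E; rewrite ?scale0r ?add0r ?addr0 //.
- by rewrite mulrCA.
- by rewrite mderiv_comm.
- by rewrite mderiv_comm.
- by rewrite mulrCA.
- by rewrite addrC.
- by rewrite mderiv_comm.
- by rewrite mulrCA.
- by rewrite opprD addrAC eq_sym addNr add0r.
Qed.

Definition fourier (T : pred 'I_N) (D : weyl) (p : poly) : poly :=
  palg_act (fourier_op T) D p.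

Lemma fourier1 T p : fourier T 1 p = p.
Proof. exact: palg_act1 (@fourier_op_lin T) (@fourier_op_rel T) _. Qed.
Lemma fourier0 T p : fourier T 0 p = 0.
Proof.
rewrite -(scale0r (1 : weyl)).
rewrite /fourier (palg_actZl (@fourier_op_lin T) (@fourier_op_rel T)).
exact: scale0r.
Qed.

Fact weyl_oner_neq0 : (1 : weyl) != 0.
Proof.
apply/eqP => /(congr1 (fun D => fourier predT D 1)).
by rewrite fourier1 fourier0 => /eqP; rewrite oner_eq0.
Qed.
HB.instance Definition _ := GRing.PzSemiRing_isNonZero.Build weyl weyl_oner_neq0.
HB.instance Definition _ := GRing.Lmodule_isLalgebra.Build F weyl
  (@pscaleAl _ _ weyl_rel).
HB.instance Definition _ := GRing.Lalgebra_isAlgebra.Build F weyl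
  (@pscaleAr _ _ weyl_rel).

Lemma weyl_ind (P : weyl -> Prop) :
  (forall i, P (wx i)) -> (forall i, P (wd i)) -> P 1 ->
  (forall a b, P a -> P b -> P (a + b)) ->
  (forall a b, P a -> P b -> P (a * b)) -> (forall c a, P a -> P (c *: a)) ->
  forall a, P a.
Proof. by move=> Px Pd P1 PD PM PZ; apply: palg_ind => // -[]. Qed.

Section Fourier.
Variable T : pred 'I_N.
Let lin := @fourier_op_lin T.
Let rel := @fourier_op_rel T.
Lemma fourier_x i p :
  fourier T (wx i) p = if T i then 'X_i * p else - mderiv i p.
Proof. exact: (palg_act_gen lin rel). Qed.
Lemma fourier_d i p :
  fourier T (wd i) p = if T i then mderiv i p else 'X_i * p.
Proof. exact: (palg_act_gen lin rel). Qed.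
Lemma fourierDl a b p : fourier T (a + b) p = fourier T a p + fourier T b p.
Proof. exact: (palg_actDl lin rel). Qed.
Lemma fourierZl c a p : fourier T (c *: a) p = c *: fourier T a p.
Proof. exact: (palg_actZl lin rel). Qed.
Lemma fourierM a b p : fourier T (a * b) p = fourier T a (fourier T b p).
Proof. exact: (palg_actM lin rel). Qed.
Lemma fourier_lin a c p q :
  fourier T a (c *: p + q) = c *: fourier T a p + fourier T a q.
Proof. exact: (palg_act_lin lin). Qed.
End Fourier.

End Weyl.

Lemma mmap_commM (F : fieldType) (A : algType F) (n : nat) (y : 'I_n -> A) :
  (forall i j, y i * y j = y j * y i) ->
  {morph mmap (in_alg A) y : p q / p * q}.
Proof.
move=> yC.
have prodM (r : seq 'I_n) (a b : 'I_n -> nat) :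
  \prod_(i <- r) (y i ^+ a i * y i ^+ b i) =
  \prod_(i <- r) y i ^+ a i * \prod_(i <- r) y i ^+ b i.
  elim: r => [|i r IH]; first by rewrite !big_nil mulr1.
  rewrite !big_cons IH -!mulrA; congr (_ * _); rewrite !mulrA; congr (_ * _).
  apply: commr_prod => j _; apply: commrX; apply: commr_sym; apply: commrX.
  exact: yC.
have m1M m1 m2 : mmap1 y (m1 + m2)%MM = mmap1 y m1 * mmap1 y m2.
  by rewrite /mmap1 -prodM; apply: eq_bigr => i _; rewrite mnmDE exprD.
have MX m q :
  mmap (in_alg A) y ('X_[m] * q) = mmap1 y m * mmap (in_alg A) y q.
  elim/mpolyind: q => [|c m' q _ _ IH]; first by rewrite mulr0 !mmap0 mulr0.
  rewrite mulrDr mmapD IH mmapD mulrDr -scalerAr -mpolyXD !mmapZ !mmapX m1M /=.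
  by rewrite -!scalerAl !mul1r scalerAr.
elim/mpolyind => [|c m p _ _ IH] q; first by rewrite mul0r !mmap0 mul0r.
by rewrite mulrDl !mmapD mulrDl IH -scalerAl !mmapZ MX mmapX mulrA.
Qed.

Section GTModule.
Variables (F : fieldType) (N : nat) (th : 'I_N).
Local Notation A := (weyl F N).

Definition gt_ideal_gen (D : A) :=
  (exists2 i, i != th & D = wx F i) \/ D = wd F th.

Definition gt_ideal : A -> Prop := left_ideal_gen gt_ideal_gen.

(* 'X_i stands for d_i if i != th, and for x_th if i = th; gt_emb is the
   inclusion of C[d_i (i != th), x_th] in the Weyl algebra. *)
Definition gt_var (i : 'I_N) : A := if i == th then wx F i else wd F i.
Definition gt_emb (p : {mpoly F[N]}) : A := mmap (in_alg A) gt_var p.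

Lemma mpoly_mulX_ind (P : {mpoly F[N]} -> Prop) :
  P 1 -> (forall p q, P p -> P q -> P (p + q)) ->
  (forall c p, P p -> P (c *: p)) -> (forall i p, P p -> P ('X_i * p)) ->
  forall p, P p.
Proof.
move=> P1 PD PZ PX.
have PM m : P 'X_[m].
  rewrite -[X in P X]mulr1 mpolyXE_id.
  apply: (big_ind (fun q => forall p, P p -> P (q * p))) 1 P1 => //.
  - by move=> p; rewrite mul1r.
  - by move=> q1 q2 H1 H2 p Pp; rewrite -mulrA; apply/H1/H2.
  - move=> i _; elim: (m i) => [|k IH] p Pp; first by rewrite expr0 mul1r.
    by rewrite exprS -mulrA; apply/PX/IH.
elim/mpolyind => [|c m p _ _ Pp]; first by rewrite -(scale0r 1); apply: PZ.
by apply: PD => //; apply: PZ.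
Qed.

Lemma gt_varC i j : gt_var i * gt_var j = gt_var j * gt_var i.
Proof.
rewrite /gt_var; case: eqP => [->|ni]; case: eqP => [->|nj] //.
- by rewrite wdx (_ : j == th = false) ?scale0r ?addr0 //; apply/eqP.
- by rewrite wdx (_ : i == th = false) ?scale0r ?addr0 //; apply/eqP.
- exact: wdd.
Qed.

Lemma gt_embX i : gt_emb 'X_i = gt_var i.
Proof. by rewrite /gt_emb mmapX mmap1U. Qed.
Lemma gt_embM p q : gt_emb (p * q) = gt_emb p * gt_emb q.
Proof. exact/mmap_commM/gt_varC. Qed.
Lemma gt_emb1 : gt_emb 1 = 1.
Proof. by rewrite /gt_emb -mpolyC1 mmapC /= scale1r. Qed.
Lemma gt_embD p q : gt_emb (p + q) = gt_emb p + gt_emb q.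
Proof. exact: mmapD. Qed.
Lemma gt_embZ c p : gt_emb (c *: p) = c *: gt_emb p.
Proof. by rewrite /gt_emb mmapZ /= -scalerAl mul1r. Qed.

Lemma gt_emb_comm (z : A) (i : 'I_N) (s : F) :
  (forall j, z * gt_var j = gt_var j * z + (i == j)%:R *: (s *: 1)) ->
  forall p, z * gt_emb p = gt_emb p * z + s *: gt_emb (mderiv i p).
Proof.
move=> zj; elim/mpoly_mulX_ind => [|p q IHp IHq|c p IH|j p IH].
- have -> : mderiv i (1 : {mpoly F[N]}) = 0 by rewrite -mpolyC1 mderivC.
  by rewrite -(scale0r 1) gt_embZ gt_emb1 scale0r scaler0 addr0 mulr1 mul1r.
- by rewrite mderivD !gt_embD mulrDr IHp IHq mulrDl scalerDr addrACA.
- rewrite linearZ /= !gt_embZ -scalerAr IH scalerDr scalerAl.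
  by rewrite !scalerA mulrC.
- rewrite mderivXM gt_embD gt_embZ !gt_embM gt_embX mulrA zj mulrDl.
  rewrite -!mulrA IH mulrDr scalerDr -!addrA; congr (_ + _).
  rewrite addrC -!scalerAl mul1r scalerAr; congr (_ + _).
  by rewrite !scalerA mulrC.
Qed.

Lemma wdxN i j : wx F i * wd F j = wd F j * wx F i - (i == j)%:R *: (1 : A).
Proof. by rewrite wdx eq_sym addrK. Qed.

Lemma gt_embP (D : A) p :
  gt_ideal (D * gt_emb p - gt_emb (fourier (pred1 th) D p)).
Proof.
have I0 a : a = 0 -> gt_ideal a by move->; apply: left_ideal_gen0.
elim/weyl_ind: D p => [i|i||a b IHa IHb|a b IHa IHb|c a IH] p.
- rewrite fourier_x /=; case: eqP => [->|/eqP ni].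
    by rewrite gt_embM gt_embX /gt_var eqxx; apply: I0; rewrite subrr.
  rewrite (@gt_emb_comm (wx F i) i (-1)); last first.
    move=> j; rewrite /gt_var; case: (eqVneq j th) => [->|nj].
      by rewrite wxx (negPf ni) scale0r addr0.
    by rewrite wdxN scaleN1r scalerN.
  rewrite -(scaleN1r (mderiv i p)) gt_embZ addrK.
  by apply/left_ideal_genM/left_ideal_gen_mem; left; exists i.
- rewrite fourier_d /=; case: eqP => [->|/eqP ni]; last first.
    by rewrite gt_embM gt_embX /gt_var (negPf ni); apply: I0; rewrite subrr.
  rewrite (@gt_emb_comm (wd F th) th 1); last first.
    move=> j; rewrite /gt_var eq_sym; case: (eqVneq j th) => [->|nj].
      by rewrite wdx eqxx !scale1r.
    by rewrite scale0r addr0; apply: wdd.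
  rewrite scale1r addrK.
  by apply/left_ideal_genM/left_ideal_gen_mem; right.
- by rewrite fourier1; apply: I0; rewrite mul1r subrr.
- rewrite fourierDl gt_embD mulrDl opprD addrACA.
  exact: (left_ideal_genD (IHa p) (IHb p)).
- rewrite fourierM -mulrA.
  have := left_ideal_genD (left_ideal_genM a (IHb p))
    (IHa (fourier (pred1 th) b p)).
  by rewrite mulrBr addrA subrK.
- rewrite fourierZl gt_embZ -scalerAl -scalerBr.
  by rewrite -[_ - _]mul1r scalerAl; apply/left_ideal_genM/IH.
Qed.

Lemma fourier_gt_ideal D : gt_ideal D -> fourier (pred1 th) D 1 = 0.
Proof.
have d0 i : mderiv i (1 : {mpoly F[N]}) = 0 by rewrite -mpolyC1 mderivC.
elim=> {D} [D|| a b _ IHa _ IHb|a b _ IH].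
- case=> [[i ni ->]|->]; first by rewrite fourier_x /= (negPf ni) d0 oppr0.
  by rewrite fourier_d /= eqxx d0.
- exact: fourier0.
- by rewrite fourierDl IHa IHb addr0.
- rewrite fourierM IH.
  have := fourier_lin (pred1 th) a (-1) 0 0.
  by rewrite scaler0 addr0 scaleN1r addNr.
Qed.

Lemma fourier_gt_emb p : fourier (pred1 th) (gt_emb p) 1 = p.
Proof.
elim/mpoly_mulX_ind: p => [|p q IHp IHq|c p IH|i p IH].
- by rewrite gt_emb1 fourier1.
- by rewrite gt_embD fourierDl IHp IHq.
- by rewrite gt_embZ fourierZl IH.
- rewrite gt_embM gt_embX fourierM IH /gt_var.
  by case: ifP => ii; rewrite ?fourier_x ?fourier_d /= ii.
Qed.

Lemma gt_ideal_uniq D p q :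
  gt_ideal (D - gt_emb p) -> gt_ideal (D - gt_emb q) -> p = q.
Proof.
have aux r : gt_ideal (D - gt_emb r) -> fourier (pred1 th) D 1 = r.
  move=> /fourier_gt_ideal; rewrite -[- gt_emb r]scaleN1r -gt_embZ.
  rewrite fourierDl fourier_gt_emb scaleN1r.
  by move/eqP; rewrite subr_eq0 => /eqP.
by move=> /aux <- /aux.
Qed.

(* The inclusion induces a linear isomorphism onto A / I_GT. *)
Theorem gt_identification (D : A) : exists! p, gt_ideal (D - gt_emb p).
Proof.
exists (fourier (pred1 th) D 1); split=> [|q].
  by have := gt_embP D 1; rewrite gt_emb1 mulr1.
by apply: gt_ideal_uniq; have := gt_embP D 1; rewrite gt_emb1 mulr1.
Qed.

Definition gt_class (D : A) : {mpoly F[N]} :=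
  xget 0 [set p | gt_ideal (D - gt_emb p)].

(* Left multiplication by D on A / I_GT, transported to the polynomials. *)
Definition gt_act (D : A) (p : {mpoly F[N]}) : {mpoly F[N]} :=
  gt_class (D * gt_emb p).

Theorem gt_actE D p : gt_act D p = fourier (pred1 th) D p.
Proof.
apply: (@gt_ideal_uniq (D * gt_emb p)); last exact: gt_embP.
apply: (@xgetPex _ 0 [set q | gt_ideal (D * gt_emb p - gt_emb q)]).
by exists (fourier (pred1 th) D p); apply: gt_embP.
Qed.

End GTModule.
HB.mixin Record Vector_isLie (F : fieldType) g of Vector F g := {
  lie : g -> g -> g;
  lie_linl : forall x, linear (lie^~ x);
  lie_linr : forall x, linear (lie x);
  liexx : forall x, lie x x = 0;
  lie_jacobi : forall x y z,
    lie x (lie y z) + lie y (lie z x) + lie z (lie x y) = 0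
}.

#[short(type="lieAlgType")]
HB.structure Definition LieAlgebra (F : fieldType) :=
  {g of Vector F g & Vector_isLie F g}.

HB.instance Definition _ (F : fieldType) (g : lieAlgType F) (x : g) :=
  GRing.isLinear.Build F g g *:%R (lie x) (lie_linr x).

Section LieTheory.
Variables (F : fieldType) (g : lieAlgType F).

Definition lie_ideal (I : {vspace g}) :=
  forall x y, y \in I -> lie x y \in I.

Definition simple_lie :=
  (exists x y : g, lie x y != 0) /\
  forall I : {vspace g}, lie_ideal I -> I = 0%VS \/ I = fullv.

Definition abelian_lie (k : {vspace g}) :=
  {in k &, forall x y, lie x y = 0}.

Definition ad_diagonalizable (x : g) :=
  exists2 X : seq g, basis_of fullv X &
    {in X, forall v, exists c : F, lie x v = c *: v}.

(* The usual definition for semisimple Lie algebras: a maximal abelian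
   subalgebra consisting of ad-semisimple elements. *)
Definition cartan_subalgebra (hs : {vspace g}) :=
  [/\ abelian_lie hs,
      forall k : {vspace g}, abelian_lie k -> (hs <= k)%VS -> k = hs
    & {in hs, forall x, ad_diagonalizable x}].

Inductive lie_rel : aterm F g -> aterm F g -> Prop :=
| lie_rel_add x y : lie_rel (AVar (x + y)) (AAdd (AVar x) (AVar y))
| lie_rel_scale c x : lie_rel (AVar (c *: x)) (AMul (AScal c) (AVar x))
| lie_rel_bracket x y :
    lie_rel (AVar (lie x y))
      (AAdd (AMul (AVar x) (AVar y))
            (AMul (AScal (-1)) (AMul (AVar y) (AVar x)))).

Definition uenv := palg lie_rel.
HB.instance Definition _ := GRing.PzRing.on uenv.
HB.instance Definition _ := GRing.Lmodule.on uenv.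

Definition uinj (x : g) : uenv := pgen lie_rel x.

Definition is_lie_module (M : lmodType F) (pi : g -> M -> M) :=
  [/\ forall c x y v, pi (c *: x + y) v = c *: pi x v + pi y v,
      forall x c v w, pi x (c *: v + w) = c *: pi x v + pi x w
    & forall x y v, pi (lie x y) v = pi x (pi y v) - pi y (pi x v)].

Definition uenv_act (M : lmodType F) (pi : g -> M -> M) (u : uenv) : M -> M :=
  palg_act pi u.

Lemma lie_module_rel (M : lmodType F) (pi : g -> M -> M) :
  is_lie_module pi ->
  forall s t, lie_rel s t -> aterm_act pi s =1 aterm_act pi t.
Proof.
case=> pil pir pib s t [x y|c x|x y] v /=.
- by rewrite -{1}(scale1r x) pil scale1r.
- have pi0 : pi 0 v = 0.
    by have := pil (-1) 0 0 v; rewrite scaler0 addr0 scaleN1r addNr.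
  by rewrite -[c *: x]addr0 pil pi0 addr0.
- by rewrite pib scaleN1r.
Qed.

Fact uenv_oner_neq0 : (1 : uenv) != 0.
Proof.
pose pi (_ : g) (_ : F^o) : F^o := 0.
have pim : is_lie_module pi.
  by split=> *; rewrite /pi ?scaler0 ?addr0 ?subr0.
have lin : forall x c v w, pi x (c *: v + w) = c *: pi x v + pi x w.
  by case: pim.
apply/eqP => /(congr1 (fun u => palg_act pi u 1)).
rewrite (palg_act1 lin (lie_module_rel pim)) -(scale0r (1 : uenv)).
rewrite (palg_actZl lin (lie_module_rel pim)) scale0r.
by move/eqP; rewrite oner_eq0.
Qed.
HB.instance Definition _ := GRing.PzSemiRing_isNonZero.Build uenv uenv_oner_neq0.
HB.instance Definition _ := GRing.Lmodule_isLalgebra.Build F uenv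
  (@pscaleAl _ _ lie_rel).
HB.instance Definition _ := GRing.Lalgebra_isAlgebra.Build F uenv
  (@pscaleAr _ _ lie_rel).

Section LieModule.
Variables (M : lmodType F) (pi : g -> M -> M).
Hypothesis piM : is_lie_module pi.
Let lin : forall x c v w, pi x (c *: v + w) = c *: pi x v + pi x w.
Proof. by case: piM. Qed.
Let rel := lie_module_rel piM.

Lemma uenv_act_inj x v : uenv_act pi (uinj x) v = pi x v.
Proof. exact: (palg_act_gen lin rel). Qed.
Lemma uenv_act1 v : uenv_act pi 1 v = v.
Proof. exact: (palg_act1 lin rel). Qed.
Lemma uenv_actDl a b v : uenv_act pi (a + b) v = uenv_act pi a v + uenv_act pi b v.
Proof. exact: (palg_actDl lin rel). Qed.
Lemma uenv_actZl c a v : uenv_act pi (c *: a) v = c *: uenv_act pi a v.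
Proof. exact: (palg_actZl lin rel). Qed.
Lemma uenv_actM a b v : uenv_act pi (a * b) v = uenv_act pi a (uenv_act pi b v).
Proof. exact: (palg_actM lin rel). Qed.
Lemma uenv_act_lin a c v w :
  uenv_act pi a (c *: v + w) = c *: uenv_act pi a v + uenv_act pi a w.
Proof. exact: (palg_act_lin lin). Qed.
End LieModule.

Definition cyclic_lie_module (M : lmodType F) (pi : g -> M -> M) :=
  exists v, forall w, exists u, w = uenv_act pi u v.

Section Roots.
Variable hs : {vspace g}.

Definition dual := 'Hom(subvs_of hs, F^o).

Definition rootsp (a : dual) : {vspace g} :=
  (\bigcap_(i < \dim hs)
     lker (linfun (lie (vbasis hs)`_i)
           - (a (vsproj hs (vbasis hs)`_i) : F) *: (\1%VF : 'End(g))))%VS.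

Lemma rootspP (a : dual) v :
  v \in rootsp a <-> forall x : subvs_of hs, lie (vsval x) v = a x *: v.
Proof.
have lieDl (x y z : g) c : lie (c *: x + y) z = c *: lie x z + lie y z.
  exact: (lie_linl z).
have kerE (i : 'I_(\dim hs)) :
    (v \in lker (linfun (lie (vbasis hs)`_i)
           - (a (vsproj hs (vbasis hs)`_i) : F) *: (\1%VF : 'End(g)))) =
    (lie (vbasis hs)`_i v == a (vsproj hs (vbasis hs)`_i) *: v).
  by rewrite memv_ker !lfunE /= !lfunE /= !lfunE /= id_lfunE subr_eq0.
rewrite /rootsp memvE; split=> [/subv_bigcapP va x|va].
- have bE (i : 'I_(\dim hs)) : lie (vbasis hs)`_i v
      = a (vsproj hs (vbasis hs)`_i) *: v.
    by have := va i isT; rewrite -memvE kerE => /eqP.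
  have [c xE] : exists c : 'I_(\dim hs) -> F,
      vsval x = \sum_i c i *: (vbasis hs)`_i.
    by exists (fun i => coord (vbasis hs) i (vsval x)); apply/coord_vbasis/subvsP.
  have -> : a x = \sum_i c i *: a (vsproj hs (vbasis hs)`_i).
    rewrite -[X in a X]vsvalK xE !linear_sum /=.
    by apply: eq_bigr => i _; rewrite !linearZ.
  rewrite xE scaler_suml.
  elim: (index_enum _) => [|i r IH].
    rewrite !big_nil.
    by have := lieDl 0 0 v (-1); rewrite scaler0 addr0 scaleN1r addNr.
  by rewrite !big_cons lieDl IH bE scalerA.
- apply/subv_bigcapP => i _; rewrite -memvE kerE; apply/eqP.
  by rewrite -va vsprojK // vbasis_mem // mem_nth // size_tuple.
Qed.

Definition is_root (a : dual) := a != 0 /\ rootsp a != 0%VS.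
Definition is_nat_comb (b : dual) (X : seq dual) :=
  exists c : 'I_(size X) -> nat, b = \sum_(i < size X) X`_i *+ c i.

(* pos enumerates the positive roots of the root system with respect to some
   base. *)
Definition positive_system (N : nat) (pos : N.-tuple dual) :=
  [/\ uniq pos,
      forall a, is_root a <-> a \in pos \/ - a \in pos
    & exists base : seq dual,
        [/\ free base, {subset base <= pos} &
            {in pos, forall a, is_nat_comb a base}]].

Definition root_le (N : nat) (pos : N.-tuple dual) (a b : dual) :=
  is_nat_comb (b - a) pos.

Definition maximal_root (N : nat) (pos : N.-tuple dual) (a : dual) :=
  is_root a /\ forall b, is_root b -> root_le pos a b -> b = a.

Definition nilp (N : nat) (pos : N.-tuple dual) : {vspace g} :=
  (\sum_(i < N) rootsp (tnth pos i))%VS.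
Definition nilp_opp (N : nat) (pos : N.-tuple dual) : {vspace g} :=
  (\sum_(i < N) rootsp (- tnth pos i))%VS.

Definition root_basis_opp (N : nat) (pos : N.-tuple dual) (f : N.-tuple g) :=
  basis_of (nilp_opp pos) f /\ forall i, tnth f i \in rootsp (- tnth pos i).

Definition rho (N : nat) (pos : N.-tuple dual) : dual :=
  2%:R^-1 *: \sum_(i < N) tnth pos i.

Definition sl2_triple (a : dual) (e h f : g) :=
  [/\ e != 0, e \in rootsp a, f \in rootsp (- a) &
      [/\ lie e f = h, lie h e = 2%:R *: e & lie h f = - (2%:R *: f)]].

Section GelfandTsetlin.
Variables (e h f : g).

(* U(s_theta), as the subalgebra of U(g) generated by s_theta. *)
Definition uenv_sl2 : uenv -> Prop :=
  subalg_gen (fun u => exists2 x, x \in <<[:: e; h; f]>>%VS & u = uinj x).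

Definition Gamma : uenv -> Prop :=
  subalg_gen (fun u =>
    (exists2 x, x \in hs & u = uinj x) \/ center_of uenv_sl2 u).

Variables (M : lmodType F) (pi : g -> M -> M).

Definition GT_component (chi : uenv -> F) (v : M) :=
  exists k : nat, forall a, Gamma a ->
    uenv_act pi ((a - chi a *: 1) ^+ k) v = 0.

Definition theta_GT_module :=
  (forall v, exists (n : nat) (chi : 'I_n -> uenv -> F) (w : 'I_n -> M),
     (forall i, is_character Gamma (chi i) /\ GT_component (chi i) (w i)) /\
     v = \sum_i w i) /\
  (forall (n : nat) (chi : 'I_n -> uenv -> F) (w : 'I_n -> M),
     (forall i, is_character Gamma (chi i) /\ GT_component (chi i) (w i)) ->
     (forall i j, i != j -> exists2 a, Gamma a & chi i a != chi j a) ->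
     \sum_i w i = 0 -> forall i, w i = 0).

End GelfandTsetlin.
End Roots.
End LieTheory.

Section PowerSeries.
Variable F : fieldType.

Definition exp_coef (k : nat) : F := (k`!%:R)^-1.

Fixpoint todd_seq (k : nat) : seq F :=
  if k is j.+1 then
    rcons (todd_seq j)
      (exp_coef j - \sum_(i < j) (todd_seq j)`_i * exp_coef (j.+1 - i))
  else [::].

(* The coefficients of t e^t / (e^t - 1). *)
Definition todd_coef (k : nat) : F := (todd_seq k.+1)`_k.

Lemma todd_coefP k :
  \sum_(i < k.+1) todd_coef i * exp_coef (k.+1 - i) = exp_coef k.
Proof.
have sz j : size (todd_seq j) = j by elim: j => //= j IH; rewrite size_rcons IH.
have nthE j i : (i < j)%N -> (todd_seq j)`_i = todd_coef i.
  elim: j => // j IH; rewrite ltnS leq_eqVlt => /orP[/eqP->//|ij].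
  by rewrite /= nth_rcons sz ij IH.
rewrite big_ord_recr /= subSnn (_ : exp_coef 1 = 1) ?mulr1; last first.
  by rewrite /exp_coef invr1.
rewrite [X in _ + X]/todd_coef /= nth_rcons sz ltnn eqxx addrC -addrA.
rewrite [X in _ + X](_ : _ = 0) ?addr0 //.
rewrite addrC -sumrB big1 // => i _.
by rewrite nthE // subrr.
Qed.

(* The power series with coefficients c evaluated at a nilpotent T: the sum is
   cut at an exponent at which T vanishes. *)
Definition nilp_series (P : algType F) (M : lmodType P) (c : nat -> F)
    (T : M -> M) (v : M) : M :=
  let K := xget 0%N [set k | forall w, iter k T w = 0] in
  \sum_(k < K) (c k)%:A *: iter k T v.

End PowerSeries.

Section DiffOp.
Variables (F : fieldType) (N : nat).
Local Notation P := {mpoly F[N]}.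

(* P (x) V is represented by coordinates in a basis of V; tens p v is the pure
   tensor p (x) v, and ext_hom, ext_form, ext_lie are P-(bi)linear extensions. *)
Definition ptens (V : vectType F) := 'rV[P]_(\dim {:V}).

Definition tens (V : vectType F) (p : P) (v : V) : ptens V :=
  \row_j (coord (vbasis {:V}) j v *: p).

Definition ext_hom (V W : vectType F) (phi : V -> W) (w : ptens V) : ptens W :=
  \sum_(j < \dim {:V}) tens (w 0 j) (phi (vbasis {:V})`_j).

Definition ext_form (V : vectType F) (phi : V -> F) (w : ptens V) : P :=
  \sum_(j < \dim {:V}) phi (vbasis {:V})`_j *: w 0 j.

Definition ext_lie (g : lieAlgType F) (v w : ptens g) : ptens g :=
  \sum_(i < \dim {:g}) \sum_(j < \dim {:g})
    tens (v 0 i * w 0 j) (lie (vbasis {:g})`_i (vbasis {:g})`_j).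

Variables (g : lieAlgType F) (hs : {vspace g}) (pos : N.-tuple (dual hs)).
Variable f : N.-tuple g.

(* u(x) *)
Definition generic_elt : ptens g := \sum_(i < N) tens 'X_i (tnth f i).
Definition ad_u : ptens g -> ptens g := ext_lie generic_elt.

(* e^{- ad u(x)} (1 (x) a) *)
Definition exp_ad_opp (a : g) : ptens g :=
  nilp_series (@exp_coef F) (fun w => - ad_u w) (tens 1 a).

Definition proj_nilp_opp : g -> g :=
  daddv_pi (nilp_opp pos) (hs + nilp pos)%VS.
Definition proj_cartan : g -> g :=
  daddv_pi hs (nilp_opp pos + nilp pos)%VS.

Definition wpoly (p : P) : weyl F N := mmap (in_alg (weyl F N)) (@wx F N) p.

Definition diff_op (mu : dual hs) (a : g) : weyl F N :=
  - (\sum_(i < N)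
       wpoly (ext_form (coord f i)
         (nilp_series (@todd_coef F) ad_u
            (ext_hom proj_nilp_opp (exp_ad_opp a)))) * wd F i)
  + wpoly (ext_form (fun y => mu (vsproj hs y))
             (ext_hom proj_cartan (exp_ad_opp a))).

End DiffOp.

(* Main.v *)
Require Import Defs.
From HB Require Import structures.
From mathcomp Require Import all_boot all_order all_algebra.
From mathcomp Require Import boolp classical_sets reals complex mpoly ring.

Set Implicit Arguments.
Unset Strict Implicit.
Unset Printing Implicit Defensive.

Import GRing.Theory Num.Theory.
Local Open Scope ring_scope.

(** Let u = u(x), T = ad u, A_a = e^(-T) a for a in g, and let Y_a and H_a be
    the parts of A_a in nbar and h.  With phi(t) = t e^t / (e^t - 1) and
    psi(t) = (1 - e^(-t)) / t, so that phi psi = 1, the operator of a is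
    D_a + mu(H_a), where D_a is the vector field on nbar with
    D_a u = - phi(T) Y_a, that is, psi(T) (D_a u) = - Y_a.  Geometrically D_a
    is the action of a on the open cell of the flag variety in the exponential
    chart, and - Y_a is its logarithmic derivative.

    It represents g for every linear form mu on h.  The rule
    D e^(-T) = e^(-T) D - ad(psi(T) (D u)) e^(-T) for a vector field D
    ([derivation_exp]) gives D_a A_b = [Y_a, A_b] ([flow_exp_opp]), and e^(-T)
    preserves brackets ([exp_ext_lie]).  The h-part of these relations is
    D_a H_b - D_b H_a = H_[a,b] ([flow_cartan_part]); the nbar-part is a
    Maurer-Cartan equation ([flow_nilp_part]), from which [D_a, D_b] = D_[a,b]
    follows because g has trivial centre ([flow_coef_bracket]).  Hence
    a |-> D_a + mu(H_a) is a morphism from g to the Weyl algebra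
    ([diff_op_lie]), and every module over the Weyl algebra becomes a g-module.

    On the polynomials in the d_alpha (alpha <> theta) and x_theta, the Cartan
    subalgebra is diagonal on monomials ([act_cartan]); f_theta acts as
    - d/dx_theta since theta is maximal ([act_maximal_root]); and a root vector
    f_beta acts as - d_beta plus terms that do not raise the degree in the
    d_alpha ([act_root_vector]).  The sl2-relations and the weights force
    e_theta x_theta^k to be a multiple of x_theta^(k+1), nonzero for large k
    ([e_th_Xth]).  So one large power of x_theta generates all powers, and
    then, by induction on the degree in the d_alpha, everything
    ([pi_cyclic]).

    The Gelfand-Tsetlin property only uses that h is diagonalizable and that
    f_theta is locally nilpotent ([pi_theta_GT]).  In a weight space, the
    kernels of the powers of f_theta are stable under Gamma_theta, which acts
    on each successive quotient through one character ([Gamma_filtration]):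
    a central element of U(s_theta) acts on a vector killed by f_theta by a
    scalar depending only on the weight ([center_scalar]).  A vector killed by
    a product of such character shifts splits into generalized eigenvectors
    ([killed_by_split]). *)

(** * Finite sums and independence of components *)

Lemma sum_triangle (V : zmodType) (G : nat -> nat -> V) (M : nat) :
  (forall i j, (M <= i)%N || (M <= j)%N -> G i j = 0) ->
  \sum_(n < M + M) \sum_(i < n.+1) G i (n - i)%N =
  \sum_(i < M) \sum_(j < M) G i j.
Proof.
move=> G0.
have step1 (n : 'I_(M + M)) : \sum_(i < n.+1) G i (n - i)%N =
    \sum_(i < M) \sum_(j < M | (i + j)%N == n) G i j.
  rewrite (bigID (fun i : 'I_n.+1 => (i < M)%N)) /=.
  rewrite [X in _ + X]big1 ?addr0; last first.
    by move=> i; rewrite -leqNgt => Mi; apply: G0; rewrite Mi.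
  have -> : \sum_(i < n.+1 | (i < M)%N) G i (n - i)%N =
    \sum_(i < M | (i < n.+1)%N) G i (n - i)%N.
    transitivity (\sum_(0 <= i < n.+1 | (i < M)%N) G i (n - i)%N).
      by rewrite big_mkord.
    transitivity (\sum_(0 <= i < M | (i < n.+1)%N) G i (n - i)%N); last first.
      by rewrite big_mkord.
    have aux (A B : nat) (T : nat -> V) : \sum_(0 <= i < A | (i < B)%N) T i =
        \sum_(0 <= i < A + B | (i < B)%N && (i < A)%N) T i.
      rewrite [RHS](@big_cat_nat _ _ _ A) ?leq_addr //= [RHS]addrC -[LHS]add0r.
      congr (_ + _).
        rewrite big_nat_cond big1 // => i.
        by case/andP=> /andP[Ai _] /andP[_]; rewrite ltnNge Ai.
      rewrite big_nat_cond [RHS]big_nat_cond; apply: eq_bigl => i.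
      by rewrite leq0n /=; case: (i < A)%N; rewrite ?andbT ?andbF.
    rewrite aux [RHS]aux addnC; apply: eq_bigl => i; exact: andbC.
  rewrite big_mkcond; apply: eq_bigr => i _; case: ifP => [|/negbT]; last first.
    rewrite -leqNgt => ni; rewrite big1 // => j /eqP E.
    by move: ni; rewrite -E ltnNge leq_addr.
  rewrite ltnS => ni; case: (ltnP (n - i) M) => nM.
    rewrite (bigD1 (Ordinal nM)) ?subnKC //= big1 ?addr0 // => j /andP[/eqP E].
    by rewrite -val_eqE /= -E addKn eqxx.
  rewrite big1 => [|j /eqP E]; first by apply: G0; rewrite nM orbT.
  by move: nM; rewrite -E addKn leqNgt ltn_ord.
rewrite (eq_bigr _ (fun n _ => step1 n)) exchange_big /=; apply: eq_bigr => i _.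
under eq_bigr => n _ do rewrite big_mkcond /=.
rewrite exchange_big /=; apply: eq_bigr => j _; rewrite -big_mkcond /=.
have ltij : (i + j < M + M)%N.
  by rewrite -addSn leq_add // ltnW.
by rewrite (bigD1 (Ordinal ltij)) //= big1 ?addr0 // => n /andP[/eqP E];
  rewrite -val_eqE /= -E eqxx.
Qed.

(** The argument for the independence of eigenvectors: a component is removed by
    an operator Q that kills it, and Q is injective on the component kept. *)
Lemma independent_components (V : zmodType) (I : eqType)
    (P : I -> V -> Prop) :
  (forall i j w, i != j -> P j w ->
     exists2 Q : V -> V, Q w = 0 &
       [/\ {morph Q : x y / x + y}, forall l v, P l v -> P l (Q v)
         & forall v, P i v -> Q v = 0 -> v = 0]) ->
  forall (s : seq I) (w : I -> V), uniq s -> {in s, forall i, P i (w i)} ->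
  \sum_(i <- s) w i = 0 -> {in s, forall i, w i = 0}.
Proof.
move=> sep; elim=> [|j s IH] w // /= /andP[js us] Pw.
have Pj : P j (w j) by apply: Pw; rewrite mem_head.
have Ps : {in s, forall i, P i (w i)}.
  by move=> i si; apply: Pw; rewrite inE si orbT.
rewrite big_cons => sw0.
have ws0 : {in s, forall i, w i = 0}.
  move=> i si; have ij : i != j by apply: contraNneq js => <-.
  have [Q Qw [QD QP Qinj]] := sep _ _ _ ij Pj.
  apply: Qinj (Ps _ si) _.
  have Q0 : Q 0 = 0 by apply: (addIr (Q 0)); rewrite -QD !add0r.
  apply: (IH (Q \o w)) => // [l sl|]; first exact/QP/Ps.
  have := congr1 Q sw0; rewrite QD Qw add0r Q0.
  by rewrite (big_morph Q QD Q0).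
move=> i; rewrite inE => /predU1P[->|/ws0//].
by move: sw0; rewrite big1_seq ?addr0 // => l /andP[_ /ws0].
Qed.

(** * Polynomial families in a vector space and in a Lie algebra *)

Section PTens.
Variables (F : fieldType) (N : nat).
Local Notation P := {mpoly F[N]}.

Section OneSpace.
Variable V : vectType F.
Implicit Types (v : V) (p q : P) (w : ptens N V).

Lemma tensDr p v v' : tens p (v + v') = tens p v + tens p v'.
Proof. by apply/rowP => j; rewrite !mxE linearD scalerDl. Qed.
Lemma tensZr c p v : tens p (c *: v) = c%:A *: tens p v.
Proof. by apply/rowP => j; rewrite !mxE linearZ -scalerA -scalerAl mul1r. Qed.
Lemma tensDl p q v : tens (p + q) v = tens p v + tens q v.
Proof. by apply/rowP => j; rewrite !mxE scalerDr. Qed.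
Lemma tensM p q v : tens (p * q) v = p *: tens q v.
Proof. by apply/rowP => j; rewrite !mxE scalerAr. Qed.
Lemma tensE p v : tens p v = p *: tens 1 v.
Proof. by rewrite -tensM mulr1. Qed.
Lemma tens0r p : tens p (0 : V) = 0.
Proof. by apply/rowP => j; rewrite !mxE linear0 scale0r. Qed.
Lemma tens0l v : tens (0 : P) v = 0.
Proof. by rewrite tensE scale0r. Qed.
Lemma tensNr p v : tens p (- v) = - tens p v.
Proof. by rewrite -scaleN1r tensZr scaleN1r scaleNr scale1r. Qed.
Lemma tensBr p v v' : tens p (v - v') = tens p v - tens p v'.
Proof. by rewrite tensDr tensNr. Qed.
Lemma tensZl c p v : tens (c *: p) v = tens p (c *: v).
Proof. by rewrite tensZr -tensM -scalerAl mul1r. Qed.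
Lemma tens_sumr (I : Type) (r : seq I) p (v : I -> V) :
  tens p (\sum_(i <- r) v i) = \sum_(i <- r) tens p (v i).
Proof. by apply: (big_morph (tens p)); [apply: tensDr | apply: tens0r]. Qed.

Lemma ptens_basis w : w = \sum_j tens (w 0 j) (vbasis {:V})`_j.
Proof.
apply/rowP => k; rewrite summxE (bigD1 k) //= mxE.
rewrite coord_free ?(basis_free (vbasisP _)) // eqxx scale1r.
rewrite big1 ?addr0 // => j jk; rewrite mxE.
by rewrite coord_free ?(basis_free (vbasisP _)) // (negPf jk) scale0r.
Qed.

(** (Bi)linear identities over the polynomials need only be checked on pure
    tensors, where they reduce to identities over the base field. *)
Lemma ptens_ind (Q : ptens N V -> Prop) :
  (forall p v, Q (tens p v)) -> (forall w w', Q w -> Q w' -> Q (w + w')) ->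
  forall w, Q w.
Proof.
move=> Qt QD w; rewrite (ptens_basis w).
by apply: big_ind => //; rewrite -(tens0l (0 : V)).
Qed.

Lemma ext_form_lin (phi : V -> F) p w w' :
  ext_form phi (p *: w + w') = p * ext_form phi w + ext_form phi w'.
Proof.
rewrite /ext_form mulr_sumr -big_split /=; apply: eq_bigr => j _.
by rewrite !mxE scalerDr scalerAr.
Qed.
Lemma ext_form0 (phi : V -> F) : ext_form phi (0 : ptens N V) = 0.
Proof. by rewrite /ext_form big1 // => j _; rewrite mxE scaler0. Qed.
Lemma ext_formZ (phi : V -> F) p w : ext_form phi (p *: w) = p * ext_form phi w.
Proof. by have := ext_form_lin phi p w 0; rewrite ext_form0 !addr0. Qed.
Lemma ext_formD (phi : V -> F) w w' :
  ext_form phi (w + w') = ext_form phi w + ext_form phi w'.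
Proof. by have := ext_form_lin phi 1 w w'; rewrite scale1r mul1r. Qed.
Lemma ext_formN (phi : V -> F) w : ext_form phi (- w) = - ext_form phi w.
Proof. by rewrite -scaleN1r ext_formZ mulN1r. Qed.
Lemma ext_formB (phi : V -> F) w w' :
  ext_form phi (w - w') = ext_form phi w - ext_form phi w'.
Proof. by rewrite ext_formD ext_formN. Qed.
Lemma ext_form_sum (I : Type) (r : seq I) (phi : V -> F) (w : I -> ptens N V) :
  ext_form phi (\sum_(i <- r) w i) = \sum_(i <- r) ext_form phi (w i).
Proof.
by apply: (big_morph (ext_form phi)); [apply: ext_formD | apply: ext_form0].
Qed.
Lemma ext_form_tens (phi : {linear V -> F^o}) p v :
  ext_form phi (tens p v) = (phi v : F) *: p.
Proof.
rewrite /ext_form [in RHS](coord_vbasis (memvf v)) linear_sum scaler_suml.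
by apply: eq_bigr => j _; rewrite mxE [in RHS]linearZ scalerA mulrC.
Qed.

End OneSpace.

Lemma ext_hom_is_linear (V W : vectType F) (phi : V -> W) :
  linear (ext_hom phi : ptens N V -> ptens N W).
Proof.
move=> p w w'; rewrite /ext_hom scaler_sumr -big_split /=.
by apply: eq_bigr => j _; rewrite !mxE tensDl tensM.
Qed.
HB.instance Definition _ (V W : vectType F) (phi : V -> W) :=
  GRing.isLinear.Build P (ptens N V) (ptens N W) *:%R (ext_hom phi)
    (ext_hom_is_linear phi).

Lemma ext_homD (V W : vectType F) (phi : V -> W) (w w' : ptens N V) :
  ext_hom phi (w + w') = ext_hom phi w + ext_hom phi w'.
Proof. exact: linearD. Qed.
Lemma ext_homZ (V W : vectType F) (phi : V -> W) (p : P) (w : ptens N V) :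
  ext_hom phi (p *: w) = p *: ext_hom phi w.
Proof. exact: linearZ. Qed.
Lemma ext_homB (V W : vectType F) (phi : V -> W) (w w' : ptens N V) :
  ext_hom phi (w - w') = ext_hom phi w - ext_hom phi w'.
Proof. exact: linearB. Qed.
Lemma ext_hom_sum (V W : vectType F) (phi : V -> W) (I : Type) (r : seq I)
    (w : I -> ptens N V) :
  ext_hom phi (\sum_(i <- r) w i) = \sum_(i <- r) ext_hom phi (w i).
Proof. exact: linear_sum. Qed.
Lemma ext_hom_tens (V W : vectType F) (phi : {linear V -> W}) (p : P) v :
  ext_hom phi (tens p v) = tens p (phi v).
Proof.
rewrite /ext_hom [in RHS](coord_vbasis (memvf v)) linear_sum tens_sumr.
by apply: eq_bigr => j _; rewrite mxE linearZ tensZl.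
Qed.

Section Lie.
Variable g : lieAlgType F.
Implicit Types (x y z : g) (p q : P) (u v w : ptens N g).

Lemma lieDl x y z : lie (x + y) z = lie x z + lie y z.
Proof. by have := lie_linl z 1 x y; rewrite !scale1r. Qed.
Lemma lie0l z : lie (0 : g) z = 0.
Proof. by apply: (addIr (lie 0 z)); rewrite -lieDl !add0r. Qed.
Lemma lieZl c x z : lie (c *: x) z = c *: lie x z.
Proof. by have := lie_linl z c x 0; rewrite lie0l !addr0. Qed.
Lemma lieC x y : lie x y = - lie y x.
Proof.
apply/eqP; rewrite -subr_eq0 opprK; apply/eqP.
by have := liexx (x + y); rewrite linearD /= !lieDl !liexx add0r addr0 addrC.
Qed.
Lemma lieDr z x y : lie z (x + y) = lie z x + lie z y.
Proof. exact: linearD. Qed.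
Lemma lieBr z x y : lie z (x - y) = lie z x - lie z y.
Proof. exact: linearB. Qed.
Lemma lieZr z c x : lie z (c *: x) = c *: lie z x.
Proof. exact: linearZ. Qed.
Lemma lie_leibniz x y z : lie x (lie y z) = lie (lie x y) z + lie y (lie x z).
Proof.
have /eqP := lie_jacobi x y z; rewrite -addrA addr_eq0 => /eqP ->.
by rewrite opprD (lieC z (lie x y)) opprK addrC (lieC z x) linearN opprK.
Qed.

Lemma ext_lie_is_linear u : linear (ext_lie u).
Proof.
move=> p v w; rewrite /ext_lie scaler_sumr -big_split /=; apply: eq_bigr => i _.
rewrite scaler_sumr -big_split /=; apply: eq_bigr => j _.
by rewrite !mxE mulrDr tensDl mulrCA (tensM p).
Qed.
HB.instance Definition _ u :=
  GRing.isLinear.Build P (ptens N g) (ptens N g) *:%R (ext_lie u)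
    (ext_lie_is_linear u).

Lemma ext_lie_linl w p u v :
  ext_lie (p *: u + v) w = p *: ext_lie u w + ext_lie v w.
Proof.
rewrite /ext_lie scaler_sumr -big_split /=; apply: eq_bigr => i _.
rewrite scaler_sumr -big_split /=; apply: eq_bigr => j _.
by rewrite !mxE mulrDl tensDl -mulrA (tensM p).
Qed.
Lemma ext_lieDl u v w : ext_lie (u + v) w = ext_lie u w + ext_lie v w.
Proof. by have := ext_lie_linl w 1 u v; rewrite !scale1r. Qed.
Lemma ext_lie0l w : ext_lie 0 w = 0.
Proof. by apply: (addIr (ext_lie 0 w)); rewrite -ext_lieDl !add0r. Qed.
Lemma ext_lieZl p u w : ext_lie (p *: u) w = p *: ext_lie u w.
Proof. by have := ext_lie_linl w p u 0; rewrite ext_lie0l !addr0. Qed.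
Lemma ext_lieNl u w : ext_lie (- u) w = - ext_lie u w.
Proof. by rewrite -scaleN1r ext_lieZl scaleN1r. Qed.
Lemma ext_lie_suml (I : Type) (r : seq I) (u : I -> ptens N g) w :
  ext_lie (\sum_(i <- r) u i) w = \sum_(i <- r) ext_lie (u i) w.
Proof.
by elim: r => [|i r IH]; rewrite ?big_nil ?ext_lie0l ?big_cons ?ext_lieDl ?IH.
Qed.

Lemma ext_lieDr w u v : ext_lie w (u + v) = ext_lie w u + ext_lie w v.
Proof. exact: linearD. Qed.
Lemma ext_lie0r w : ext_lie w 0 = 0.
Proof. exact: linear0. Qed.
Lemma ext_lieZr w p u : ext_lie w (p *: u) = p *: ext_lie w u.
Proof. exact: linearZ. Qed.
Lemma ext_lieNr w u : ext_lie w (- u) = - ext_lie w u.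
Proof. exact: linearN. Qed.
Lemma ext_lieMnr w u n : ext_lie w (u *+ n) = ext_lie w u *+ n.
Proof. exact: linearMn. Qed.
Lemma ext_lie_sumr (I : Type) (r : seq I) (u : I -> ptens N g) w :
  ext_lie w (\sum_(i <- r) u i) = \sum_(i <- r) ext_lie w (u i).
Proof. exact: linear_sum. Qed.

Lemma ext_lie_tens p q x y : ext_lie (tens p x) (tens q y) = tens (p * q) (lie x y).
Proof.
rewrite /ext_lie [in RHS](coord_vbasis (memvf x)) [in RHS](coord_vbasis (memvf y)).
rewrite (big_morph (lie^~ _) (fun x x' => lieDl x x' _) (lie0l _)) tens_sumr.
apply: eq_bigr => i _; rewrite linear_sum tens_sumr; apply: eq_bigr => j _.
by rewrite !mxE linearZ /= lieZl -!tensZl -scalerAl -scalerAr.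
Qed.

Lemma ext_lieC u v : ext_lie u v = - ext_lie v u.
Proof.
elim/ptens_ind: u v => [p x|u u' IH IH'] v; last first.
  by rewrite ext_lieDl IH IH' ext_lieDr opprD.
elim/ptens_ind: v => [q y|v v' IH IH']; last first.
  by rewrite ext_lieDr IH IH' ext_lieDl opprD.
by rewrite !ext_lie_tens lieC tensNr mulrC.
Qed.

Lemma ext_lie_leibniz u v w :
  ext_lie u (ext_lie v w) = ext_lie (ext_lie u v) w + ext_lie v (ext_lie u w).
Proof.
elim/ptens_ind: u v w => [p x|u u' IH IH'] v w; last first.
  by rewrite !ext_lieDl IH IH' ext_lieDr addrACA.
elim/ptens_ind: v w => [q y|v v' IH IH'] w; last first.
  by rewrite ext_lieDl !ext_lieDr !ext_lieDl IH IH' addrACA.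
elim/ptens_ind: w => [r z|w w' IH IH']; last first.
  by rewrite !ext_lieDr IH IH' addrACA.
by rewrite !ext_lie_tens lie_leibniz tensDr (mulrCA q p) mulrA.
Qed.

Lemma center_ext (z0 : forall x, (forall y, lie x y = 0) -> x = 0) u :
  (forall w, ext_lie u w = 0) -> u = 0.
Proof.
move=> u0.
(* For each monomial, the corresponding coefficients of the coordinates of u
   give an element of the centre of g. *)
have um m : \sum_j (u 0 j)@_m *: (vbasis {:g})`_j = 0.
  apply: z0 => y; have := u0 (tens 1 y).
  rewrite [in ext_lie u _](ptens_basis u) ext_lie_suml.
  under eq_bigr do rewrite ext_lie_tens mulr1.
  move=> u0y; rewrite (big_morph (lie^~ _) (fun x x' => lieDl x x' _) (lie0l _)).
  rewrite [LHS](coord_vbasis (memvf _)) big1 // => k _.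
  have := congr1 (fun w : ptens N g => (w 0 k)@_m) u0y.
  rewrite mxE mcoeff0 summxE raddf_sum /= => E.
  rewrite linear_sum /= [X in X *: _](_ : _ = 0) ?scale0r // -[RHS]E.
  by apply: eq_bigr => j _; rewrite mxE lieZl linearZ /= mcoeffZ mulrC.
apply/rowP => j; rewrite mxE; apply/mpolyP => m; rewrite mcoeff0.
have /freeP := basis_free (vbasisP {:g}).
by move/(_ (fun j => (u 0 j)@_m) (um m) j).
Qed.

End Lie.
End PTens.

(** * Power series evaluated at a nilpotent operator *)

Section SeriesCoefficients.
Variable F : numFieldType.
Implicit Types c d : nat -> F.

Definition conv c d (n : nat) : F := \sum_(i < n.+1) c i * d (n - i)%N.

(** The coefficients of e^(-t), (1 - e^(-t)) / t and (e^t - 1) / t. *)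
Definition expN_coef (k : nat) : F := (-1) ^+ k * exp_coef F k.
Definition expN_quot_coef (k : nat) : F := (-1) ^+ k * exp_coef F k.+1.
Definition exp_quot_coef (k : nat) : F := exp_coef F k.+1.

Lemma convC c d n : conv c d n = conv d c n.
Proof.
rewrite /conv (reindex_inj rev_ord_inj) /=; apply: eq_bigr => i _.
by rewrite subSS subKn ?leq_ord // mulrC.
Qed.

Lemma exp_coef_bin n i : (i <= n)%N ->
  exp_coef F n * ('C(n, i))%:R = exp_coef F i * exp_coef F (n - i).
Proof.
move=> le_in; rewrite /exp_coef -(bin_fact le_in) !natrM invfM.
have n0 m : (m`!)%:R != 0 :> F by rewrite pnatr_eq0 -lt0n fact_gt0.
have b0 : ('C(n, i))%:R != 0 :> F by rewrite pnatr_eq0 -lt0n bin_gt0.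
by rewrite mulrAC mulVf // mul1r invfM.
Qed.

Lemma expN_coef_bin n i : (i <= n)%N ->
  expN_coef n * ('C(n, i))%:R = expN_coef i * expN_coef (n - i).
Proof.
move=> le_in; rewrite /expN_coef -mulrA exp_coef_bin // mulrACA -exprD.
by rewrite subnKC.
Qed.

Lemma expN_quot_coef_bin n i : (i <= n)%N ->
  expN_coef n.+1 * ('C(n.+1, i.+1))%:R = - (expN_quot_coef i * expN_coef (n - i)).
Proof.
move=> le_in; rewrite /expN_coef /expN_quot_coef -mulrA exp_coef_bin // subSS.
by rewrite mulrACA -exprD subnKC // exprS mulN1r mulNr.
Qed.

(** n! times the left-hand side is the binomial expansion of (1 - 1)^n. *)
Lemma conv_expN_exp n : conv expN_coef (exp_coef F) n = (n == 0)%:R.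
Proof.
transitivity (exp_coef F n * (1 - 1) ^+ n).
  rewrite exprBn mulr_sumr; apply: eq_bigr => i _.
  by rewrite /expN_coef !expr1n !mulr1 -mulr_natr mulrCA exp_coef_bin ?leq_ord // mulrA.
by rewrite subrr expr0n; case: n => [|n]; rewrite ?mulr0 // /exp_coef invr1 mulr1.
Qed.

Lemma conv_expN_exp_quot n : conv expN_coef exp_quot_coef n = expN_quot_coef n.
Proof.
have := conv_expN_exp n.+1; rewrite /conv big_ord_recr /= subnn => /eqP.
rewrite addr_eq0 => /eqP.
rewrite /expN_coef /expN_quot_coef exprS -mulrA mulN1r mulNr opprK.
rewrite [exp_coef F 0]/exp_coef invr1 mulr1 => <-.
by apply: eq_bigr => i _; rewrite /exp_quot_coef -subSn // leq_ord.
Qed.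

Lemma conv_todd_exp_quot n : conv (todd_coef F) exp_quot_coef n = exp_coef F n.
Proof.
rewrite -todd_coefP; apply: eq_bigr => i _.
by rewrite /exp_quot_coef -subSn // leq_ord.
Qed.

End SeriesCoefficients.
Arguments expN_coef {F}.
Arguments expN_quot_coef {F}.
Arguments exp_quot_coef {F}.

Lemma scaler_comm_lin (R : comNzRingType) (M : lmodType R) (a p : R) (v w : M) :
  a *: (p *: v + w) = p *: (a *: v) + a *: w.
Proof. by rewrite scalerDr !scalerA mulrC. Qed.

Section NilpotentSeries.
Variables (F : numFieldType) (N : nat) (V : vectType F).
Local Notation P := {mpoly F[N]}.
Local Notation M := (ptens N V).
Variable T : {linear M -> M}.
Implicit Types (c d : nat -> F) (v w : M).

Definition series K c w : M := \sum_(k < K) (c k)%:A *: iter k T w.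

Lemma scaleAA (a b : F) w : a%:A *: (b%:A *: w) = (a * b)%:A *: w :> M.
Proof. by rewrite !scalerA -scalerAl mul1r scalerA. Qed.

Lemma scaleAMn (a : F) n w : a%:A *: (w *+ n) = (a * n%:R)%:A *: w.
Proof.
rewrite -scaler_nat scalerA -scalerAl mul1r; congr (_ *: _).
by rewrite -scalerA scaler_nat.
Qed.

Lemma iter_linear k p v w : iter k T (p *: v + w) = p *: iter k T v + iter k T w.
Proof. by elim: k => //= k ->; rewrite linearP. Qed.

Lemma series_is_linear K c : linear (series K c).
Proof.
move=> p v w; rewrite /series scaler_sumr -big_split /=; apply: eq_bigr => k _.
by rewrite iter_linear; apply: scaler_comm_lin.
Qed.
HB.instance Definition _ K c :=
  GRing.isLinear.Build P M M *:%R (series K c) (series_is_linear K c).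

Lemma series0 K c : series K c 0 = 0.
Proof. exact: linear0. Qed.
Lemma seriesD K c v w : series K c (v + w) = series K c v + series K c w.
Proof. exact: linearD. Qed.
Lemma seriesN K c v : series K c (- v) = - series K c v.
Proof. exact: linearN. Qed.
Lemma seriesZ K c p v : series K c (p *: v) = p *: series K c v.
Proof. exact: linearZ. Qed.

Variable K : nat.
Hypothesis TK : forall w, iter K T w = 0.

Lemma iter_ge k w : (K <= k)%N -> iter k T w = 0.
Proof. by move=> /subnK <-; rewrite addnC iterD TK. Qed.

Lemma series_trunc L c w : (K <= L)%N -> series L c w = series K c w.
Proof.
move=> KL; rewrite /series -!(big_mkord xpredT (fun k => (c k)%:A *: iter k T w)).
rewrite (@big_cat_nat _ _ _ K) //= [X in _ + X]big_nat_cond [X in _ + X]big1 ?addr0 //.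
by move=> k; rewrite andbT => /andP[Kk _]; rewrite iter_ge // scaler0.
Qed.

Lemma nilp_seriesE c w : nilp_series c T w = series K c w.
Proof.
rewrite /nilp_series; set L := xget _ _.
have TL v : iter L T v = 0.
  by apply: (@xgetPex _ 0 [set k | forall w, iter k T w = 0]%classic) v; exists K.
rewrite -/(series L c w); case: (leqP K L) => [/series_trunc-> //|/ltnW LK].
rewrite /series -!(big_mkord xpredT (fun k => (c k)%:A *: iter k T w)).
rewrite [RHS](@big_cat_nat _ _ _ L) //= [X in _ + X]big_nat_cond.
rewrite [X in _ + X]big1 ?addr0 // => k; rewrite andbT => /andP[Lk _].
by rewrite -(subnK Lk) addnC iterD TL scaler0.
Qed.

(** The terms with i or j at least K vanish, so the Cauchy product may be summed
    over a square. *)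
Lemma seriesM c d w : series K c (series K d w) = series K (conv c d) w.
Proof.
rewrite -[RHS](@series_trunc (K + K)) ?leq_addr //.
pose G i j := (c i * d j)%:A *: iter (i + j) T w.
transitivity (\sum_(i < K) \sum_(j < K) G i j).
  rewrite [LHS]/series; apply: eq_bigr => i _.
  have -> : iter i T (series K d w) = \sum_(j < K) (d j)%:A *: iter (i + j) T w.
    rewrite /series; elim: (val i) => //= n ->; rewrite linear_sum.
    by apply: eq_bigr => j _; rewrite linearZ.
  by rewrite scaler_sumr; apply: eq_bigr => j _; rewrite scaleAA.
rewrite -sum_triangle => [|i j]; last first.
  rewrite /G; case/orP=> le; rewrite iter_ge ?scaler0 //.
    exact: leq_trans le (leq_addr _ _).
  exact: leq_trans le (leq_addl _ _).
apply: eq_bigr => n _; rewrite /conv !scaler_suml; apply: eq_bigr => i _.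
by rewrite /G subnKC // leq_ord.
Qed.

Lemma eq_series c d w : c =1 d -> series K c w = series K d w.
Proof. by move=> cd; apply: eq_bigr => k _; rewrite cd. Qed.

Lemma series_delta w : series K (fun n => (n == 0)%:R) w = w.
Proof.
rewrite /series; case: K TK => [|k] TK0.
  by rewrite big_ord0; have := TK0 w.
rewrite big_ord_recl /= !scale1r big1 ?addr0 // => i _.
by rewrite scale0r scale0r.
Qed.

Lemma series_expNK w : series K expN_coef (series K (exp_coef F) w) = w.
Proof. by rewrite seriesM (eq_series _ (@conv_expN_exp F)) series_delta. Qed.

(** (1 - e^(-t)) / t = e^(-t) (e^t - 1) / t, and the Todd series times
    (e^t - 1) / t is e^t. *)
Lemma series_toddK w : series K expN_quot_coef (series K (todd_coef F) w) = w.
Proof.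
rewrite -(eq_series _ (@conv_expN_exp_quot F)) -seriesM [X in series _ _ X]seriesM.
rewrite -[RHS]series_expNK; congr (series _ _ _); apply: eq_series => n.
by rewrite convC conv_todd_exp_quot.
Qed.

Lemma series_quot_toddK w : series K (todd_coef F) (series K expN_quot_coef w) = w.
Proof.
rewrite seriesM -[RHS]series_toddK seriesM.
by apply: eq_series => n; apply: convC.
Qed.

Lemma series_expN_quot w : T (series K expN_quot_coef w) = w - series K expN_coef w.
Proof.
rewrite -[in RHS](@series_trunc K.+1) // [in RHS]/series big_ord_recl /=.
have -> : expN_coef 0 = 1 :> F by rewrite /expN_coef /exp_coef invr1 mulr1.
rewrite scale1r scale1r opprD addNKr linear_sum -sumrN; apply: eq_bigr => k _.
rewrite linearZ -scaleNr -scaleNr /expN_quot_coef /expN_coef /bump leq0n add1n.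
by rewrite exprS -mulrA mulN1r opprK.
Qed.

End NilpotentSeries.

(** * Polynomial vector fields and the derivative of the exponential *)

Section VectorFields.
Variables (F : fieldType) (N : nat).
Local Notation P := {mpoly F[N]}.
Implicit Types (q : 'I_N -> P) (p : P).

Definition vfield q p : P := \sum_i q i * mderiv i p.

Lemma vfield_is_linear q : linear (vfield q).
Proof.
move=> c p r; rewrite /vfield scaler_sumr -big_split /=; apply: eq_bigr => i _.
by rewrite mderivD mderivZ mulrDr -scalerAr.
Qed.
HB.instance Definition _ q :=
  GRing.isLinear.Build F P P *:%R (vfield q) (vfield_is_linear q).

Lemma vfieldM q p r : vfield q (p * r) = vfield q p * r + p * vfield q r.
Proof.
rewrite /vfield mulr_suml mulr_sumr -big_split /=; apply: eq_bigr => i _.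
by rewrite mderivM; ring.
Qed.
Lemma vfield1 q : vfield q 1 = 0.
Proof. by rewrite /vfield big1 // => i _; rewrite -mpolyC1 mderivC mulr0. Qed.
Lemma vfieldX q i : vfield q 'X_i = q i.
Proof.
rewrite /vfield (bigD1 i) //= big1 ?addr0 => [|j ji]; rewrite -['X_i]mulr1 mderivXM.
  by rewrite eqxx scale1r -mpolyC1 mderivC mulr0 addr0 mulr1.
by rewrite (negPf ji) scale0r -mpolyC1 mderivC mulr0 addr0 mulr0.
Qed.

Section OneSpace.
Variable V : vectType F.
Implicit Types (v : V) (w : ptens N V).

Definition vfield_tens q w : ptens N V := \row_j vfield q (w 0 j).

Lemma vfield_tensD q w w' :
  vfield_tens q (w + w') = vfield_tens q w + vfield_tens q w'.
Proof. by apply/rowP => j; rewrite !mxE linearD. Qed.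
Lemma vfield_tens_scale q p w :
  vfield_tens q (p *: w) = vfield q p *: w + p *: vfield_tens q w.
Proof. by apply/rowP => j; rewrite !mxE vfieldM. Qed.
Lemma vfield_tensA q (c : F) w :
  vfield_tens q (c%:A *: w) = c%:A *: vfield_tens q w.
Proof.
by rewrite vfield_tens_scale linearZ /= vfield1 scaler0 scale0r add0r.
Qed.
Lemma vfield_tens0 q : vfield_tens q (0 : ptens N V) = 0.
Proof. by apply/rowP => j; rewrite !mxE linear0. Qed.
Lemma vfield_tens_sum (I : Type) (r : seq I) q (w : I -> ptens N V) :
  vfield_tens q (\sum_(i <- r) w i) = \sum_(i <- r) vfield_tens q (w i).
Proof.
by apply: (big_morph (vfield_tens q)); [apply: vfield_tensD | apply: vfield_tens0].
Qed.
Lemma vfield_tens_tens q p v : vfield_tens q (tens p v) = tens (vfield q p) v.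
Proof. by apply/rowP => j; rewrite !mxE linearZ. Qed.

Lemma vfield_ext_form q (phi : {linear V -> F^o}) w :
  ext_form phi (vfield_tens q w) = vfield q (ext_form phi w).
Proof.
elim/ptens_ind: w => [p v|w w' IH IH'].
  by rewrite vfield_tens_tens !ext_form_tens linearZ.
by rewrite vfield_tensD !ext_formD IH IH' linearD.
Qed.
End OneSpace.

Lemma vfield_ext_hom (V W : vectType F) q (phi : {linear V -> W}) w :
  ext_hom phi (vfield_tens q w) = vfield_tens q (ext_hom phi w).
Proof.
elim/ptens_ind: w => [p v|w w' IH IH'].
  by rewrite vfield_tens_tens !ext_hom_tens vfield_tens_tens.
by rewrite vfield_tensD !ext_homD IH IH' vfield_tensD.
Qed.

Lemma vfield_ext_lie (g : lieAlgType F) q (v w : ptens N g) :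
  vfield_tens q (ext_lie v w) =
  ext_lie (vfield_tens q v) w + ext_lie v (vfield_tens q w).
Proof.
elim/ptens_ind: v w => [p x|v v' IH IH'] w; last first.
  by rewrite ext_lieDl !vfield_tensD IH IH' !ext_lieDl addrACA.
elim/ptens_ind: w => [r y|w w' IH IH']; last first.
  by rewrite ext_lieDr !vfield_tensD IH IH' !ext_lieDr addrACA.
by rewrite !(ext_lie_tens, vfield_tens_tens) vfieldM tensDl.
Qed.

Definition vbracket q r (i : 'I_N) : P := vfield q (r i) - vfield r (q i).

Lemma vbracketE q r p :
  vfield q (vfield r p) - vfield r (vfield q p) = vfield (vbracket q r) p.
Proof.
have E a b : vfield a (vfield b p) = \sum_i vfield a (b i) * mderiv i p
    + \sum_i \sum_j b i * (a j * mderiv j (mderiv i p)).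
  rewrite [vfield b p]/vfield linear_sum -big_split /=; apply: eq_bigr => i _.
  by rewrite vfieldM -mulr_sumr.
rewrite !E [X in _ + X - _]exchange_big opprD addrACA -sumrB -sumrB.
rewrite [X in _ + X]big1 ?addr0 => [|i _]; last first.
  by rewrite -sumrB big1 // => j _; rewrite mderiv_comm mulrCA subrr.
by apply: eq_bigr => i _; rewrite -mulrBl.
Qed.

End VectorFields.

Section Flow.
Variables (F : numFieldType) (N : nat) (g : lieAlgType F).
Local Notation P := {mpoly F[N]}.
Variables (u : ptens N g) (K : nat).
Local Notation T := (ext_lie u).
Hypothesis TK : forall w, iter K T w = 0.
Implicit Types (v w : ptens N g).

Lemma iter_ext_lie n v w : iter n T (ext_lie v w) =
  \sum_(i < n.+1) ext_lie (iter i T v) (iter (n - i) T w) *+ 'C(n, i).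
Proof.
elim: n => [|n IH]; first by rewrite big_ord1 subnn bin0 mulr1n.
rewrite iterS IH ext_lie_sumr [RHS]big_ord_recl subn0 bin0 mulr1n /=.
transitivity (\sum_(i < n.+1) ext_lie (iter i.+1 T v) (iter (n - i) T w) *+ 'C(n, i)
  + \sum_(i < n.+1) ext_lie (iter i T v) (iter (n.+1 - i) T w) *+ 'C(n, i)).
  rewrite -big_split /=; apply: eq_bigr => i _.
  by rewrite ext_lieMnr ext_lie_leibniz mulrnDl subSn // leq_ord.
rewrite [X in _ + X = _]big_ord_recl bin0 mulr1n subn0 addrCA; congr (_ + _).
under [RHS]eq_bigr do rewrite /bump leq0n add1n binS mulrnDr subSS.
rewrite big_split /= addrC; congr (_ + _).
rewrite [RHS]big_ord_recr /= bin_small ?ltnSn // mulr0n addr0.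
by apply: eq_bigr => i _; rewrite /bump leq0n add1n subSS.
Qed.

(** The exponential of a nilpotent derivation is an automorphism. *)
Lemma exp_ext_lie v w :
  series T K expN_coef (ext_lie v w) =
  ext_lie (series T K expN_coef v) (series T K expN_coef w).
Proof.
rewrite -[LHS](series_trunc TK _ _ (leq_addr K K)).
pose G i j := (expN_coef i * expN_coef j : F)%:A *:
   ext_lie (iter i T v) (iter j T w).
transitivity (\sum_(i < K) \sum_(j < K) G i j); last first.
  rewrite /series ext_lie_suml; apply: eq_bigr => i _.
  rewrite ext_lieZl ext_lie_sumr scaler_sumr; apply: eq_bigr => j _.
  by rewrite ext_lieZr scaleAA.
rewrite -sum_triangle => [|i j]; last first.
  rewrite /G; case/orP=> le; rewrite (iter_ge TK _ le).
    by rewrite ext_lie0l scaler0.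
  by rewrite ext_lie0r scaler0.
apply: eq_bigr => n _; rewrite iter_ext_lie scaler_sumr; apply: eq_bigr => i _.
by rewrite scaleAMn expN_coef_bin // leq_ord.
Qed.

Section Derivation.
Variables (D : ptens N g -> ptens N g) (X : ptens N g).
Hypothesis DD : {morph D : v w / v + w}.
Hypothesis DA : forall (c : F) w, D (c%:A *: w) = c%:A *: D w.
Hypothesis DT : forall w, D (T w) = T (D w) + ext_lie X w.

(** Pascal's rule, with the iterated commutators of D and T on the left: they are
    the operators ad(T^k X) by the Jacobi identity. *)
Lemma derivation_iter n w : D (iter n T w) = iter n T (D w) +
  \sum_(k < n) ext_lie (iter k T X) (iter (n.-1 - k) T w) *+ 'C(n, k.+1).
Proof.
elim: n => [|n IH]; first by rewrite big_ord0 addr0.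
rewrite iterS DT IH ext_lieDr ext_lie_sumr -addrA; congr (_ + _).
transitivity (\sum_(k < n) ext_lie (iter k.+1 T X) (iter (n.-1 - k) T w) *+ 'C(n, k.+1)
  + \sum_(k < n) ext_lie (iter k T X) (iter (n - k) T w) *+ 'C(n, k.+1)
  + ext_lie X (iter n T w)).
  congr (_ + _); rewrite -big_split /=; apply: eq_bigr => k _.
  rewrite ext_lieMnr ext_lie_leibniz mulrnDl; congr (_ + _ *+ _).
  by rewrite -iterS -subSn ?prednK //; have := ltn_ord k; case: (n) k => [[]|m k].
under [RHS]eq_bigr do rewrite binS mulrnDr.
rewrite big_split /= addrAC addrC; congr (_ + _).
  by rewrite big_ord_recr /= bin_small // mulr0n addr0.
rewrite big_ord_recl bin0 mulr1n subn0 addrC; congr (_ + _).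
apply: eq_bigr => k _; rewrite /= /bump leq0n add1n.
by rewrite subnS -subn1 subnAC subn1.
Qed.

(** The formula for the derivative of the exponential map: the sum over n and k
    of the commutators in [derivation_iter], times (-1)^n / n!, is up to sign the
    product of the series psi(T) X and e^(-T) w. *)
Lemma derivation_exp w :
  D (series T K expN_coef w) = series T K expN_coef (D w)
    - ext_lie (series T K expN_quot_coef X) (series T K expN_coef w).
Proof.
(* The indices k and j of the product occur in degree n = k + j + 1, with k and
   j below K. *)
have LK : (K <= (K + K).+1)%N by rewrite leqW // leq_addr.
have D0 : D 0 = 0 by apply: (addIr (D 0)); rewrite -DD !add0r.
rewrite -[in LHS](series_trunc TK expN_coef w LK).
rewrite -[X in X - _](series_trunc TK _ _ LK).
rewrite /series (big_morph D DD D0).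
under eq_bigr do rewrite DA derivation_iter scalerDr.
rewrite big_split /=; congr (_ + _).
rewrite big_ord_recl big_ord0 scaler0 add0r.
pose G i j := (expN_quot_coef i * expN_coef j : F)%:A *:
   ext_lie (iter i T X) (iter j T w).
transitivity (- \sum_(i < K) \sum_(j < K) G i j); last first.
  congr (- _); rewrite ext_lie_suml; apply: eq_bigr => i _.
  rewrite ext_lieZl ext_lie_sumr scaler_sumr; apply: eq_bigr => j _.
  by rewrite ext_lieZr scaleAA.
rewrite -sum_triangle => [|i j]; last first.
  rewrite /G; case/orP=> le; rewrite (iter_ge TK _ le).
    by rewrite ext_lie0l scaler0.
  by rewrite ext_lie0r scaler0.
rewrite -sumrN; apply: eq_bigr => n _; rewrite lift0 scaler_sumr -sumrN.
apply: eq_bigr => i _.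
by rewrite scaleAMn expN_quot_coef_bin ?leq_ord // scaleNr scaleNr.
Qed.

End Derivation.
End Flow.

(** * The vector fields of the Lie algebra and their brackets *)

(** pn and ph stand for the projections to nbar and h along the other summands
    of the triangular decomposition.  Since v - pn v is the part in h + n, the
    last four hypotheses say that nbar is a subalgebra without h-part and that
    brackets in h + n lie in n. *)
Section Bracket.
Variables (F : numFieldType) (N : nat) (g : lieAlgType F).
Local Notation P := {mpoly F[N]}.
Variables (f : N.-tuple g) (pn ph : {linear g -> g}) (mu : {linear g -> F^o}).
Hypothesis center0 : forall x : g, (forall y, lie x y = 0) -> x = 0.
Hypothesis f_free : free f.
Hypothesis pn_f : forall i, pn (tnth f i) = tnth f i.
Hypothesis f_coord : forall v, \sum_i coord f i (pn v) *: tnth f i = pn v.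
Hypothesis pn_id : forall v, pn (pn v) = pn v.
Hypothesis pn_lie : forall v w, pn (lie (pn v) (pn w)) = lie (pn v) (pn w).
Hypothesis ph_lie : forall v w, ph (lie (pn v) (pn w)) = 0.
Hypothesis pn_lie_b : forall v w, pn (lie (v - pn v) (w - pn w)) = 0.
Hypothesis ph_lie_b : forall v w, ph (lie (v - pn v) (w - pn w)) = 0.

Local Notation epn := (@ext_hom F N g g pn).
Local Notation eph := (@ext_hom F N g g ph).

Lemma epn_id w : epn (epn w) = epn w.
Proof.
elim/ptens_ind: w => [p x|w w' IH IH']; first by rewrite !ext_hom_tens pn_id.
by rewrite !ext_homD IH IH'.
Qed.

Lemma epn_lie v w : epn (ext_lie (epn v) (epn w)) = ext_lie (epn v) (epn w).
Proof.
elim/ptens_ind: v w => [p x|v v' IH IH'] w; last first.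
  by rewrite ext_homD ext_lieDl ext_homD IH IH'.
elim/ptens_ind: w => [q y|w w' IH IH']; last first.
  by rewrite (ext_homD _ w w') ext_lieDr ext_homD IH IH'.
by rewrite !(ext_hom_tens, ext_lie_tens) pn_lie.
Qed.

Lemma eph_lie v w : eph (ext_lie (epn v) (epn w)) = 0.
Proof.
elim/ptens_ind: v w => [p x|v v' IH IH'] w; last first.
  by rewrite ext_homD ext_lieDl ext_homD IH IH' addr0.
elim/ptens_ind: w => [q y|w w' IH IH']; last first.
  by rewrite (ext_homD _ w w') ext_lieDr ext_homD IH IH' addr0.
by rewrite !(ext_hom_tens, ext_lie_tens) ph_lie tens0r.
Qed.

Lemma ext_hom_lie_b (phi : {linear g -> g}) :
  (forall v w, phi (lie (v - pn v) (w - pn w)) = 0) ->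
  forall v w, ext_hom phi (ext_lie (v - epn v) (w - epn w)) = 0.
Proof.
move=> phi0 v w; elim/ptens_ind: v w => [p x|v v' IH IH'] w; last first.
  by rewrite ext_homD opprD addrACA ext_lieDl ext_homD IH IH' addr0.
elim/ptens_ind: w => [q y|w w' IH IH']; last first.
  by rewrite ext_homD opprD addrACA ext_lieDr ext_homD IH IH' addr0.
by rewrite !(ext_hom_tens, ext_lie_tens, =^~ tensBr) phi0 tens0r.
Qed.

Lemma ext_coord_f w : \sum_i tens (ext_form (coord f i) (epn w)) (tnth f i) = epn w.
Proof.
elim/ptens_ind: w => [p x|w w' IH IH'].
  rewrite ext_hom_tens -[in RHS]f_coord tens_sumr; apply: eq_bigr => i _.
  by rewrite ext_form_tens tensZl.
rewrite ext_homD -[in RHS]IH -[in RHS]IH' -[RHS]big_split; apply: eq_bigr => i _.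
by rewrite ext_formD tensDl.
Qed.

Local Notation u := (generic_elt f).
Local Notation T := (ext_lie u).
Variable K : nat.
Hypothesis TK : forall w, iter K T w = 0.

Lemma epn_u : epn u = u.
Proof.
rewrite /generic_elt ext_hom_sum; apply: eq_bigr => i _.
by rewrite ext_hom_tens pn_f.
Qed.

Lemma epn_series c w : epn w = w -> epn (series T K c w) = series T K c w.
Proof.
move=> wn; rewrite /series ext_hom_sum; apply: eq_bigr => k _.
rewrite ext_homZ; congr (_ *: _).
elim: (val k) => //= n IH.
have -> : T (iter n T w) = ext_lie (epn u) (epn (iter n T w)) by rewrite epn_u IH.
exact: epn_lie.
Qed.

(** These families are locked: their unfolded forms make the comparison of two
    different members very expensive. *)
Fact lock_key : unit. Proof. by []. Qed.
Definition exp_opp := locked_with lock_key (series T K expN_coef).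
Definition nilp_part := locked_with lock_key (fun a => epn (exp_opp (tens 1 a))).
Definition flow_dir := locked_with lock_key
  (fun a => series T K (todd_coef F) (nilp_part a)).
Definition flow_coef := locked_with lock_key
  (fun a i => - ext_form (coord f i) (flow_dir a) : P).
Definition cartan_part := locked_with lock_key
  (fun a => ext_form mu (eph (exp_opp (tens 1 a))) : P).

Lemma exp_oppE w : exp_opp w = series T K expN_coef w.
Proof. by rewrite /exp_opp unlock. Qed.
Lemma nilp_partE a : nilp_part a = epn (exp_opp (tens 1 a)).
Proof. by rewrite /nilp_part unlock. Qed.
Lemma flow_dirE a : flow_dir a = series T K (todd_coef F) (nilp_part a).
Proof. by rewrite /flow_dir unlock. Qed.
Lemma flow_coefE a i : flow_coef a i = - ext_form (coord f i) (flow_dir a).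
Proof. by rewrite /flow_coef unlock. Qed.
Lemma cartan_partE a : cartan_part a = ext_form mu (eph (exp_opp (tens 1 a))).
Proof. by rewrite /cartan_part unlock. Qed.

Lemma epn_nilp_part a : epn (nilp_part a) = nilp_part a.
Proof. by rewrite nilp_partE epn_id. Qed.

Lemma vfield_tens_u q : vfield_tens q u = \sum_i tens (q i) (tnth f i).
Proof.
rewrite /generic_elt vfield_tens_sum; apply: eq_bigr => i _.
by rewrite vfield_tens_tens vfieldX.
Qed.

Lemma flow_generic_elt a : vfield_tens (flow_coef a) u = - flow_dir a.
Proof.
have Zn : epn (flow_dir a) = flow_dir a.
  by rewrite flow_dirE epn_series // epn_nilp_part.
rewrite vfield_tens_u -[in RHS]Zn -ext_coord_f -sumrN; apply: eq_bigr => i _.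
by rewrite Zn flow_coefE tensE [X in _ = - X]tensE -scaleNr.
Qed.

Lemma vfield_exp_opp q w :
  vfield_tens q (exp_opp w) = exp_opp (vfield_tens q w)
    - ext_lie (series T K expN_quot_coef (vfield_tens q u)) (exp_opp w).
Proof.
rewrite !exp_oppE; apply: (derivation_exp TK) => [v v'|c v|v].
- exact: vfield_tensD.
- exact: vfield_tensA.
- by rewrite vfield_ext_lie addrC.
Qed.

Lemma vfield_exp_opp1 q b :
  vfield_tens q (exp_opp (tens 1 b)) =
  - ext_lie (series T K expN_quot_coef (vfield_tens q u)) (exp_opp (tens 1 b)).
Proof.
rewrite vfield_exp_opp vfield_tens_tens vfield1 tens0l.
by rewrite [exp_opp 0]exp_oppE series0 add0r.
Qed.

(** This is [derivation_exp], since the vector field of a satisfies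
    psi(T) (D_a u) = - Y_a. *)
Lemma flow_exp_opp a b :
  vfield_tens (flow_coef a) (exp_opp (tens 1 b)) =
  ext_lie (nilp_part a) (exp_opp (tens 1 b)).
Proof.
rewrite vfield_exp_opp1 flow_generic_elt seriesN ext_lieNl opprK.
by rewrite flow_dirE (series_toddK TK).
Qed.

Lemma exp_opp_lie a c : exp_opp (tens 1 (lie a c)) =
  ext_lie (exp_opp (tens 1 a)) (exp_opp (tens 1 c)).
Proof. by rewrite !exp_oppE -(exp_ext_lie TK) ext_lie_tens mulr1. Qed.

(** Expansion of [A_a, A_c] along A = Y + (A - Y). *)
Lemma nilp_part_bracket a c :
  ext_lie (nilp_part a) (exp_opp (tens 1 c)) -
  ext_lie (nilp_part c) (exp_opp (tens 1 a)) =
  exp_opp (tens 1 (lie a c)) + ext_lie (nilp_part a) (nilp_part c) -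
  ext_lie (exp_opp (tens 1 a) - nilp_part a) (exp_opp (tens 1 c) - nilp_part c).
Proof.
rewrite exp_opp_lie.
move: (exp_opp (tens 1 a)) (exp_opp (tens 1 c)) (nilp_part a) (nilp_part c).
move=> x z y t; rewrite ext_lieDl ext_lieNl !ext_lieDr !ext_lieNr (ext_lieC t x).
rewrite !opprD !opprK [RHS]addrACA addNKr [X in _ = _ + X]addrC subrK.
exact: addrC.
Qed.

Lemma flow_cartan_part a c :
  vfield (flow_coef a) (cartan_part c) - vfield (flow_coef c) (cartan_part a) =
  cartan_part (lie a c).
Proof.
have E a' c' : vfield (flow_coef a') (cartan_part c') =
    ext_form mu (eph (ext_lie (nilp_part a') (exp_opp (tens 1 c')))).
  by rewrite cartan_partE -flow_exp_opp vfield_ext_hom vfield_ext_form.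
rewrite !E cartan_partE -ext_formB -ext_homB nilp_part_bracket ext_homB ext_homD.
congr ext_form.
rewrite [X in _ - X](_ : _ = 0) ?subr0; last first.
  by rewrite !nilp_partE; apply: ext_hom_lie_b.
by rewrite [X in _ + X](_ : _ = 0) ?addr0 // !nilp_partE eph_lie.
Qed.

(** The Maurer-Cartan equation for a |-> Y_a. *)
Lemma flow_nilp_part a c :
  vfield_tens (flow_coef a) (nilp_part c) - vfield_tens (flow_coef c) (nilp_part a)
  = nilp_part (lie a c) + ext_lie (nilp_part a) (nilp_part c).
Proof.
have E a' c' : vfield_tens (flow_coef a') (nilp_part c') =
    epn (ext_lie (nilp_part a') (exp_opp (tens 1 c'))).
  by rewrite nilp_partE -flow_exp_opp vfield_ext_hom.
rewrite !E -ext_homB nilp_part_bracket ext_homB ext_homD.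
rewrite [X in _ - X](_ : _ = 0) ?subr0; last first.
  by rewrite !nilp_partE; apply: ext_hom_lie_b.
by congr (_ + _); [rewrite nilp_partE | rewrite !nilp_partE epn_lie].
Qed.

Lemma vfield_tens_vbracket q r (w : ptens N g) :
  vfield_tens (vbracket q r) w =
  vfield_tens q (vfield_tens r w) - vfield_tens r (vfield_tens q w).
Proof. by apply/rowP => j; rewrite !mxE vbracketE. Qed.

(** The elements A_b generate the whole module over the polynomials because
    e^(-T) is invertible. *)
Lemma exp_opp_center w : (forall b, ext_lie w (exp_opp (tens 1 b)) = 0) -> w = 0.
Proof.
move=> w0; apply: (center_ext center0) => v.
rewrite -(series_expNK TK v) -exp_oppE.
elim/ptens_ind: (series _ _ _ v) => [p b|z z' IH IH'].
  by rewrite tensE exp_oppE seriesZ -exp_oppE ext_lieZr [ext_lie _ _]w0 scaler0.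
by rewrite exp_oppE seriesD -!exp_oppE ext_lieDr IH IH' addr0.
Qed.

(** Let D be the commutator of D_a and D_c.  Both psi(T) (D u) and - Y_[a,c]
    have the same brackets with every A_b, hence coincide; apply phi(T). *)
Lemma flow_coef_bracket a c :
  vbracket (flow_coef a) (flow_coef c) =1 flow_coef (lie a c).
Proof.
set q := vbracket _ _.
have psi0 : series T K expN_quot_coef (vfield_tens q u) + nilp_part (lie a c) = 0.
  apply: exp_opp_center => b; rewrite ext_lieDl.
  apply/eqP; rewrite addr_eq0 -eqr_oppLR -vfield_exp_opp1; apply/eqP.
  rewrite vfield_tens_vbracket !flow_exp_opp !vfield_ext_lie !flow_exp_opp.
  have /eqP := flow_nilp_part a c; rewrite subr_eq => /eqP ->.
  rewrite (ext_lie_leibniz (nilp_part a)) !ext_lieDl.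
  apply/eqP; rewrite subr_eq -!addrA; apply/eqP; congr (_ + _).
  exact: addrCA.
have qE : vfield_tens q u = vfield_tens (flow_coef (lie a c)) u.
  move/eqP: psi0; rewrite addr_eq0 => /eqP psi0.
  rewrite flow_generic_elt flow_dirE -(series_quot_toddK TK (vfield_tens q u)) psi0.
  exact: seriesN.
have coefE r i : ext_form (coord f i) (vfield_tens r u) = r i.
  rewrite vfield_tens_u ext_form_sum (bigD1 i) //= big1 ?addr0 => [|j ji].
    by rewrite ext_form_tens /= (tnth_nth 0) coord_free // eqxx scale1r.
  by rewrite ext_form_tens /= (tnth_nth 0) coord_free // (negPf ji) scale0r.
by move=> i; rewrite -coefE qE coefE.
Qed.

End Bracket.

(** * Weights of a Cartan subalgebra *)

Section SumOf.
Variable V : zmodType.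
Implicit Types (Q : V -> Prop) (v w : V).

Inductive sum_of Q : V -> Prop :=
| sum_of0 : sum_of Q 0
| sum_ofS w v : Q w -> sum_of Q v -> sum_of Q (w + v).

Lemma sum_of1 Q w : Q w -> sum_of Q w.
Proof. by move=> Qw; rewrite -(addr0 w); apply: sum_ofS => //; apply: sum_of0. Qed.

Lemma sum_ofD Q v w : sum_of Q v -> sum_of Q w -> sum_of Q (v + w).
Proof.
by move=> + Qw; elim=> [|x y Qx _ IH]; rewrite ?add0r // -addrA; apply: sum_ofS.
Qed.

Lemma sum_of_bind Q Q' v :
  (forall w, Q w -> sum_of Q' w) -> sum_of Q v -> sum_of Q' v.
Proof.
move=> QQ'; elim=> [|x y /QQ' Qx _ IH]; first exact: sum_of0.
exact: sum_ofD.
Qed.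
End SumOf.

Section EigenSplit.
Variables (F : fieldType) (V : lmodType F) (Q : V -> Prop) (A : {linear V -> V}).
Hypothesis QA : forall c v, Q v -> Q (A v - c *: v).
Hypothesis QZ : forall c v, Q v -> Q (c *: v).

(** If a product of factors A - c kills v and c <> d are two of the roots, then v
    is a combination of (A - c) v and (A - d) v, each killed by one factor fewer.
    Any property Q preserved by the operators A - c passes to the summands. *)
Lemma eigen_split (s : seq F) v : uniq s -> Q v ->
  foldl (fun w c => A w - c *: w) v s = 0 ->
  sum_of (fun w => Q w /\ exists c, A w = c *: w) v.
Proof.
elim: (size s) {-2}s v (leqnn (size s)) => {s} [|n IH] [|c [|d s]] v //=.
- by move=> _ _ _ ->; apply: sum_of0.
- by move=> _ _ _ ->; apply: sum_of0.
- move=> _ _ Qv /eqP; rewrite subr_eq0 => /eqP Av; apply: sum_of1.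
  by split=> //; exists c.
rewrite ltnS => sn /and3P[]; rewrite inE negb_or => /andP[cd cs] ds us Qv kill.
pose k := (c - d)^-1.
have k0 : c - d != 0 by rewrite subr_eq0.
have vE : v = k *: (A v - d *: v) + (- k) *: (A v - c *: v).
  rewrite scaleNr -scalerBr opprB addrC addrA subrK -scalerBl scalerA mulVf //.
  exact/esym/scale1r.
have comm w : A (A w - c *: w) - d *: (A w - c *: w) =
              A (A w - d *: w) - c *: (A w - d *: w).
  rewrite !linearB !linearZ /= ?scalerBr !scalerA [d * c]mulrC.
  exact: addrACA.
have killZ a w t : foldl (fun w c => A w - c *: w) w t = 0 ->
    foldl (fun w c => A w - c *: w) (a *: w) t = 0.
  elim: t w => [|e t IHt] w /=; first by move=> ->; rewrite scaler0.
  have -> : A (a *: w) - e *: (a *: w) = a *: (A w - e *: w).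
    by rewrite scalerBr !scalerA [a * e]mulrC (linearZZ A).
  exact: IHt.
rewrite vE; apply: sum_ofD.
- apply: (IH (c :: s)) => //=; first by rewrite cs us.
    exact/QZ/QA.
  by apply: (killZ k _ (c :: s)) => /=; rewrite -comm.
- apply: (IH (d :: s)) => //=; first by rewrite ds us.
    exact/QZ/QA.
  exact: (killZ _ _ (d :: s)).
Qed.
End EigenSplit.

Section RootSpaces.
Variables (F : numFieldType) (g : lieAlgType F) (hs : {vspace g}).
Implicit Types (a b : dual hs) (v w x : g).

Lemma dualD a b (x : subvs_of hs) : (a + b) x = a x + b x :> F.
Proof. by rewrite add_lfunE. Qed.
Lemma dualN a (x : subvs_of hs) : (- a) x = - (a x) :> F.
Proof. by rewrite opp_lfunE. Qed.

Lemma rootsp_lie a b v w :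
  v \in rootsp a -> w \in rootsp b -> lie v w \in rootsp (a + b).
Proof.
move=> /rootspP va /rootspP wb; apply/rootspP => x.
by rewrite lie_leibniz va wb lieZl linearZ /= -scalerDl dualD.
Qed.

(** Distinct weights are separated by an element x of the Cartan subalgebra, and
    ad x minus its eigenvalue kills one weight space. *)
Lemma rootsp_independent (I : finType) (wt : I -> dual hs) (w : I -> g) :
  injective wt -> (forall i, w i \in rootsp (wt i)) -> \sum_i w i = 0 ->
  forall i, w i = 0.
Proof.
move=> wtI wE w0 i.
apply: (@independent_components _ _ (fun i v => v \in rootsp (wt i)) _
          (index_enum I) w) => //; rewrite ?index_enum_uniq ?mem_index_enum //.
move=> {w w0 i wE} i j w ij wj.
have [x neq] : exists x : subvs_of hs, wt i x != wt j x.
  apply: contrapT => nex; case/eqP: ij; apply: wtI; apply/lfunP => x.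
  by apply/eqP; apply: contra_notT nex => ?; exists x.
exists (fun v => lie (vsval x) v - (wt j x : F) *: v).
  by move/rootspP: wj => ->; rewrite subrr.
split=> [v v'|l v /rootspP vl|v /rootspP vi].
- by rewrite linearD scalerDr opprD addrACA.
- by rewrite vl -scalerBl; apply: memvZ; apply/rootspP.
rewrite vi -scalerBl => /eqP; rewrite scaler_eq0 subr_eq0.
by case/orP=> [|/eqP//]; rewrite (negPf neq).
Qed.

Hypothesis hsC : cartan_subalgebra hs.

(** An element centralizing the Cartan subalgebra spans with it an abelian
    subalgebra, so maximality applies. *)
Lemma cartan_weight0 v : (v \in hs) = (v \in rootsp (0 : dual hs)).
Proof.
have [hab hmax _] := hsC; apply/idP/idP => [vh|/rootspP v0].
  by apply/rootspP => x; rewrite hab ?subvsP // zero_lfunE scale0r.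
have hv x : x \in hs -> lie x v = 0.
  by move=> xh; have := v0 (vsproj hs x); rewrite vsprojK // zero_lfunE scale0r.
rewrite -(hmax (hs + <[v]>)%VS) ?addvSl //.
  by apply: subvP (addvSr _ _) _ _; apply: memv_line.
move=> _ _ /memv_addP[x xh [_ /vlineP[c ->] ->]] /memv_addP[y yh [_ /vlineP[d ->] ->]].
have -> : lie (x + c *: v) (y + d *: v) = lie x y + d *: lie x v
    + (c *: lie v y + c *: (d *: lie v v)).
  by rewrite lieDl lieZl -scalerDr !lieDr !lieZr.
by rewrite hab // hv // (lieC v y) hv // liexx oppr0 !scaler0 !addr0.
Qed.

Lemma sl2_h_mem a (e h f : g) : sl2_triple a e h f -> h \in hs.
Proof.
case=> _ ea fa [hE _ _]; rewrite cartan_weight0 -hE -(subrr a).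
exact: rootsp_lie.
Qed.

Lemma ad_cartan_killed x : x \in hs -> exists s : seq F, uniq s /\
  forall v, foldl (fun w c => lie x w - c *: w) v s = 0.
Proof.
have [_ _ hdiag] := hsC; move=> /hdiag[X Xb Xe].
pose op v := foldl (fun w c => lie x w - c *: w) v.
have [s0 s0E] : exists s : seq F, {in X, forall v, exists2 c, c \in s &
  lie x v = c *: v}.
  elim: (X) Xe => [|v Y IH] Ye; first by exists [::].
  have [|s sE] := IH; first by move=> w wY; apply: Ye; rewrite inE wY orbT.
  have [c vc] := Ye v (mem_head _ _); exists (c :: s) => w.
  rewrite inE => /predU1P[->|/sE[d ds wd]]; first by exists c; rewrite ?mem_head.
  by exists d; rewrite // inE ds orbT.
exists (undup s0); split=> [|v]; first exact: undup_uniq.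
have opD s w w' : op (w + w') s = op w s + op w' s.
  elim: s w w' => //= c s IH w w'; rewrite -IH; congr (op _ s).
  by rewrite linearD scalerDr opprD addrACA.
have opZ s c w : op (c *: w) s = c *: op w s.
  elim: s w => //= d s IH w; rewrite -IH; congr (op _ s).
  by rewrite scalerBr !scalerA [c * d]mulrC lieZr.
have op0 s : op 0 s = 0.
  by have := opZ s 0 0; rewrite scale0r => ->; apply: scale0r.
have opX w c s : c \in s -> lie x w = c *: w -> op w s = 0.
  move=> + wc; elim: s => //= d s IH; rewrite inE wc -scalerBl opZ.
  by case/predU1P => [->|/IH->]; rewrite ?subrr ?scale0r ?scaler0.
rewrite -/(op v _).
have /coord_span -> : v \in <<in_tuple X>>%VS by rewrite (span_basis Xb) memvf.
elim/big_ind: _ => [|w w' Hw Hw'|i _]; rewrite ?op0 // ?opD ?Hw ?Hw' ?addr0 //.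
have [|c cs wc] := s0E (in_tuple X)`_i; first by rewrite mem_nth.
by rewrite opZ (opX _ c) ?scaler0 // mem_undup.
Qed.

Lemma common_eigen (l : seq g) v : {subset l <= hs} ->
  sum_of (fun w => forall x, x \in l -> exists c : F, lie x w = c *: w) v.
Proof.
have [hab _ _] := hsC.
elim: l v => [|x l IH] v lh; first exact: sum_of1.
have lh' : {subset l <= hs} by move=> y yl; apply: lh; rewrite inE yl orbT.
have xh : x \in hs by apply: lh; rewrite mem_head.
apply: sum_of_bind (IH v lh') => w wl.
have [s [us kill]] := ad_cartan_killed xh.
have QA c u : (forall y, y \in l -> exists d : F, lie y u = d *: u) ->
    forall y, y \in l -> exists d :
      F, lie y (lie x u - c *: u) = d *: (lie x u - c *: u).
  move=> ul y yl; have [d yd] := ul y yl; exists d.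
  have yx0 : lie y x = 0 by apply: hab => //; apply: lh'.
  rewrite lieBr lieZr lie_leibniz yx0 lie0l add0r yd.
  by rewrite lieZr scalerBr !scalerA mulrC.
have QZ c u : (forall y, y \in l -> exists d : F, lie y u = d *: u) ->
    forall y, y \in l -> exists d : F, lie y (c *: u) = d *: (c *: u).
  move=> ul y yl; have [d yd] := ul y yl; exists d.
  by rewrite lieZr yd !scalerA mulrC.
apply: sum_of_bind (eigen_split (A := lie x) QA QZ us wl (kill w)).
move=> w' [w'l [c w'x]]; apply: sum_of1 => y; rewrite inE => /predU1P[->|/w'l//].
by exists c.
Qed.

(** The eigenvalues on the basis vectors of the Cartan subalgebra determine the
    weight as a linear form. *)
Lemma weight_decomposition v : sum_of (fun w => exists a, w \in rootsp a) v.
Proof.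
have lh : {subset vbasis hs <= hs} by move=> y; apply: vbasis_mem.
apply: sum_of_bind (common_eigen v lh) => w wE; apply: sum_of1.
have wE' (i : 'I_(\dim hs)) : exists c : F, lie (vbasis hs)`_i w = c *: w.
  by apply: wE; rewrite mem_nth // size_tuple.
have [c cE] := fin_all_exists wE'.
pose a : dual hs := \sum_i c i *: linfun ((coord (vbasis hs) i : {linear g ->
  F^o}) \o vsval).
exists a; apply/rootspP => x.
rewrite [in LHS](coord_vbasis (subvsP x)).
rewrite (big_morph (lie^~ _) (fun x x' => lieDl x x' _) (lie0l _)).
rewrite sum_lfunE scaler_suml; apply: eq_bigr => i _.
rewrite lieZl cE scalerA scale_lfunE lfunE /= mulrC; congr (_ *: _).
Qed.

End RootSpaces.

(** * Weight vectors of a module *)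

Section WeightVectors.
Variables (F : numFieldType) (g : lieAlgType F) (hs : {vspace g}).
Variables (M : lmodType F) (pi : g -> M -> M).
Hypothesis piM : is_lie_module pi.

Lemma piDl x y v : pi (x + y) v = pi x v + pi y v.
Proof. by case: piM => pil _ _; have := pil 1 x y v; rewrite !scale1r. Qed.
Lemma pi0l v : pi 0 v = 0.
Proof. by apply: (addIr (pi 0 v)); rewrite -piDl !add0r. Qed.
Lemma piZl c x v : pi (c *: x) v = c *: pi x v.
Proof. by case: piM => pil _ _; have := pil c x 0 v; rewrite pi0l !addr0. Qed.
Lemma piDr x v w : pi x (v + w) = pi x v + pi x w.
Proof. by case: piM => _ pir _; have := pir x 1 v w; rewrite !scale1r. Qed.
Lemma pi0r x : pi x 0 = 0.
Proof. by apply: (addIr (pi x 0)); rewrite -piDr !add0r. Qed.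
Lemma piZr c x v : pi x (c *: v) = c *: pi x v.
Proof. by case: piM => _ pir _; have := pir x c v 0; rewrite pi0r !addr0. Qed.
Lemma pi_lie x y v : pi (lie x y) v = pi x (pi y v) - pi y (pi x v).
Proof. by case: piM. Qed.

Definition weight_vector (nu : dual hs) (v : M) :=
  forall x : subvs_of hs, pi (vsval x) v = (nu x : F) *: v.

Lemma weight_vector_root (nu a : dual hs) x v : x \in rootsp a ->
  weight_vector nu v -> weight_vector (a + nu) (pi x v).
Proof.
move=> /rootspP xa vnu y.
have := pi_lie (vsval y) x v; rewrite xa piZl vnu piZr => /eqP.
by rewrite eq_sym subr_eq => /eqP ->; rewrite -scalerDl dualD.
Qed.

End WeightVectors.

(** * The triangular decomposition *)

Lemma daddv_pi_compl (F : fieldType) (V : vectType F) (U W : {vspace V}) v :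
  (U :&: W = 0)%VS -> v \in W -> daddv_pi U W v = 0.
Proof.
move=> UW vW; have WU : (W :&: U = 0)%VS by rewrite capvC.
apply: (addIr (daddv_pi W U v)); rewrite daddv_pi_add ?(subvP (addvSr _ _)) //.
by rewrite add0r (daddv_pi_id WU vW).
Qed.

Section Triangular.
Variables (F : numFieldType) (g : lieAlgType F) (hs : {vspace g}) (N : nat).
Variable pos : N.-tuple (dual hs).
Hypothesis hsC : cartan_subalgebra hs.
Hypothesis posP : positive_system pos.
Implicit Types (a b : dual hs) (v w x : g).
Local Notation nb := (nilp_opp pos).
Local Notation n := (Defs.nilp pos).

Lemma simple_center0 : simple_lie g -> forall x : g, (forall y, lie x y = 0) -> x = 0.
Proof.
case=> [[x0 [y0 xy0]] idl] x x0E.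
have lieZ_0 (c : F) z : lie z (c *: x) = 0.
  by rewrite lieC lieZl x0E scaler0 oppr0.
case: (idl <[x]>%VS) => [z _ /vlineP[c ->]|x1|xT].
- by rewrite lieZ_0 mem0v.
- by apply/eqP; rewrite -memv0 -x1 memv_line.
- have /vlineP[c yE] : y0 \in <[x]>%VS by rewrite xT memvf.
  by case/eqP: xy0; rewrite yE lieZ_0.
Qed.

Definition is_height (ht : dual hs -> F) (m : 'I_N -> nat) :=
  [/\ {morph ht : a b / a + b}, {morph ht : a / - a},
      forall c a, ht (c *: a) = c * ht a,
      forall i, ht (tnth pos i) = (m i)%:R & forall i, (0 < m i)%N].

(** The sum of the coordinates in the base. *)
Lemma height_exists : exists ht m, is_height ht m.
Proof.
have [_ rootP [base [bfree _ bpos]]] := posP.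
pose ht a : F := \sum_i coord (in_tuple base) i a.
have htD : {morph ht : a b / a + b}.
  by move=> a b; rewrite /ht -big_split /=; apply: eq_bigr => i _; rewrite linearD.
have htN : {morph ht : a / - a}.
  by move=> a; rewrite /ht -sumrN /=; apply: eq_bigr => i _; rewrite linearN.
have htZ c a : ht (c *: a) = c * ht a.
  by rewrite /ht mulr_sumr; apply: eq_bigr => i _; rewrite linearZ.
have hE (i : 'I_N) : exists k : nat, ht (tnth pos i) = k%:R /\ (0 < k)%N.
  have ipos := mem_tnth i pos; have [c cE] := bpos _ ipos.
  exists (\sum_i c i)%N; split.
    rewrite natr_sum /ht; apply: eq_bigr => j _.
    rewrite cE linear_sum (bigD1 j) //= big1 ?addr0 => [|l lj].
      by rewrite linearMn /= (coord_free (X := in_tuple base)) // eqxx.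
    by rewrite linearMn /= (coord_free (X := in_tuple base)) // (negPf lj) mul0rn.
  rewrite lt0n; apply/eqP => c0.
  have [/eqP ne0 _] : is_root (tnth pos i) by apply/rootP; left.
  apply: ne0.
  rewrite cE big1 // => j _.
  by move/eqP: c0; rewrite sum_nat_eq0 => /forallP/(_ j)/eqP ->; rewrite mulr0n.
have [m mE] := fin_all_exists hE.
by exists ht, m; split=> // i; case: (mE i).
Qed.

Variables (ht : dual hs -> F) (m : 'I_N -> nat).
Hypothesis htP : is_height ht m.

Lemma ht0 : ht 0 = 0.
Proof. by case: htP => htD _ _ _ _; apply: (addIr (ht 0)); rewrite -htD !add0r. Qed.

Definition weight (j : unit + ('I_N + 'I_N)) : dual hs :=
  match j with
  | inl _ => 0
  | inr (inl i) => - tnth pos i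
  | inr (inr i) => tnth pos i
  end.

Lemma weight_inj : injective weight.
Proof.
have [puniq _ _] := posP; have [htD htN htZ htm m0] := htP.
have pinj i j : tnth pos i = tnth pos j -> i = j.
  by rewrite !(tnth_nth 0) => /eqP; rewrite nth_uniq ?size_tuple // => /eqP/val_inj.
have p0 i : tnth pos i <> 0.
  by move=> E; have := htm i; rewrite E ht0 => /esym/eqP; rewrite pnatr_eq0 gtn_eqF.
have pN i j : tnth pos i <> - tnth pos j.
  move=> E; have /eqP := htm i; rewrite E htN htm eq_sym -addr_eq0 -natrD pnatr_eq0.
  by rewrite gtn_eqF // addn_gt0 m0.
move=> [[]|[i|i]] [[]|[j|j]] //= E.
- by case: (p0 j); rewrite -[LHS]opprK -E oppr0.
- by case: (p0 j).
- by case: (p0 i); rewrite -[LHS]opprK E oppr0.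
- by congr (inr (inl _)); apply: pinj; apply: oppr_inj.
- by case: (pN j i).
- by case: (p0 i).
- by case: (pN i j).
- by congr (inr (inr _)); apply: pinj.
Qed.

Lemma rootsp_weight a v : v \in rootsp a -> v != 0 -> exists j, a = weight j.
Proof.
have [_ rootP _] := posP; move=> va v0.
have [->|a0] := eqVneq a 0; first by exists (inl tt).
have /rootP : is_root a.
  by split=> //; apply: contraNneq v0 => a0'; rewrite -memv0 -a0'.
case=> /tnthP[i aE]; first by exists (inr (inr i)).
by exists (inr (inl i)); rewrite /= -aE opprK.
Qed.

Lemma memv_nb v : v \in nb -> exists2 y : 'I_N -> g,
  forall i, y i \in rootsp (- tnth pos i) & v = \sum_i y i.
Proof. by move/memv_sumP=> [y yP ->]; exists y => // i; apply: yP. Qed.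
Lemma memv_n v : v \in n -> exists2 y : 'I_N -> g,
  forall i, y i \in rootsp (tnth pos i) & v = \sum_i y i.
Proof. by move/memv_sumP=> [y yP ->]; exists y => // i; apply: yP. Qed.
Lemma rootsp_nb i v : v \in rootsp (- tnth pos i) -> v \in nb.
Proof. by move=> vi; apply: subvP v vi; apply: (sumv_sup i). Qed.
Lemma rootsp_n i v : v \in rootsp (tnth pos i) -> v \in n.
Proof. by move=> vi; apply: subvP v vi; apply: (sumv_sup i). Qed.

Lemma triangular_independent x v w : x \in hs -> v \in nb -> w \in n ->
  x + (v + w) = 0 -> [/\ x = 0, v = 0 & w = 0].
Proof.
move=> xh /memv_nb[y yE ->] /memv_n[z zE ->] s0.
pose c (j : unit + ('I_N + 'I_N)) := match j with inl _ => x | inr (inl i) =>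
  y i | inr (inr i) => z i end.
have c0 : forall j, c j = 0.
  apply: (rootsp_independent (wt := weight) weight_inj) => [[[]|[i|i]]|] //=.
    by rewrite -cartan_weight0.
  by rewrite big_sumType /= big_sumType /= (big_pred1 tt) // => -[].
split; first exact: (c0 (inl tt)).
  by rewrite big1 // => i _; apply: (c0 (inr (inl i))).
by rewrite big1 // => i _; apply: (c0 (inr (inr i))).
Qed.

Lemma triangular_full : (nb + (hs + n))%VS = fullv.
Proof.
apply/eqP; rewrite eqEsubv subvf; apply/subvP => v _.
elim: (weight_decomposition hsC v) => [|w {}v [a wa] _ IH]; first exact: mem0v.
apply: memvD => //; have [->|w0] := eqVneq w 0; first exact: mem0v.
have [[[]|[i|i]] aE] := rootsp_weight wa w0; rewrite aE in wa.
- apply: subvP (addvSr _ _) _ _; apply: subvP (addvSl _ _) _ _.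
  by rewrite cartan_weight0.
- by apply: subvP (addvSl _ _) _ _; apply: rootsp_nb wa.
- apply: subvP (addvSr _ _) _ _; apply: subvP (addvSr _ _) _ _.
  exact: rootsp_n wa.
Qed.

Lemma nb_cap : (nb :&: (hs + n) = 0)%VS.
Proof.
apply/eqP; rewrite -subv0; apply/subvP => v; rewrite memv_cap memv0.
case/andP=> vn /memv_addP[x xh [w wn vE]].
have [] := @triangular_independent x (- v) w; rewrite ?memvN //.
  by rewrite vE opprD subrK subrr.
by move=> _ /eqP; rewrite oppr_eq0.
Qed.

Lemma hs_cap : (hs :&: (nb + n) = 0)%VS.
Proof.
apply/eqP; rewrite -subv0; apply/subvP => v; rewrite memv_cap memv0.
case/andP=> vh /memv_addP[x xh [w wn vE]].
have [] := @triangular_independent (- v) x w; rewrite ?memvN //.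
  by rewrite vE addNr.
by move=> /eqP; rewrite oppr_eq0 => ->.
Qed.

Local Notation pn := (proj_nilp_opp pos).
Local Notation ph := (proj_cartan pos).

Lemma pn_mem v : pn v \in nb. Proof. exact: memv_pi. Qed.
Lemma pn_id v : v \in nb -> pn v = v.
Proof. exact: daddv_pi_id nb_cap. Qed.
Lemma pn_compl v : v - pn v \in (hs + n)%VS.
Proof.
have vT : v \in (nb + (hs + n))%VS by rewrite triangular_full memvf.
have -> : v - pn v = daddv_pi (hs + n)%VS nb v.
  by apply/eqP; rewrite subr_eq addrC daddv_pi_add // nb_cap.
exact: memv_pi.
Qed.
Lemma pn_borel v : v \in (hs + n)%VS -> pn v = 0.
Proof. exact: daddv_pi_compl nb_cap. Qed.
Lemma ph_id v : v \in hs -> ph v = v.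
Proof. exact: daddv_pi_id hs_cap. Qed.
Lemma ph_nilp v : v \in (nb + n)%VS -> ph v = 0.
Proof. exact: daddv_pi_compl hs_cap. Qed.

Lemma neg_height_nb a v k : v \in rootsp a -> ht a = - (k.+1)%:R -> v \in nb.
Proof.
have [htD htN htZ htm m0] := htP; move=> va hta.
have [->|v0] := eqVneq v 0; first exact: mem0v.
have [[[]|[i|i]] aE] := rootsp_weight va v0; rewrite aE in va hta.
- by move: hta; rewrite /= ht0 => /esym/eqP; rewrite oppr_eq0 pnatr_eq0.
- exact: rootsp_nb va.
- by move/eqP: hta; rewrite /= htm -addr_eq0 -natrD pnatr_eq0 addnS.
Qed.

Lemma pos_height_n a v k : v \in rootsp a -> ht a = (k.+1)%:R -> v \in n.
Proof.
have [htD htN htZ htm m0] := htP; move=> va hta.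
have [->|v0] := eqVneq v 0; first exact: mem0v.
have [[[]|[i|i]] aE] := rootsp_weight va v0; rewrite aE in va hta.
- by move: hta; rewrite /= ht0 => /esym/eqP; rewrite pnatr_eq0.
- by move/eqP: hta; rewrite /= htN htm eq_sym -addr_eq0 -natrD pnatr_eq0.
- exact: rootsp_n va.
Qed.

Lemma lie_sum2 (I J : Type) (r : seq I) (s : seq J) (y : I -> g) (z : J -> g) :
  lie (\sum_(i <- r) y i) (\sum_(j <- s) z j) =
  \sum_(i <- r) \sum_(j <- s) lie (y i) (z j).
Proof.
rewrite (big_morph (lie^~ _) (fun x x' => lieDl x x' _) (lie0l _)).
by apply: eq_bigr => i _; rewrite linear_sum.
Qed.

Lemma lie_nb v w : v \in nb -> w \in nb -> lie v w \in nb.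
Proof.
have [htD htN htZ htm m0] := htP.
move=> /memv_nb[y yE ->] /memv_nb[z zE ->]; rewrite lie_sum2.
apply: memv_suml => i _; apply: memv_suml => j _.
apply: (@neg_height_nb (- tnth pos i - tnth pos j) _ (m i + m j).-1).
  exact: rootsp_lie.
by rewrite htD !htN !htm -opprD -natrD prednK // addn_gt0 m0.
Qed.

Lemma lie_n v w : v \in n -> w \in n -> lie v w \in n.
Proof.
have [htD htN htZ htm m0] := htP.
move=> /memv_n[y yE ->] /memv_n[z zE ->]; rewrite lie_sum2.
apply: memv_suml => i _; apply: memv_suml => j _.
apply: (@pos_height_n (tnth pos i + tnth pos j) _ (m i + m j).-1).
  exact: rootsp_lie.
by rewrite htD !htm -natrD prednK // addn_gt0 m0.
Qed.

Lemma lie_hs_n x w : x \in hs -> w \in n -> lie x w \in n.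
Proof.
move=> xh /memv_n[z zE ->]; rewrite linear_sum.
apply: memv_suml => i _; apply: (@rootsp_n i).
by rewrite -[tnth pos i]add0r; apply: rootsp_lie; rewrite // -cartan_weight0.
Qed.

Lemma lie_borel v w : v \in (hs + n)%VS -> w \in (hs + n)%VS -> lie v w \in n.
Proof.
have [hab _ _] := hsC.
move=> /memv_addP[x xh [v' vn ->]] /memv_addP[y yh [w' wn ->]].
rewrite lieDl !lieDr hab // add0r; apply: memvD; first exact: lie_hs_n.
by apply: memvD; [rewrite lieC memvN lie_hs_n | apply: lie_n].
Qed.

Section RootVectors.
Variable f : N.-tuple g.
Hypothesis fP : root_basis_opp pos f.

Lemma tnth_f_root i : tnth f i \in rootsp (- tnth pos i).
Proof. by case: fP. Qed.

Lemma coord_f_nb v : v \in nb -> \sum_i coord f i v *: tnth f i = v.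
Proof.
case: fP => fb _ vn; rewrite [RHS](coord_basis fb vn).
by apply: eq_bigr => i _; rewrite (tnth_nth 0).
Qed.

(** ad u strictly lowers the height of a weight, and the heights of the weights
    lie in the interval [- H, H]. *)
Lemma ad_u_nilpotent : exists K, forall w : ptens N g, iter K (ad_u f) w = 0.
Proof.
have [htD htN htZ htm m0] := htP.
pose H := (\sum_i m i)%N.
have weight_ht j : exists2 k : nat, ht (weight j) + H%:R = k%:R & (k <= H + H)%N.
  have le_mH i : (m i <= H)%N by rewrite /H (bigD1 i) //= leq_addr.
  case: j => [[]|[i|i]] /=.
  - by exists H; rewrite ?ht0 ?add0r ?leq_addr.
  - exists (H - m i)%N; last by rewrite (leq_trans (leq_subr _ _)) ?leq_addr.
    by rewrite htN htm natrB // addrC.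
  - by exists (m i + H)%N; rewrite ?htm ?natrD ?leq_add2r.
have iter0 k : iter k (ad_u f) 0 = 0 :> ptens N g.
  by elim: k => //= k ->; apply: ext_lie0r.
have iterD k (w w' : ptens N g) :
    iter k (ad_u f) (w + w') = iter k (ad_u f) w + iter k (ad_u f) w'.
  by elim: k => //= k ->; apply: ext_lieDr.
have killed k : forall a v p, v \in rootsp a ->
    (v != 0 -> forall l : nat, ht a + H%:R = l%:R -> (l < k)%N) ->
    iter k (ad_u f) (tens p v : ptens N g) = 0.
  elim: k => [|k IH] a v p va lt_k.
    have [->|v0] := eqVneq v 0; first by rewrite /= tens0r.
    have [j aE] := rootsp_weight va v0.
    by have [l hl _] := weight_ht j; have := lt_k v0 l; rewrite aE hl => /(_ erefl).
  have [->|v0] := eqVneq v 0; first by rewrite tens0r iter0.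
  rewrite iterSr /ad_u /generic_elt ext_lie_suml.
  rewrite (big_morph (iter k (ad_u f)) (iterD k) (iter0 k)) big1 // => i _.
  rewrite ext_lie_tens; apply: (IH (- tnth pos i + a)).
    by apply: rootsp_lie va; apply: tnth_f_root.
  move=> _ l hl; have {}lt_k := lt_k v0 (l + m i)%N.
  have /lt_k : ht a + H%:R = (l + m i)%:R by rewrite natrD -hl htD htN htm; ring.
  by rewrite ltnS; apply: leq_trans; rewrite -addn1 leq_add2l.
exists (H + H).+1 => w; elim/ptens_ind: w => [p v|w w' IH IH']; last first.
  by rewrite iterD IH IH' addr0.
elim: (weight_decomposition hsC v) => [|x {}v [a xa] _ IH]; first
  by rewrite tens0r iter0.
rewrite tensDr iterD IH addr0; apply: (killed _ _ _ _ xa) => x0 l.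
have [j ->] := rootsp_weight xa x0; have [k -> lek /eqP] := weight_ht j.
by rewrite eqr_nat => /eqP <-.
Qed.

(** The bracket has weight - (theta + alpha), and theta + alpha is not a root. *)
Lemma maximal_root_central th v : maximal_root pos (tnth pos th) ->
  v \in nb -> lie (tnth f th) v = 0.
Proof.
have [_ rootP _] := posP; have [htD htN htZ htm m0] := htP.
case=> _ thmax /memv_nb[y yE ->]; rewrite linear_sum big1 // => i _ /=.
apply/eqP; apply: contraT => nz.
have lieR := rootsp_lie (tnth_f_root th) (yE i).
have [j jE] := rootsp_weight lieR nz.
have r : is_root (tnth pos th + tnth pos i).
  apply/rootP; case: j jE => [[]|[j|j]] /= jE.
  - have /eqP := congr1 ht jE; rewrite ht0 htD !htN !htm -opprD oppr_eq0 -natrD.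
    by rewrite pnatr_eq0 addn_eq0 gtn_eqF.
  - left; apply/tnthP; exists j; rewrite -[RHS]opprK -jE opprD !opprK //.
  - right; apply/tnthP; exists j; by rewrite opprD.
have le : root_le pos (tnth pos th) (tnth pos th + tnth pos i).
  exists (fun k : 'I_(size pos) => nat_of_bool (val k == val i)).
  have iN : (i < size pos)%N by rewrite size_tuple ltn_ord.
  rewrite addrAC subrr add0r (bigD1 (Ordinal iN)) //= eqxx mulr1n big1 ?addr0.
    by rewrite (tnth_nth 0).
  by move=> k; rewrite -val_eqE /= => /negPf ->; rewrite mulr0n.
have /eqP := thmax _ r le; rewrite -subr_eq0 addrAC subrr add0r => /eqP i0.
by have /eqP := htm i; rewrite i0 ht0 eq_sym pnatr_eq0 gtn_eqF.
Qed.

Lemma rootsp_opp_line i v : v \in rootsp (- tnth pos i) -> exists c :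
  F, v = c *: tnth f i.
Proof.
move=> vi; pose c j := coord f j v; exists (c i).
have vE : \sum_j c j *: tnth f j = v by apply/coord_f_nb/rootsp_nb/vi.
apply/eqP; rewrite -subr_eq0; apply/eqP.
pose w j := (if j == i then v else 0) - c j *: tnth f j.
have w0 : forall j, w j = 0.
  apply: (rootsp_independent (wt := fun j => - tnth pos j)).
  - move=> j k /oppr_inj E;
    suff: inr (inr j) = inr (inr k) :> unit + ('I_N + 'I_N) by case.
    exact: weight_inj.
  - by move=> j; rewrite memvB ?memvZ ?tnth_f_root //; case: eqP => [->|]; rewrite
    ?mem0v.
  by rewrite sumrB vE -big_mkcond big_pred1_eq subrr.
by have := w0 i; rewrite /w eqxx.
Qed.

End RootVectors.
End Triangular.

(** * First-order operators in the Weyl algebra *)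

Section WeylOperators.
Variables (F : fieldType) (N : nat).
Local Notation P := {mpoly F[N]}.
Implicit Types (p : P) (q r : 'I_N -> P).

Lemma wpolyM p p' : wpoly (p * p') = wpoly p * wpoly p'.
Proof. exact/mmap_commM/wxx. Qed.
Lemma wpolyD p p' : wpoly (p + p') = wpoly p + wpoly p'.
Proof. exact: mmapD. Qed.
Lemma wpolyZ c p : wpoly (c *: p) = c *: wpoly p.
Proof. by rewrite /wpoly mmapZ /= -scalerAl mul1r. Qed.
Lemma wpoly1 : wpoly (1 : P) = 1.
Proof. by rewrite /wpoly -mpolyC1 mmapC /= scale1r. Qed.
Lemma wpolyX i : wpoly ('X_i : P) = wx F i.
Proof. by rewrite /wpoly mmapX mmap1U. Qed.
Lemma wpoly0 : wpoly (0 : P) = 0.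
Proof. exact: mmap0. Qed.
Lemma wpolyN p : wpoly (- p) = - wpoly p.
Proof. by rewrite -scaleN1r wpolyZ scaleN1r. Qed.
Lemma wpolyB p p' : wpoly (p - p') = wpoly p - wpoly p'.
Proof. by rewrite wpolyD wpolyN. Qed.
Lemma wpoly_sum (I : Type) (s : seq I) (p : I -> P) :
  wpoly (\sum_(i <- s) p i) = \sum_(i <- s) wpoly (p i).
Proof. exact: (big_morph _ wpolyD wpoly0). Qed.
Lemma wpolyC p p' : wpoly p * wpoly p' = wpoly p' * wpoly p.
Proof. by rewrite -!wpolyM mulrC. Qed.

Lemma wd_wpoly i p : wd F i * wpoly p = wpoly p * wd F i + wpoly (mderiv i p).
Proof.
elim/mpoly_mulX_ind: p => [|p p' IHp IHp'|c p IH|j p IH].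
- by rewrite wpoly1 mul1r mulr1 -mpolyC1 mderivC wpoly0 addr0.
- by rewrite wpolyD mderivD wpolyD mulrDr mulrDl IHp IHp' addrACA.
- by rewrite mderivZ !wpolyZ -scalerAr IH scalerDr scalerAl.
- rewrite mderivXM wpolyD wpolyZ !wpolyM wpolyX mulrA wdx mulrDl -!mulrA IH.
  by rewrite mulrDr -scalerAl mul1r !addrA addrAC.
Qed.

Definition wvfield q : weyl F N := \sum_i wpoly (q i) * wd F i.

Lemma wvfield_wpoly q p :
  wvfield q * wpoly p - wpoly p * wvfield q = wpoly (vfield q p).
Proof.
rewrite /wvfield /vfield wpoly_sum mulr_suml mulr_sumr -sumrB.
apply: eq_bigr => i _; rewrite -mulrA wd_wpoly mulrDr !mulrA [wpoly p * _]wpolyC.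
by rewrite [X in X - _]addrC addrK wpolyM.
Qed.

Lemma wvfieldB q r : wvfield (fun i => q i - r i) = wvfield q - wvfield r.
Proof. by rewrite /wvfield -sumrB; apply: eq_bigr => i _; rewrite wpolyB mulrBl. Qed.

Lemma eq_wvfield q r : q =1 r -> wvfield q = wvfield r.
Proof. by move=> qr; apply: eq_bigr => i _; rewrite qr. Qed.

Lemma wvfield_bracket q r :
  wvfield q * wvfield r - wvfield r * wvfield q = wvfield (vbracket q r).
Proof.
have E a b : wvfield a * wvfield b = wvfield (fun i => vfield a (b i)) +
    \sum_i \sum_j wpoly (a j) * wpoly (b i) * (wd F j * wd F i).
  have S i : wpoly (b i) * wvfield a * wd F i =
      \sum_j wpoly (a j) * wpoly (b i) * (wd F j * wd F i).
    rewrite /wvfield mulr_sumr mulr_suml; apply: eq_bigr => j _.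
    by rewrite mulrA wpolyC -!mulrA.
  rewrite {2}/wvfield mulr_sumr -big_split /=; apply: eq_bigr => i _.
  by rewrite -S -wvfield_wpoly mulrBl mulrA subrK.
rewrite !E [X in _ + X - _]exchange_big opprD addrACA -wvfieldB.
rewrite [X in _ + X](_ : _ = 0) ?addr0 //.
rewrite -sumrB big1 // => i _; rewrite -sumrB big1 // => j _.
by rewrite wdd wpolyC subrr.
Qed.

(** The polynomial parts commute with each other. *)
Lemma first_order_bracket q r p p' :
  (wvfield q + wpoly p) * (wvfield r + wpoly p') -
  (wvfield r + wpoly p') * (wvfield q + wpoly p) =
  wvfield (vbracket q r) + wpoly (vfield q p' - vfield r p).
Proof.
rewrite wpolyB -!wvfield_wpoly -wvfield_bracket !mulrDr !mulrDl (wpolyC p').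
rewrite opprD addrACA (opprD (wvfield r * _)) (addrACA (wvfield q * _)).
rewrite (opprD (wvfield r * _)) (addrACA (wvfield q * _) (wpoly p * _)).
rewrite subrr addr0 -addrA; congr (_ + _); rewrite opprB addrC addrACA [RHS]addrACA.
by congr (_ + _); rewrite addrC.
Qed.

End WeylOperators.

Lemma fourier_lie_module (F : fieldType) (N : nat) (g : lieAlgType F)
    (S : pred 'I_N) (D : g -> weyl F N) :
  (forall (c : F) a b, D (c *: a + b) = c *: D a + D b) ->
  (forall a b, D (lie a b) = D a * D b - D b * D a) ->
  is_lie_module (fun a => fourier S (D a)).
Proof.
move=> Dlin Dlie; split=> [c a b v|a c v w|a b v].
- by rewrite Dlin fourierDl fourierZl.
- exact: fourier_lin.
- by rewrite Dlie -scaleN1r fourierDl fourierZl !fourierM scaleN1r.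
Qed.

Section DiffOp.
Variables (F : numFieldType) (N : nat) (g : lieAlgType F) (hs : {vspace g}).
Variables (pos : N.-tuple (dual hs)) (f : N.-tuple g) (mu : dual hs) (K : nat).
Local Notation P := {mpoly F[N]}.
Local Notation T := (ext_lie (generic_elt f)).
Hypothesis TK : forall w : ptens N g, iter K T w = 0.

Definition pnilp : {linear g -> g} := daddv_pi (nilp_opp pos) (hs + Defs.nilp pos)%VS.
Definition pcartan : {linear g -> g} := daddv_pi hs (nilp_opp pos + Defs.nilp pos)%VS.
Definition cartan_form : {linear g -> F^o} := mu \o vsproj hs.

Lemma exp_ad_oppE a : exp_ad_opp f a = exp_opp f K (tens 1 a).
Proof.
have iterN k w : iter k (ext_lie (- generic_elt f)) w =
    (-1) ^+ k *: iter k T w.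
  elim: k => [|k IH]; first by rewrite scale1r.
  by rewrite !iterS IH ext_lieNl ext_lieZr exprS mulN1r scaleNr.
have TKN w : iter K (ext_lie (- generic_elt f)) w = 0 by rewrite iterN TK scaler0.
rewrite /exp_ad_opp (_ : (fun w => _) = ext_lie (- generic_elt f)); last first.
  by apply/funext => w; rewrite ext_lieNl.
rewrite (nilp_seriesE TKN) exp_oppE; apply: eq_bigr => k _.
rewrite iterN scalerA /expN_coef; congr (_ *: _).
rewrite -scalerAl mul1r mulrC -scalerA; congr (_ *: _).
exact/esym/(rmorph_sign (in_alg P) k).
Qed.

Local Notation flowc := (flow_coef f pnilp K).
Local Notation cartanc := (cartan_part f pcartan cartan_form K).

Lemma diff_opE a : diff_op pos f mu a = wvfield (flowc a) + wpoly (cartanc a).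
Proof.
rewrite /diff_op exp_ad_oppE cartan_partE; congr (_ + _).
rewrite -sumrN; apply: eq_bigr => i _.
rewrite (nilp_seriesE TK) flow_coefE flow_dirE nilp_partE wpolyN mulNr.
by [].
Qed.


Hypothesis g_simple : simple_lie g.
Hypothesis hsC : cartan_subalgebra hs.
Hypothesis posP : positive_system pos.
Hypothesis fP : root_basis_opp pos f.

(** [first_order_bracket] splits the identity into the bracket of the vector
    fields and the relation between the Cartan parts. *)
Lemma diff_op_lie a b : diff_op pos f mu (lie a b) =
  diff_op pos f mu a * diff_op pos f mu b - diff_op pos f mu b * diff_op pos f mu a.
Proof.
have [ht [m htP]] := height_exists posP.
have center0 := simple_center0 g_simple.
have f_free : free f by case: fP => /basis_free.
have pn_f i : pnilp (tnth f i) = tnth f i.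
  by apply: (pn_id hsC posP htP); apply: rootsp_nb (tnth_f_root fP i).
have f_coord v : \sum_i coord f i (pnilp v) *: tnth f i = pnilp v.
  exact/(coord_f_nb fP)/pn_mem.
have pn_idem v : pnilp (pnilp v) = pnilp v.
  exact/(pn_id hsC posP htP)/pn_mem.
have lie_nbp v w : lie (pnilp v) (pnilp w) \in nilp_opp pos.
  by apply: (lie_nb posP htP); apply: pn_mem.
have pn_lie v w : pnilp (lie (pnilp v) (pnilp w)) = lie (pnilp v) (pnilp w).
  exact/(pn_id hsC posP htP).
have ph_lie v w : pcartan (lie (pnilp v) (pnilp w)) = 0.
  by apply: (ph_nilp hsC posP htP); apply: subvP (addvSl _ _) _ _.
have lie_b v w : lie (v - pnilp v) (w - pnilp w) \in Defs.nilp pos.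
  by apply: (lie_borel hsC posP htP); apply: (pn_compl hsC posP htP).
have pn_lie_b v w : pnilp (lie (v - pnilp v) (w - pnilp w)) = 0.
  by apply: (pn_borel hsC posP htP); apply: subvP (addvSr _ _) _ _.
have ph_lie_b v w : pcartan (lie (v - pnilp v) (w - pnilp w)) = 0.
  by apply: (ph_nilp hsC posP htP); apply: subvP (addvSr _ _) _ _.
rewrite !diff_opE first_order_bracket; congr (_ + _).
- apply: eq_wvfield => i; apply/esym; exact: flow_coef_bracket.
- by rewrite flow_cartan_part.
Qed.

Lemma diff_op_linear (c : F) a b : diff_op pos f mu (c *: a + b) =
  c *: diff_op pos f mu a + diff_op pos f mu b.
Proof.
have exp_lin : exp_opp f K (tens 1 (c *: a + b)) =
    c%:A *: exp_opp f K (tens 1 a) + exp_opp f K (tens 1 b).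
  by rewrite !exp_oppE tensDr tensZr seriesD seriesZ.
rewrite !diff_opE scalerDr addrACA; congr (_ + _).
- rewrite /wvfield scaler_sumr -big_split /=; apply: eq_bigr => i _.
  rewrite scalerAl -mulrDl -wpolyZ -wpolyD; congr (wpoly _ * _).
  rewrite !flow_coefE !flow_dirE !nilp_partE exp_lin ext_homD ext_homZ.
  rewrite seriesD seriesZ ext_formD ext_formZ opprD scalerN.
  by rewrite -scalerAl mul1r.
- rewrite !cartan_partE exp_lin ext_homD ext_homZ ext_formD ext_formZ.
  by rewrite -scalerAl mul1r wpolyD wpolyZ.
Qed.

End DiffOp.

(** * The operators of Cartan elements and of root vectors *)

Section SeriesExtra.
Variables (F : numFieldType) (N : nat) (V : vectType F).
Variable T : {linear ptens N V -> ptens N V}.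
Implicit Types (c : nat -> F) (w : ptens N V).

Lemma series_comm K c w : T (series T K c w) = series T K c (T w).
Proof.
rewrite /series linear_sum; apply: eq_bigr => k _.
by rewrite linearZ /= -iterS iterSr.
Qed.

Lemma series_recl K c w :
  series T K.+1 c w = (c 0)%:A *: w + series T K (fun k => c k.+1) (T w).
Proof.
rewrite /series big_ord_recl; congr (_ + _); apply: eq_bigr => k _.
by rewrite lift0 iterSr.
Qed.

Lemma todd_expN0 : conv (todd_coef F) expN_coef 0 = 1.
Proof.
have e0 : exp_coef F 0 = 1 by rewrite /exp_coef invr1.
have e1 : exp_coef F 1 = 1 by rewrite /exp_coef invr1.
have := todd_coefP F 0; rewrite big_ord1 e0 e1 mulr1 => t0.
by rewrite /conv big_ord1 t0 mul1r /expN_coef e0 mulr1.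
Qed.
End SeriesExtra.

Section ExplicitFlow.
Variables (F : numFieldType) (N : nat) (g : lieAlgType F) (hs : {vspace g}).
Variables (pos : N.-tuple (dual hs)) (f : N.-tuple g) (mu : dual hs) (K : nat).
Local Notation P := {mpoly F[N]}.
Local Notation T := (ext_lie (generic_elt f)).
Hypothesis TK : forall w : ptens N g, iter K.+1 T w = 0.
Hypothesis hsC : cartan_subalgebra hs.
Hypothesis posP : positive_system pos.
Hypothesis fP : root_basis_opp pos f.

Local Notation pn := (pnilp pos).
Local Notation ph := (pcartan pos).
Local Notation epn := (@ext_hom F N g g pn).
Local Notation eph := (@ext_hom F N g g ph).
Local Notation flowc := (flow_coef f pn K.+1).
Local Notation cartanc := (cartan_part f ph (cartan_form mu) K.+1).

Lemma epn_series_nb c (w : ptens N g) :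
  epn w = w -> epn (series T K.+1 c w) = series T K.+1 c w.
Proof.
have [ht [m htP]] := height_exists posP.
move=> wn; apply: epn_series => //.
- by move=> i; apply: (pn_id hsC posP htP); apply: rootsp_nb (tnth_f_root fP i).
- move=> v v'; apply: (pn_id hsC posP htP); apply: (lie_nb posP htP); exact: pn_mem.
Qed.

Lemma eph_epn (w : ptens N g) : epn w = w -> eph w = 0.
Proof.
have [ht [m htP]] := height_exists posP.
move=> <-; elim/ptens_ind: w => [p x|w w' IH IH'].
  rewrite !ext_hom_tens (_ : ph _ = 0) ?tens0r //.
  apply: (ph_nilp hsC posP htP); apply: subvP (addvSl _ _) _ _; exact: pn_mem.
by rewrite !ext_homD IH IH' addr0.
Qed.

Lemma cartan_lie_u (x : subvs_of hs) :
  T (tens 1 (vsval x)) = \sum_i tens ((tnth pos i x : F) *: 'X_i) (tnth f i).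
Proof.
rewrite /generic_elt ext_lie_suml; apply: eq_bigr => i _.
rewrite ext_lie_tens mulr1 tensZl; congr tens.
have /rootspP fi := tnth_f_root fP i.
by rewrite lieC fi dualN scaleNr opprK.
Qed.

Section Cartan.
Variable x : subvs_of hs.
Local Notation h := (vsval x).

Lemma eph_cartan : eph (tens 1 h) = tens 1 h.
Proof.
have [ht [m htP]] := height_exists posP.
by rewrite ext_hom_tens; congr tens; apply: (ph_id hsC posP htP); apply: subvsP.
Qed.

Lemma epn_cartan : epn (tens 1 h) = 0.
Proof.
have [ht [m htP]] := height_exists posP.
rewrite ext_hom_tens (_ : pn h = 0) ?tens0r //.
by apply: (pn_borel hsC posP htP); apply: subvP (addvSl _ _) _ _; apply: subvsP.
Qed.

Lemma epn_T_cartan : epn (T (tens 1 h)) = T (tens 1 h).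
Proof.
have [ht [m htP]] := height_exists posP.
rewrite cartan_lie_u ext_hom_sum; apply: eq_bigr => i _.
rewrite ext_hom_tens; congr tens; apply: (pn_id hsC posP htP).
exact: rootsp_nb (tnth_f_root fP i).
Qed.

(** e^(-t) = 1 - psi(t) t. *)
Lemma exp_opp_cartan : exp_opp f K.+1 (tens 1 h) =
  tens 1 h - series T K.+1 expN_quot_coef (T (tens 1 h)).
Proof. by rewrite -series_comm (series_expN_quot TK) exp_oppE opprB addrC subrK. Qed.

(** psi(T) and phi(T) cancel: the vector field of h is D u = [u, h], an Euler
    field. *)
Lemma flow_coef_cartan i : flowc h i = (tnth pos i x : F) *: 'X_i.
Proof.
rewrite flow_coefE flow_dirE nilp_partE exp_opp_cartan ext_homB epn_cartan sub0r.
rewrite epn_series_nb ?epn_T_cartan // seriesN (series_quot_toddK TK) ext_formN.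
rewrite opprK cartan_lie_u ext_form_sum (bigD1 i) //= big1 ?addr0 => [|j ji].
  rewrite ext_form_tens /= (tnth_nth 0) coord_free ?eqxx ?scale1r //.
  by case: fP => /basis_free.
rewrite ext_form_tens /= [tnth f _](tnth_nth 0) coord_free ?(negPf ji) ?scale0r //.
by case: fP => /basis_free.
Qed.

Lemma cartan_part_cartan : cartanc h = (mu x)%:A.
Proof.
rewrite cartan_partE exp_opp_cartan ext_homB eph_cartan.
rewrite (eph_epn (epn_series_nb _ epn_T_cartan)) subr0 ext_form_tens /=.
by rewrite vsvalK.
Qed.
End Cartan.

Section Nilpotent.
Variable b : g.
Hypothesis bn : b \in nilp_opp pos.

Lemma epn_nilp : epn (tens 1 b) = tens 1 b.
Proof.
have [ht [m htP]] := height_exists posP.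
by rewrite ext_hom_tens; congr tens; apply: (pn_id hsC posP htP).
Qed.

Lemma cartan_part_nilp : cartanc b = 0.
Proof.
by rewrite cartan_partE exp_oppE (eph_epn (epn_series_nb _ epn_nilp)) ext_form0.
Qed.

Lemma flow_dir_nilp : flow_dir f pn K.+1 b =
  series T K.+1 (conv (todd_coef F) expN_coef) (tens 1 b).
Proof.
by rewrite flow_dirE nilp_partE exp_oppE epn_series_nb ?epn_nilp // (seriesM TK).
Qed.

Lemma flow_coef_central i : T (tens 1 b) = 0 -> flowc b i = - (coord f i b)%:A.
Proof.
move=> Tb; rewrite flow_coefE flow_dir_nilp series_recl [X in series _ _ _ X]Tb series0 addr0.
by rewrite todd_expN0 scale1r scale1r ext_form_tens.
Qed.

(** The constant term of phi(t) e^(-t) is 1, and the other terms lie in the image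
    of T = sum of x_j ad f_j.  The term with j = theta drops out because
    f_theta centralizes nbar. *)
Lemma flow_coef_nilp th :
  maximal_root pos (tnth pos th) ->
  exists r : 'I_N -> 'I_N -> P, forall i,
    flowc b i = - (coord f i b)%:A + \sum_(j | j != th) 'X_j * r j i.
Proof.
have [ht [m htP]] := height_exists posP.
move=> thmax; set d := fun k => conv (todd_coef F) expN_coef k.+1.
pose w := series T K d (tens 1 b).
have wn : epn w = w.
  have -> : w = series T K.+1 (fun k => if (k < K)%N then d k else 0) (tens 1 b).
    rewrite /w /series big_ord_recr /= ltnn !scale0r addr0.
    by apply: eq_bigr => k _; rewrite ltn_ord.
  by rewrite epn_series_nb ?epn_nilp.
have fth0 : ext_lie (tens 1 (tnth f th)) w = 0.
  rewrite -wn; elim/ptens_ind: (w) => [p x|w1 w2 IH1 IH2].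
    rewrite ext_hom_tens ext_lie_tens (maximal_root_central posP htP fP thmax)
      ?tens0r //.
    exact: pn_mem.
  by rewrite ext_homD ext_lieDr IH1 IH2 addr0.
exists (fun j i => - ext_form (coord f i) (ext_lie (tens 1 (tnth f j)) w)) => i.
rewrite flow_coefE flow_dir_nilp series_recl -series_comm ext_formD opprD.
rewrite todd_expN0 scale1r scale1r ext_form_tens; congr (_ + _).
rewrite -/d -/w /= /generic_elt ext_lie_suml ext_form_sum -sumrN.
rewrite (bigID (fun j => j != th)) /= [X in _ + X]big1 ?addr0 => [|j].
  by apply: eq_bigr => j _; rewrite tensE ext_lieZl ext_formZ mulrN.
by rewrite negbK => /eqP ->; rewrite tensE ext_lieZl fth0 scaler0 ext_form0 oppr0.
Qed.
End Nilpotent.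

End ExplicitFlow.

(** * Action on the Gelfand-Tsetlin module *)

Section FourierAction.
Variables (F : fieldType) (N : nat).
Local Notation P := {mpoly F[N]}.
Implicit Types (m : 'X_{1..N}) (p v : P).

Lemma mulX_mderiv i m : 'X_i * mderiv i 'X_[m] = (m i)%:R *: 'X_[m] :> P.
Proof.
rewrite mderivX -scalerAr; case: (posnP (m i)) => [->|mi]; first by rewrite !scale0r.
rewrite -mpolyXD addmC submK //.
by apply/mnm_lepP => j; rewrite mnm1E; case: eqP => [<-|].
Qed.

Lemma fourier_sum (S : pred 'I_N) (I : Type) (r : seq I) (Q : pred I)
    (D : I -> weyl F N) p :
  fourier S (\sum_(i <- r | Q i) D i) p = \sum_(i <- r | Q i) fourier S (D i) p.
Proof.
by apply: (big_morph (fourier S ^~ p)) => [D1 D2|]; rewrite ?fourierDl ?fourier0.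
Qed.

Variable th : 'I_N.
Local Notation act := (fourier (pred1 th)).

Lemma act_euler i m : act (wx F i * wd F i) 'X_[m] =
  (if i == th then (m i)%:R else - (m i).+1%:R) *: 'X_[m].
Proof.
rewrite fourierM fourier_x fourier_d /=; case: eqP => _.
  exact: mulX_mderiv.
by rewrite mderivXM eqxx mulX_mderiv -scalerDl -mulrS scaleNr.
Qed.

End FourierAction.

Section ExplicitAction.
Variables (F : numFieldType) (N : nat) (g : lieAlgType F) (hs : {vspace g}).
Variables (pos : N.-tuple (dual hs)) (f : N.-tuple g) (mu : dual hs) (th : 'I_N).
Local Notation P := {mpoly F[N]}.
Hypothesis hsC : cartan_subalgebra hs.
Hypothesis posP : positive_system pos.
Hypothesis fP : root_basis_opp pos f.
Hypothesis thmax : maximal_root pos (tnth pos th).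

Local Notation act := (fourier (pred1 th)).

(** A positive exponent, so that the truncated series have a constant term. *)
Lemma nilpotent_bound : exists K, forall w : ptens N g,
  iter K.+1 (ext_lie (generic_elt f)) w = 0.
Proof.
have [ht [m htP]] := height_exists posP.
have [K TK] := ad_u_nilpotent hsC posP htP fP.
by exists K => w; rewrite iterS [X in ext_lie _ X]TK ext_lie0r.
Qed.

(** For i <> theta the variable X_i is d_i and x_i d_i acts as - d/dd_i d_i,
    whence - (m_i + 1). *)
Definition monomial_weight (m : 'X_{1..N}) : dual hs :=
  mu + \sum_i (if i == th then (m i)%:R else - (m i).+1%:R) *: tnth pos i.

Lemma act_cartan (x : subvs_of hs) m :
  act (diff_op pos f mu (vsval x)) 'X_[m] = (monomial_weight m x : F) *: 'X_[m].
Proof.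
have [K TK] := nilpotent_bound.
rewrite (diff_opE _ _ TK) fourierDl (cartan_part_cartan mu TK hsC posP fP).
rewrite wpolyZ wpoly1 fourierZl fourier1 addrC dualD scalerDl; congr (_ + _).
rewrite sum_lfunE scaler_suml /wvfield fourier_sum; apply: eq_bigr => i _.
rewrite (flow_coef_cartan TK hsC posP fP) wpolyZ wpolyX -scalerAl fourierZl.
by rewrite act_euler scalerA scale_lfunE mulrC.
Qed.

Lemma act_root_vector i : exists r : 'I_N -> 'I_N -> P, forall p,
  act (diff_op pos f mu (tnth f i)) p = - act (wd F i) p +
  \sum_k \sum_(j | j != th) act (wx F j * wpoly (r j k) * wd F k) p.
Proof.
have [K TK] := nilpotent_bound.
have fn := rootsp_nb (tnth_f_root fP i).
have [r rE] := flow_coef_nilp TK hsC posP fP fn thmax.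
exists r => p; rewrite (diff_opE _ _ TK) (cartan_part_nilp mu K hsC posP fP fn).
rewrite wpoly0 addr0.
have f_free : free f by case: fP => /basis_free.
transitivity (act (- wd F i + \sum_k \sum_(j | j != th)
   wx F j * wpoly (r j k) * wd F k) p); last first.
  rewrite fourierDl -scaleN1r fourierZl scaleN1r fourier_sum; congr (_ + _).
  by apply: eq_bigr => k _; rewrite fourier_sum.
congr (act _ p).
transitivity (\sum_k ((- (k == i)%:R) *: wd F k + \sum_(j | j != th)
   wx F j * wpoly (r j k) * wd F k)).
  apply: eq_bigr => k _; rewrite rE wpolyD mulrDl -scaleNr wpolyZ wpoly1 mulr_algl.
  congr (_ + _); first by rewrite (tnth_nth 0) coord_free // eq_sym.
  rewrite -mulr_suml; congr (_ * _); rewrite (big_morph _ (@wpolyD F N) (@wpoly0 F N)).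
  by apply: eq_bigr => j _; rewrite wpolyM wpolyX.
rewrite big_split /=; congr (_ + _).
rewrite (bigD1 i) //= eqxx big1 ?addr0 => [|k /negPf ->]; first by rewrite scaleN1r.
by rewrite oppr0 scale0r.
Qed.

Lemma act_maximal_root p :
  act (diff_op pos f mu (tnth f th)) p = - mderiv th p.
Proof.
have [K TK] := nilpotent_bound.
have [ht [m htP]] := height_exists posP.
have fn := rootsp_nb (tnth_f_root fP th).
have f_free : free f by case: fP => /basis_free.
have Tf : ext_lie (generic_elt f) (tens 1 (tnth f th)) = 0.
  rewrite /generic_elt ext_lie_suml big1 // => i _.
  rewrite ext_lie_tens lieC (maximal_root_central posP htP fP thmax) ?oppr0 ?tens0r //.
  exact: rootsp_nb (tnth_f_root fP i).
rewrite (diff_opE _ _ TK) (cartan_part_nilp mu K hsC posP fP fn) wpoly0 addr0.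
transitivity (act (- wd F th) p); last first.
  by rewrite -scaleN1r fourierZl scaleN1r fourier_d /= eqxx.
congr (act _ p); rewrite /wvfield (bigD1 th) //= big1 ?addr0 => [|i ith].
  rewrite (flow_coef_central TK hsC posP fP fn) // (tnth_nth 0) coord_free // eqxx.
  by rewrite scale1r wpolyN wpoly1 mulN1r.
rewrite (flow_coef_central TK hsC posP fP fn) // (tnth_nth 0) coord_free //
  eq_sym (negPf ith).
by rewrite scale0r oppr0 wpoly0 mul0r.
Qed.

End ExplicitAction.

(** * Generation by one vector *)

Section TransverseDegree.
Variables (F : fieldType) (N : nat) (th : 'I_N).
Local Notation P := {mpoly F[N]}.
Local Notation act := (fourier (pred1 th)).
Implicit Types (m : 'X_{1..N}) (v : P).

(** The degree in the variables d_i, i <> theta. *)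
Definition tdeg m : nat := (\sum_(i | i != th) m i)%N.

Definition tdeg_le d : P -> Prop :=
  sum_of (fun w => exists (c : F) m, (tdeg m <= d)%N /\ w = c *: 'X_[m]).

Lemma tdegD m m' : tdeg (m + m')%MM = (tdeg m + tdeg m')%N.
Proof. by rewrite /tdeg -big_split; apply: eq_bigr => i _; rewrite mnmDE. Qed.
Lemma tdegU i : tdeg U_(i)%MM = (i != th).
Proof.
rewrite /tdeg; case: (boolP (i != th)) => ith.
  rewrite (bigD1 i) //= mnm1E eqxx big1 // => j /andP[_ ji].
  by rewrite mnm1E eq_sym (negPf ji).
by rewrite big1 // => j jth; rewrite mnm1E; move: ith; rewrite negbK => /eqP ->;
   rewrite eq_sym (negPf jth).
Qed.

Lemma tdeg_le_mono m d c : (tdeg m <= d)%N -> tdeg_le d (c *: 'X_[m]).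
Proof. by move=> md; apply: sum_of1; exists c, m. Qed.

Lemma tdeg_le_exists v : exists d, tdeg_le d v.
Proof.
have mono d d' w : (d <= d')%N -> tdeg_le d w -> tdeg_le d' w.
  move=> dd'; apply: sum_of_bind => _ [c [m [md ->]]].
  exact/tdeg_le_mono/(leq_trans md).
elim/mpolyind: v => [|c m v _ _ [d vd]]; first by exists 0%N; apply: sum_of0.
exists (maxn (tdeg m) d); apply: sum_ofD.
  by apply: tdeg_le_mono; apply: leq_maxl.
by apply: mono vd; apply: leq_maxr.
Qed.

Lemma tdeg_le_map (op : P -> P) d d' v :
  op 0 = 0 -> {morph op : x y / x + y} ->
  (forall c m, (tdeg m <= d)%N -> tdeg_le d' (op (c *: 'X_[m]))) ->
  tdeg_le d v -> tdeg_le d' (op v).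
Proof.
move=> op0 opD opX; elim=> [|_ w [c [m [md ->]]] _ IH]; rewrite ?op0 ?opD.
  exact: sum_of0.
by apply: sum_ofD IH; apply: opX.
Qed.

Lemma tdeg_le_mulX i d v : tdeg_le d v -> tdeg_le (d + (i != th)) ('X_i * v).
Proof.
apply: tdeg_le_map => [|x y|c m md]; rewrite ?mulr0 ?mulrDr //.
by rewrite -scalerAr -mpolyXD; apply: tdeg_le_mono; rewrite tdegD tdegU addnC leq_add.
Qed.

Lemma tdeg_le_mderiv i d v : tdeg_le d v -> tdeg_le (d - (i != th)) (mderiv i v).
Proof.
apply: tdeg_le_map => [|x y|c m md]; rewrite ?mderiv0 ?mderivD //.
rewrite mderivZ mderivX; case: (posnP (m i)) => mi.
  by rewrite mi scale0r scaler0; apply: sum_of0.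
rewrite scalerA; apply: tdeg_le_mono.
have mE : m = (m - U_(i) + U_(i))%MM.
  by rewrite submK //; apply/mnm_lepP => j; rewrite mnm1E; case: eqP => [<-|].
have -> : tdeg (m - U_(i))%MM = (tdeg m - (i != th))%N.
  by rewrite [in RHS]mE tdegD tdegU addnK.
exact: leq_sub2r.
Qed.

Lemma tdeg_le_N d v : tdeg_le d v -> tdeg_le d (- v).
Proof.
apply: tdeg_le_map => [|x y|c m md]; rewrite ?oppr0 ?opprD //.
by rewrite -scaleNr; apply: tdeg_le_mono.
Qed.

Lemma tdeg_le_wx_transverse i d v : i != th -> tdeg_le d.+1 v ->
  tdeg_le d (act (wx F i) v).
Proof.
move=> ith vd; rewrite fourier_x /= (negPf ith); apply: tdeg_le_N.
by have := tdeg_le_mderiv i vd; rewrite ith subn1.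
Qed.

Lemma tdeg_le_wpoly p d v : tdeg_le d v -> tdeg_le d (act (wpoly p) v).
Proof.
elim/mpoly_mulX_ind: p d v => [|p p' IH IH'|c p IH|i p IH] d v vd.
- by rewrite wpoly1 fourier1.
- by rewrite wpolyD fourierDl; apply: sum_ofD; [apply: IH | apply: IH'].
- rewrite wpolyZ fourierZl; apply: tdeg_le_map (IH _ _ vd) => [|x y|c' m md].
  + exact: scaler0.
  + exact: scalerDr.
  + by rewrite scalerA; apply: tdeg_le_mono.
- rewrite wpolyM wpolyX fourierM fourier_x /=; case: (boolP (i == th)) => ith.
    by have := tdeg_le_mulX i (IH _ _ vd); rewrite ith addn0.
  have := tdeg_le_N (tdeg_le_mderiv i (IH _ _ vd)).
  apply: sum_of_bind => _ [c [m [md ->]]]; apply: tdeg_le_mono.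
  exact: leq_trans md (leq_subr _ _).
Qed.

Lemma tdeg_le_wd i d v : tdeg_le d v -> tdeg_le d.+1 (act (wd F i) v).
Proof.
move=> vd; rewrite fourier_d /=.
have [w wE ld] : exists2 w, tdeg_le w (if i == th then mderiv i v else 'X_i * v) &
  (w <= d.+1)%N.
  case: (boolP (i == th)) => ith.
    by exists (d - (i != th))%N;
      [apply: tdeg_le_mderiv | rewrite (leq_trans (leq_subr _ _))].
  by exists (d + (i != th))%N; [apply: tdeg_le_mulX | rewrite ith addn1].
apply: sum_of_bind wE => _ [c [m [md ->]]]; apply: tdeg_le_mono.
exact: leq_trans ld.
Qed.

End TransverseDegree.

Section Cyclic.
Variables (F : numFieldType) (N : nat) (g : lieAlgType F) (hs : {vspace g}).
Variables (pos : N.-tuple (dual hs)) (f : N.-tuple g) (mu : dual hs) (th : 'I_N).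
Local Notation P := {mpoly F[N]}.
Variable pi : g -> P -> P.
Local Notation act := (fourier (pred1 th)).
Local Notation wt := (monomial_weight pos mu th).
Hypothesis hsC : cartan_subalgebra hs.
Hypothesis posP : positive_system pos.
Hypothesis fP : root_basis_opp pos f.
Hypothesis piM : is_lie_module pi.
Hypothesis pi_cartan : forall (x : subvs_of hs) m,
  pi (vsval x) 'X_[m] = (wt m x : F) *: 'X_[m].
Hypothesis pi_root : forall i, exists r : 'I_N -> 'I_N -> P, forall p,
  pi (tnth f i) p = - act (wd F i) p +
  \sum_k \sum_(j | j != th) act (wx F j * wpoly (r j k) * wd F k) p.
Hypothesis pi_max : forall p, pi (tnth f th) p = - mderiv th p.

Let piDr := piDr piM.
Let pi0r := pi0r piM.
Let piZr := piZr piM.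
Let piZl := piZl piM.
Let pi_lie := pi_lie piM.
Local Notation weight_vector := (weight_vector pi).

Lemma weight_vector_monomial m : weight_vector (wt m) 'X_[m].
Proof. by move=> x; apply: pi_cartan. Qed.

Lemma weight_vector_coef nu v m : weight_vector nu v -> v@_m != 0 -> wt m = nu.
Proof.
move=> vnu vm; apply/lfunP => x.
have E w : (pi (vsval x) w)@_m = (wt m x : F) * w@_m.
  elim/mpolyind: w => [|c m' w _ _ IH]; first by rewrite pi0r mcoeff0 mulr0.
  rewrite piDr piZr pi_cartan !mcoeffD IH !mcoeffZ mcoeffX mulrDr; congr (_ + _).
  by case: eqP => [->|]; rewrite ?mulr1 ?mulr0 // mulrC.
by have := E v; rewrite vnu mcoeffZ => /(mulIf vm).
Qed.

Variables e_th h_th f_th : g.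
Hypothesis sl2 : sl2_triple (tnth pos th) e_th h_th f_th.
Variable c : F.
Hypothesis f_thE : f_th = c *: tnth f th.

Lemma f_th_scale_neq0 : c != 0.
Proof.
case: sl2 => e0 _ _ [hE he _]; apply: contraNneq e0 => c0.
by move: he; rewrite -hE f_thE c0 scale0r linear0 lie0l => /esym/eqP;
  rewrite scaler_eq0 pnatr_eq0.
Qed.

Local Notation hth := (vsproj hs h_th).

Lemma th_h_th : tnth pos th hth = 2%:R :> F.
Proof.
case: sl2 => e0 /rootspP ea _ [_ he _].
have := ea hth; rewrite vsprojK ?(sl2_h_mem hsC sl2) // he => /eqP.
rewrite -subr_eq0 -scalerBl scaler_eq0 (negPf e0) orbF subr_eq0.
by move/eqP.
Qed.

Local Notation Xth k := ('X_[U_(th) *+ k] : P).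

Lemma wt_Xth k : wt (U_(th) *+ k)%MM = wt 0%MM + k%:R *: tnth pos th.
Proof.
rewrite /monomial_weight -addrA; congr (_ + _).
rewrite (bigD1 th) //= [in RHS](bigD1 th) //= eqxx mnm0E scale0r add0r.
rewrite mulmnE mnm1E eqxx mul1n addrC; congr (_ + _).
apply: eq_bigr => i ith; rewrite (negPf ith) mulmnE mnm1E mnm0E.
by rewrite eq_sym (negPf ith).
Qed.

(** A monomial in the d_i alone has height at most that of 1, and x_th^(k+1) has a
    larger one. *)
Lemma transverse_weight m k : wt m = wt (U_(th) *+ k.+1)%MM -> m th != 0%N.
Proof.
have [ht [l htP]] := height_exists posP; have [htD htN htZ htm l0] := htP.
have htS (I : Type) (s : seq I) (Q : pred I) (a : I -> dual hs) :
    ht (\sum_(i <- s | Q i) a i) = \sum_(i <- s | Q i) ht (a i).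
  exact: (big_morph ht htD (ht0 htP)).
move=> /addrI /(congr1 ht); rewrite !htS => /eqP; rewrite eq_sym -subr_eq0 -sumrB.
apply: contraTneq => mth.
have -> : \sum_i (ht ((if i == th then ((U_(th) *+ k.+1)%MM i)%:R
      else - ((U_(th) *+ k.+1)%MM i).+1%:R) *: tnth pos i) -
    ht ((if i == th then (m i)%:R else - (m i).+1%:R) *: tnth pos i)) =
    (\sum_i (if i == th then k.+1 else m i) * l i)%N%:R.
  rewrite natr_sum; apply: eq_bigr => i _; rewrite !htZ htm -mulrBl natrM.
  congr (_ * _); rewrite mulmnE mnm1E; case: (eqVneq i th) => [->|ith].
    by rewrite mul1n mth subr0.
  by rewrite mul0n opprK addrC -natrB // subn1.
by rewrite pnatr_eq0 (bigD1 th) //= eqxx addn_eq0 muln_eq0 /= gtn_eqF.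
Qed.

Lemma mderivXth k : mderiv th (Xth k) = k%:R *: Xth k.-1.
Proof.
rewrite mderivX mulmnE mnm1E eqxx mul1n; case: k => [|k]; first by rewrite !scale0r.
congr (_ *: 'X_[_]); apply/mnmP => i; rewrite mnmBE !mulmnE mnm1E.
by case: eqP => _; rewrite ?mul1n ?mul0n ?subn1 ?subn0.
Qed.

Lemma wt_Xth_h_th k : wt (U_(th) *+ k)%MM hth = wt 0%MM hth + k%:R * 2%:R :> F.
Proof. by rewrite wt_Xth dualD scale_lfunE th_h_th. Qed.

Lemma mderiv_e_th k : mderiv th (pi e_th (Xth k)) =
  ((wt 0%MM hth + k%:R * 2%:R) / c) *: Xth k + k%:R *: pi e_th (Xth k.-1).
Proof.
have c0 := f_th_scale_neq0; have [_ _ _ [hE _ _]] := sl2.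
have hX : pi h_th (Xth k) = (wt 0%MM hth + k%:R * 2%:R) *: Xth k.
  have := weight_vector_monomial (U_(th) *+ k)%MM hth.
  by rewrite vsprojK ?(sl2_h_mem hsC sl2) // => ->; rewrite wt_Xth_h_th.
have := pi_lie e_th f_th (Xth k); rewrite hE hX f_thE !piZl !pi_max mderivXth.
rewrite piZr -scaleNr piZr scalerN opprK => E.
rewrite [_ / c]mulrC -scalerA E scalerDr !scalerA mulVf // scale1r.
by rewrite (mulKf c0) scaleNr addrAC addNr add0r.
Qed.

(** The brackets with f_th determine the derivative of e_th x_th^k along x_th, and
    the weights exclude a part independent of x_th. *)
Lemma e_th_Xth k : pi e_th (Xth k) =
  ((wt 0%MM hth + k%:R) / c) *: Xth k.+1.
Proof.
have c0 := f_th_scale_neq0; have [e0 ea fa _] := sl2.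
have from_deriv k' a : mderiv th (pi e_th (Xth k')) = (k'.+1%:R * a) *: Xth k' ->
    pi e_th (Xth k') = a *: Xth k'.+1.
  move=> dE; apply/mpolyP => m; rewrite mcoeffZ mcoeffX.
  case: eqP => [<-|neq].
    have := congr1 (fun p : P => p@_(U_(th) *+ k')%MM) dE.
    rewrite mcoeff_deriv mcoeffZ mcoeffX eqxx mulr1 mulmnE mnm1E eqxx mul1n.
    rewrite addmC -mulmS -[X in X = _]mulr_natl => /mulfI-> //; first by rewrite mulr1.
    by rewrite pnatr_eq0.
  rewrite mulr0; apply/eqP; apply: contra_notT neq => pm.
  have wm : wt m = wt (U_(th) *+ k'.+1)%MM.
    have := weight_vector_coef (weight_vector_root piM ea (weight_vector_monomial _)) pm.
    move=> ->; rewrite !wt_Xth addrCA; congr (_ + _).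
    by rewrite -{1}[tnth pos th]scale1r -scalerDl -natr1 addrC.
  have mth := transverse_weight wm.
  have mE : m = (m - U_(th) + U_(th))%MM.
    rewrite submK //; apply/mnm_lepP => j; rewrite mnm1E.
    by case: eqP => [<-|] //; rewrite lt0n.
  have := congr1 (fun p : P => p@_(m - U_(th))%MM) dE.
  rewrite mcoeff_deriv -mE mcoeffZ mcoeffX.
  case: eqP => [E _|_ /eqP]; first by rewrite mE -E mulmS addmC.
  by rewrite mulr0 mulrn_eq0 (negPf pm).
apply: (@from_deriv); elim: k => [|k IH]; rewrite mderiv_e_th.
  by rewrite !mulr0n mul0r scale0r !addr0 mul1r.
rewrite /= (from_deriv _ _ IH) scalerA -scalerDl; congr (_ *: _).
by rewrite -!natr1; field.
Qed.

Definition generated (v0 w : P) := exists u, w = uenv_act pi u v0.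

Lemma generated_self v0 : generated v0 v0.
Proof. by exists 1; rewrite (uenv_act1 piM). Qed.
Lemma generatedD v0 v w : generated v0 v -> generated v0 w -> generated v0 (v + w).
Proof. by move=> [a ->] [b ->]; exists (a + b); rewrite (uenv_actDl piM). Qed.
Lemma generatedZ v0 b v : generated v0 v -> generated v0 (b *: v).
Proof. by move=> [a ->]; exists (b *: a); rewrite (uenv_actZl piM). Qed.
Lemma generated_pi v0 x v : generated v0 v -> generated v0 (pi x v).
Proof.
by move=> [a ->]; exists (uinj x * a); rewrite (uenv_actM piM) (uenv_act_inj piM).
Qed.

(** A root vector f_b sends a monomial m to - d_b m plus terms whose degree in the
    d_i is at most that of m, so d_b m is reached from m. *)
Lemma generated_tdeg v0 d v :
  (forall k, generated v0 (Xth k)) -> tdeg_le th d v -> generated v0 v.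
Proof.
move=> gX.
have gsum Q w : (forall x, Q x -> generated v0 x) -> sum_of Q w -> generated v0 w.
  move=> gQ; elim=> [|x y /gQ gx _ gy]; last exact: generatedD.
  by rewrite -(scale0r v0); apply/generatedZ/generated_self.
elim: d v => [|d IH] v; apply: gsum => _ [a [m [md ->]]]; apply: generatedZ.
  have -> : m = (U_(th) *+ m th)%MM; last exact: gX.
  apply/mnmP => i; rewrite mulmnE mnm1E eq_sym; case: eqP => [->|/eqP ith].
    by rewrite mul1n.
  by move: md; rewrite leqn0 sum_nat_eq0 => /forallP/(_ i)/implyP/(_ ith)/eqP.
move: md; rewrite leq_eqVlt ltnS => /predU1P[md|md]; last first.
  by rewrite -(scale1r 'X_[m]); apply: IH; apply: tdeg_le_mono.
have [b bth mb] : exists2 b, b != th & m b != 0%N.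
  have : tdeg th m != 0%N by rewrite md.
  by rewrite /tdeg sum_nat_eq0 negb_forall => /existsP[b]; rewrite negb_imply =>
    /andP[]; exists b.
pose m' := (m - U_(b))%MM.
have mE : m = (U_(b) + m')%MM.
  rewrite addmC submK //; apply/mnm_lepP => j; rewrite mnm1E.
  by case: eqP => [<-|] //; rewrite lt0n.
have m'd : (tdeg th m' <= d)%N.
  by move: md; rewrite mE tdegD tdegU bth add1n => -[->].
have g' : generated v0 'X_[m'].
  by rewrite -(scale1r 'X_[m']); apply: IH; apply: tdeg_le_mono.
have [r rE] := pi_root b.
have := rE 'X_[m']; rewrite fourier_d /= (negPf bth) -mpolyXD -mE => E.
have -> : 'X_[m] = - 1 *: pi (tnth f b) 'X_[m'] +
    \sum_k \sum_(j | j != th) act (wx F j * wpoly (r j k) * wd F k) 'X_[m'].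
  by rewrite E scaleN1r opprD opprK subrK.
apply: generatedD; first exact/generatedZ/generated_pi.
apply: IH; rewrite /tdeg_le; apply: (big_ind (sum_of _)) => [|x y|k _].
- exact: sum_of0.
- exact: sum_ofD.
apply: (big_ind (sum_of _)) => [|x y|j jth].
- exact: sum_of0.
- exact: sum_ofD.
rewrite !fourierM; apply: tdeg_le_wx_transverse => //.
apply: tdeg_le_wpoly; apply: tdeg_le_wd; rewrite -(scale1r 'X_[m']).
exact: tdeg_le_mono.
Qed.

(** The scalar in [e_th_Xth] vanishes for at most one k.  Beyond it e_th raises
    the powers of x_th, and f_theta lowers them. *)
Lemma pi_cyclic : cyclic_lie_module pi.
Proof.
have c0 := f_th_scale_neq0.
have [k0 k0P] : exists k0 : nat, forall k, (k0 <= k)%N -> wt 0%MM hth + k%:R != 0 :> F.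
  have [[l lE]|nl] := pselect (exists l : nat, wt 0%MM hth + l%:R = 0 :> F).
    exists l.+1 => k lk; apply/eqP => kE; move: lk; rewrite ltnNge => /negP; apply.
    have /eqP : k%:R = l%:R :> F by apply: (addrI (wt 0%MM hth : F)); rewrite kE lE.
    by rewrite eqr_nat => /eqP ->.
  by exists 0%N => k _; apply/eqP => kE; apply: nl; exists k.
exists (Xth k0) => v; have [d vd] := tdeg_le_exists th v.
apply: generated_tdeg vd => k.
have down l j : (l + j = k0)%N -> generated (Xth k0) (Xth j).
  elim: l j => [|l IH] j lj; first by rewrite -lj; apply: generated_self.
  have gj : generated (Xth k0) (Xth j.+1) by apply: IH; rewrite addnS -addSn.
  have -> : Xth j = - (j.+1%:R)^-1 *: pi (tnth f th) (Xth j.+1).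
    rewrite pi_max mderivXth scalerN scaleNr opprK scalerA mulVf ?scale1r //.
    by rewrite pnatr_eq0.
  exact/generatedZ/generated_pi.
case: (leqP k k0) => [/subnK/down//|/ltnW/subnK <-].
elim: (k - k0)%N => [|l IH]; first exact: generated_self.
rewrite addSn; have nz := k0P (l + k0)%N (leq_addl _ _).
have -> : Xth (l + k0).+1 = ((wt 0%MM hth + (l + k0)%:R) / c)^-1 *: pi e_th (Xth (l + k0)).
  by rewrite e_th_Xth scalerA mulVf ?scale1r // mulf_neq0 ?invr_eq0.
exact/generatedZ/generated_pi.
Qed.

End Cyclic.

(** * Commutation in the enveloping algebra *)

Section Envelope.
Variables (F : fieldType) (g : lieAlgType F).
Implicit Types (x y : g) (a b : uenv g).

Lemma uinjZ c x : uinj (c *: x) = c *: uinj x.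
Proof. by rewrite /uinj /pgen [RHS]pclsZ; apply/pclsP/acongr_rel/lie_rel_scale. Qed.
Lemma uinj_lie x y : uinj (lie x y) = uinj x * uinj y - uinj y * uinj x.
Proof.
rewrite -scaleN1r /uinj /pgen [X in X + _]pclsM [X in _ *: X]pclsM.
rewrite [X in _ + X]pclsZ [RHS]pclsD.
exact/pclsP/acongr_rel/lie_rel_bracket.
Qed.

End Envelope.

Section SubalgebraCommute.
Variables (F : fieldType) (A : algType F).

Lemma subalg_gen_comm (S S' : A -> Prop) :
  (forall a b, S a -> S' b -> a * b = b * a) ->
  forall a b, subalg_gen S a -> subalg_gen S' b -> a * b = b * a.
Proof.
move=> SS' a b Sa S'b; elim: S'b =>
  {b} [b S'b||b c _ IHb _ IHc|b c _ IHb _ IHc|k b _ IH].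
- elim: Sa => {a} [a /SS'->//||x y _ IHx _ IHy|x y _ IHx _ IHy|k x _ IH].
  + by rewrite mul1r mulr1.
  + by rewrite mulrDl mulrDr IHx IHy.
  + by rewrite -mulrA IHy mulrA IHx mulrA.
  + by rewrite -scalerAl IH scalerAr.
- by rewrite mul1r mulr1.
- by rewrite mulrDl mulrDr IHb IHc.
- by rewrite mulrA IHb -mulrA IHc mulrA.
- by rewrite -scalerAr IH scalerAl.
Qed.

End SubalgebraCommute.

Lemma sub_scalar_comm (F : fieldType) (A : algType F) (a b : A) (c d : F) :
  a * b = b * a -> (a - c *: 1) * (b - d *: 1) = (b - d *: 1) * (a - c *: 1).
Proof.
have sc (x : A) k : GRing.comm x (k *: 1).
  by rewrite /GRing.comm -scalerAr -scalerAl mulr1 mul1r.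
move=> ab; apply: commrB; last exact: sc.
by apply/commr_sym/commrB; [apply/esym/ab | apply: sc].
Qed.

(** * Theta-Gelfand-Tsetlin modules *)

Section GelfandTsetlin.
Variables (F : numFieldType) (g : lieAlgType F) (hs : {vspace g}).
Variables (M : lmodType F) (pi : g -> M -> M).
Hypothesis piM : is_lie_module pi.
Hypothesis hsC : cartan_subalgebra hs.
Variables (al : dual hs) (e h f : g).
Hypothesis sl2 : sl2_triple al e h f.
Let h_in : h \in hs := sl2_h_mem hsC sl2.

Local Notation act := (uenv_act pi).
Local Notation U := (uenv_sl2 e h f).
Local Notation Gam := (Gamma hs e h f).
Local Notation weight_vector := (@weight_vector F g hs M pi).

Lemma actD a v w : act a (v + w) = act a v + act a w.
Proof. by rewrite -{1}[v]scale1r (uenv_act_lin piM) scale1r. Qed.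
Lemma act0 a : act a 0 = 0.
Proof. by apply: (addIr (act a 0)); rewrite -actD !add0r. Qed.
Lemma actZ a c v : act a (c *: v) = c *: act a v.
Proof. by rewrite -[c *: v]addr0 (uenv_act_lin piM) act0 addr0. Qed.
Lemma act_sub_scalar a c v : act (a - c *: 1) v = act a v - c *: v.
Proof.
have -> : a - c *: 1 = a + (- c) *: 1 by rewrite scaleNr.
by rewrite (uenv_actDl piM) (uenv_actZl piM) (uenv_act1 piM) scaleNr.
Qed.

Lemma sl2_mem x : x \in [:: e; h; f] -> U (uinj x).
Proof. by move=> xs; apply: subalg_gen_mem; exists x => //; apply: memv_span. Qed.

(** An element x of the Cartan subalgebra acts on s_theta, hence on U(s_theta), as
    the multiple al(x) / 2 of ad h. *)
Lemma cartan_ad_sl2 (x : subvs_of hs) b : U b ->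
  2%:R *: (uinj (vsval x) * b - b * uinj (vsval x)) =
  (al x : F) *: (uinj h * b - b * uinj h).
Proof.
have [hab _ _] := hsC; have [_ /rootspP ea /rootspP fa [_ he hf]] := sl2.
have DM (X y z : uenv g) : X * (y * z) - y * z * X =
    (X * y - y * X) * z + y * (X * z - z * X).
  by rewrite mulrBl mulrBr !mulrA addrA subrK.
have DA (X y z : uenv g) :
  X * (y + z) - (y + z) * X = (X * y - y * X) + (X * z - z * X).
  by rewrite mulrDr mulrDl opprD addrACA.
have DZ (X y : uenv g) c : X * (c *: y) - (c *: y) * X = c *: (X * y - y * X).
  by rewrite -scalerAr -scalerAl scalerBr.
elim=> [_ [y ys ->]||y z _ IHy _ IHz|y z _ IHy _ IHz|c y _ IH].
- rewrite -!uinj_lie -!uinjZ; congr uinj.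
  move: ys; rewrite span_cons => /memv_addP[_ /vlineP[c1 ->] [w ws ->]].
  move: ws; rewrite span_cons => /memv_addP[_ /vlineP[c2 ->] [w' ws ->]].
  move: ws; rewrite span_seq1 => /vlineP[c3 ->].
  have xh0 : lie (vsval x) h = 0 by apply: hab; rewrite ?subvsP.
  rewrite !lieDr !lieZr xh0 liexx ea fa he hf dualN !scaler0 !add0r.
  rewrite -scaleNr !scalerDr !scalerA; congr (_ *: _ + _ *: _); ring.
- by rewrite !mulr1 !mul1r !subrr !scaler0.
- by rewrite (DA _ y z) scalerDr IHy IHz -scalerDr -DA.
- rewrite (DM _ y z) scalerDr scalerAl IHy scalerAr IHz.
  by rewrite -scalerAl -scalerAr -scalerDr -DM.
- by rewrite (DZ _ y c) scalerA mulrC -scalerA IH scalerA mulrC -scalerA -DZ.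
Qed.

(** ad x is a multiple of ad h on U(s_theta), and ad h kills its centre. *)
Lemma cartan_center_comm (x : subvs_of hs) z : center_of U z ->
  uinj (vsval x) * z = z * uinj (vsval x).
Proof.
case=> Uz zC; have := cartan_ad_sl2 x Uz.
have Uh : U (uinj h) by apply: sl2_mem; rewrite !inE eqxx orbT.
rewrite -(zC _ Uh) subrr scaler0 => /eqP; rewrite scaler_eq0 pnatr_eq0 /= subr_eq0.
by move/eqP.
Qed.

Lemma Gamma_comm a b : Gam a -> Gam b -> a * b = b * a.
Proof.
have [hab _ _] := hsC; apply: subalg_gen_comm => y z.
case=> [[x xh ->]|zy] [[x' xh' ->]|zz].
- by apply/eqP; rewrite -subr_eq0 -uinj_lie hab // -(scale0r (0 : g)) uinjZ scale0r.
- by rewrite -(vsprojK xh) cartan_center_comm.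
- by rewrite -(vsprojK xh') cartan_center_comm.
- by case: zy zz => Uy yC [Uz _]; apply: yC.
Qed.

Lemma Gamma_cartan (x : subvs_of hs) : Gam (uinj (vsval x)).
Proof. by apply: subalg_gen_mem; left; exists (vsval x); rewrite ?subvsP. Qed.

Lemma act_comm a b v : a * b = b * a -> act a (act b v) = act b (act a v).
Proof. by move=> ab; rewrite -!(uenv_actM piM) ab. Qed.

Lemma Gamma_weight_vector a mu v : Gam a -> weight_vector mu v ->
  weight_vector mu (act a v).
Proof.
move=> Ga vmu x; rewrite -(uenv_act_inj piM) act_comm.
  by rewrite (uenv_act_inj piM) vmu actZ.
exact: Gamma_comm (Gamma_cartan x) Ga.
Qed.

Lemma iter_piD n v w : iter n (pi f) (v + w) = iter n (pi f) v + iter n (pi f) w.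
Proof. by elim: n => //= n ->; rewrite (piDr piM). Qed.
Lemma iter_piZ n c v : iter n (pi f) (c *: v) = c *: iter n (pi f) v.
Proof. by elim: n => //= n ->; rewrite (piZr piM). Qed.
Lemma iter_piB n v w : iter n (pi f) (v - w) = iter n (pi f) v - iter n (pi f) w.
Proof. by rewrite iter_piD -scaleN1r iter_piZ scaleN1r. Qed.
Section Lowest.
Variable nu : F.
Definition lowest v := pi f v = 0 /\ pi h v = nu *: v.

Lemma h_iter_e v i : lowest v ->
  pi h (iter i (pi e) v) = (nu + i%:R * 2%:R) *: iter i (pi e) v.
Proof.
case: sl2 => _ _ _ [_ he _] [_ hv]; elim: i => [|i IH] /=.
  by rewrite mulr0n mul0r addr0.
have := pi_lie piM h e (iter i (pi e) v); rewrite he (piZl piM) IH (piZr piM) => /eqP.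
rewrite eq_sym subr_eq => /eqP ->; rewrite -scalerDl; congr (_ *: _).
by rewrite -natr1; ring.
Qed.

Lemma f_iter_e v i : lowest v ->
  pi f (iter i (pi e) v) = - (i%:R * (nu + i%:R - 1)) *: iter i.-1 (pi e) v.
Proof.
move=> lv; case: sl2 => _ _ _ [hE _ _]; elim: i => [|i IH].
  by rewrite /= mulr0n mul0r oppr0 scale0r; case: lv.
rewrite iterS; have := pi_lie piM e f (iter i (pi e) v).
rewrite hE (h_iter_e i lv) IH (piZr piM) => E.
rewrite -[LHS](subrK (- (i%:R * (nu + i%:R - 1)) *: pi e (iter i.-1 (pi e) v))).
rewrite -[X in X + _]opprB -E addrC.
case: i {IH E} => [|i] /=.
  by rewrite mulr0n mul0r oppr0 scale0r sub0r -scaleNr; congr (_ *: _); ring.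
by rewrite -scalerBl; congr (_ *: _); rewrite -!natr1; ring.
Qed.

(** A formal combination of powers of e, kept as a list so that its coefficients
    are the same for all lowest vectors v of weight nu. *)
Definition e_comb (s : seq (F * nat)) (v : M) : M :=
  \sum_(p <- s) p.1 *: iter p.2 (pi e) v.

Lemma e_comb_cat s t v : e_comb (s ++ t) v = e_comb s v + e_comb t v.
Proof. exact: big_cat. Qed.

Lemma sl2_e_comb b : U b -> forall s, exists t, forall v, lowest v ->
  act b (e_comb s v) = e_comb t v.
Proof.
have ext (op : M -> M) : op 0 = 0 -> {morph op : v w / v + w} ->
    (forall p : F * nat, exists t, forall v, lowest v ->
       op (p.1 *: iter p.2 (pi e) v) = e_comb t v) ->
    forall s, exists t, forall v, lowest v -> op (e_comb s v) = e_comb t v.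
  move=> op0 opD op1; elim=> [|p s [t IH]].
    by exists [::] => v _; rewrite /e_comb !big_nil.
  have [t1 H1] := op1 p; exists (t1 ++ t) => v lv.
  by rewrite e_comb_cat -IH // -H1 // -opD /e_comb big_cons.
elim=> [_ [y ys ->]||y z _ IHy _ IHz|y z _ IHy _ IHz|c y _ IH] s.
- apply: ext => [|v w|[c i]]; rewrite ?act0 ?actD //=.
  move: ys; rewrite span_cons => /memv_addP[_ /vlineP[c1 ->] [w ws ->]].
  move: ws; rewrite span_cons => /memv_addP[_ /vlineP[c2 ->] [w' ws ->]].
  move: ws; rewrite span_seq1 => /vlineP[c3 ->].
  exists [:: (c * c1, i.+1); (c * (c2 * (nu + i%:R * 2%:R)), i);
             (c * (c3 * - (i%:R * (nu + i%:R - 1))), i.-1)] => v lv.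
  rewrite (uenv_act_inj piM) !(piDl piM) !(piZl piM) !(piZr piM).
  rewrite (h_iter_e i lv) (f_iter_e i lv) /e_comb !big_cons big_nil addr0 /=.
  by rewrite !scalerA [c1 * c]mulrC !mulrA [c2 * c]mulrC [c3 * c]mulrC.
- by exists s => v _; rewrite (uenv_act1 piM).
- have [t1 H1] := IHy s; have [t2 H2] := IHz s; exists (t1 ++ t2) => v lv.
  by rewrite (uenv_actDl piM) H1 // H2 // e_comb_cat.
- have [t1 H1] := IHz s; have [t2 H2] := IHy t1; exists t2 => v lv.
  by rewrite (uenv_actM piM) H1 // H2.
- have [t H] := IH s; exists [seq (c * p.1, p.2) | p <- t] => v lv.
  rewrite (uenv_actZl piM) H // /e_comb big_map scaler_sumr.
  by apply: eq_bigr => p _; rewrite scalerA.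
Qed.

(** z v is a combination of the vectors e^i v with weight nu; only i = 0 occurs,
    since e^i v has weight nu + 2 i.  The scalar is the value at nu of the
    Harish-Chandra projection of z. *)
Lemma center_scalar z : center_of U z -> exists c, forall v, lowest v ->
  act z v = c *: v.
Proof.
case=> Uz zC; have [t tE] := sl2_e_comb Uz [:: (1, 0%N)].
exists (\sum_(p <- t | p.2 == 0%N) p.1) => v lv.
have {}tE : act z v = e_comb t v.
  by rewrite -tE // /e_comb big_cons big_nil addr0 scale1r.
pose n := (\max_(p <- t) p.2).+1.
pose w i := \sum_(p <- t | p.2 == i) p.1 *: iter i (pi e) v.
have wE : act z v = \sum_(i <- iota 0 n) w i.
  rewrite tE /e_comb; under [RHS]eq_bigr do rewrite /w big_mkcond.
  rewrite exchange_big /=; apply: eq_big_seq => p pt.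
  have pin : p.2 \in iota 0 n.
    by rewrite mem_iota leq0n add0n /n ltnS;
      exact: (@leq_bigmax_seq _ t xpredT (fun q => q.2)).
  rewrite -big_mkcond (big_rem _ pin) eqxx -[LHS]addr0; congr (_ + _).
  rewrite big1_seq // => i /andP[/eqP <-].
  by rewrite mem_rem_uniqF ?iota_uniq.
have hw i : pi h (w i) = (nu + i%:R * 2%:R) *: w i.
  rewrite /w (big_morph _ (piDr piM h) (pi0r piM h)) scaler_sumr; apply: eq_bigr => p _.
  by rewrite (piZr piM) (h_iter_e i lv) !scalerA mulrC.
have hz : pi h (act z v) = nu *: act z v.
  have Uh : U (uinj h) by apply: sl2_mem; rewrite !inE eqxx orbT.
  case: lv => _ hv.
  by rewrite -(uenv_act_inj piM) act_comm -?zC // (uenv_act_inj piM) hv actZ.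
(* z v has the same weight as the component of index 0, hence is moved there. *)
pose w' i := if i == 0%N then w 0%N - act z v else w i.
have w'0 : {in iota 0 n, forall i, w' i = 0}.
  apply: (@independent_components _ _ (fun i x => pi h x = (nu + i%:R * 2%:R) *: x)).
  - move=> i j x ij xj; exists (fun y => pi h y - (nu + j%:R * 2%:R) *: y).
      by rewrite xj subrr.
    split=> [y y'|l y yl|y yi].
    + by rewrite (piDr piM) scalerDr opprD addrACA.
    + by rewrite yl -scalerBl (piZr piM) yl !scalerA mulrC.
    rewrite yi -scalerBl => /eqP; rewrite scaler_eq0 => /orP[|/eqP//].
    rewrite opprD addrACA subrr add0r -mulrBl mulf_eq0 pnatr_eq0 orbF subr_eq0.
    by rewrite eqr_nat (negPf ij).
  - exact: iota_uniq.
  - move=> i _; rewrite /w'; case: eqP => [->|_]; last exact: hw.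
    rewrite (piDr piM) -scaleN1r (piZr piM) hz hw mulr0n mul0r addr0.
    by rewrite scalerDr !scalerA mulrC.
  rewrite /n /= big_cons /w' eqxx.
  have -> : \sum_(i <- iota 1 (\max_(p <- t) p.2))
      (if i == 0%N then w 0%N - act z v else w i) =
      \sum_(i <- iota 1 (\max_(p <- t) p.2)) w i.
    by apply: eq_big_seq => i; rewrite mem_iota; case: i.
  by rewrite addrAC [X in X - _](_ : _ = act z v) ?subrr // wE /n /= big_cons.
have := w'0 0%N; rewrite mem_iota /= /w' eqxx => /(_ isT)/eqP.
rewrite subr_eq0 => /eqP <-; rewrite /w scaler_suml.
by apply: eq_bigr.
Qed.
End Lowest.

Lemma iter_f_weight mu v n : weight_vector mu v ->
  pi h (iter n (pi f) v) = (mu (vsproj hs h) - n%:R * 2%:R) *: iter n (pi f) v.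
Proof.
move=> vmu; case: sl2 => _ _ _ [_ _ hf]; elim: n => [|n IH] /=.
  by rewrite mulr0n mul0r subr0 -vmu vsprojK.
have := pi_lie piM h f (iter n (pi f) v).
rewrite hf -scaleNr (piZl piM) IH (piZr piM) => /eqP.
rewrite eq_sym subr_eq => /eqP ->; rewrite -scalerDl; congr (_ *: _).
by rewrite -natr1; ring.
Qed.

Lemma center_iter_f z n v : center_of U z ->
  iter n (pi f) (act z v) = act z (iter n (pi f) v).
Proof.
case=> Uz zC; elim: n => //= n ->.
have Uf : U (uinj f) by apply: sl2_mem; rewrite !inE eqxx !orbT.
by rewrite -!(uenv_act_inj piM) act_comm // -zC.
Qed.

(** On ker f^(n+1) / ker f^n in the weight space of mu, which f^n embeds in the
    vectors killed by f of weight mu - n al, a central element z acts by the scalar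
    of [center_scalar], because z commutes with f. *)
Lemma Gamma_filtration a : Gam a -> forall mu n, exists c, forall v,
  weight_vector mu v -> iter n.+1 (pi f) v = 0 ->
  iter n (pi f) (act a v) = c *: iter n (pi f) v.
Proof.
elim=> [{}a [[x xh ->]|za]||b k _ IHb _ IHk|b k Gb IHb Gk IHk|k b _ IH] mu n.
- exists (mu (vsproj hs x)) => v vmu _.
    by rewrite (uenv_act_inj piM) -{1}(vsprojK xh) vmu iter_piZ.
- have [k kE] := center_scalar (mu (vsproj hs h) - n%:R * 2%:R) za.
  exists k => v vmu fv; rewrite center_iter_f // kE //.
  by split=> //; apply: iter_f_weight.
- by exists 1 => v _ _; rewrite (uenv_act1 piM) scale1r.
- have [cb HB] := IHb mu n; have [ck HK] := IHk mu n.
  exists (cb + ck) => v vmu fv.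
  by rewrite (uenv_actDl piM) iter_piD HB // HK // scalerDl.
- have [cb HB] := IHb mu n; have [ck HK] := IHk mu n; have [c' HK'] := IHk mu n.+1.
  exists (cb * ck) => v vmu fv; rewrite (uenv_actM piM) HB.
  + by rewrite HK // scalerA.
  + exact: Gamma_weight_vector.
  + by rewrite HK' // ?fv ?scaler0 // iterS fv (pi0r piM).
- have [c H] := IH mu n; exists (k * c) => v vmu fv.
  by rewrite (uenv_actZl piM) iter_piZ H // scalerA.
Qed.

(** The product of the shifts a_i - chi_i(a_i) kills v for all choices of the a_i
    in Gamma, where chi_1, chi_2, ... is the list s. *)
Fixpoint killed_by (s : seq (uenv g -> F)) (v : M) : Prop :=
  if s is chi :: s' then
    is_character Gam chi /\ forall a, Gam a -> killed_by s' (act a v - chi a *: v)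
  else v = 0.

(** A step of the filtration by the kernels of the powers of f contributes one
    character if it is strict, and none otherwise. *)
Lemma weight_killed mu n : exists s, forall v, weight_vector mu v ->
  iter n (pi f) v = 0 -> killed_by s v.
Proof.
elim: n => [|n [s IH]]; first by exists [::].
have [[v0 [v0mu [fv0 nz]]]|none] := pselect (exists v, weight_vector mu v /\
    iter n.+1 (pi f) v = 0 /\ iter n (pi f) v != 0); last first.
  exists s => v vmu fv; apply: IH => //; apply/eqP; apply: contra_notT none => nz.
  by exists v.
have /choice[chi chiE] : forall a, exists c, Gam a -> forall v, weight_vector mu v ->
    iter n.+1 (pi f) v = 0 -> iter n (pi f) (act a v) = c *: iter n (pi f) v.
  move=> a; have [Ga|nGa] := pselect (Gam a); last by exists 0.
  by have [c cE] := Gamma_filtration Ga mu n; exists c.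
have uniq_c c c' : c *: iter n (pi f) v0 = c' *: iter n (pi f) v0 -> c = c'.
  move/eqP; rewrite -subr_eq0 -scalerBl scaler_eq0 (negPf nz) orbF subr_eq0.
  by move/eqP.
have GM a v : Gam a -> weight_vector mu v -> iter n.+1 (pi f) v = 0 ->
    iter n.+1 (pi f) (act a v) = 0.
  move=> Ga vmu fv; have [c cE] := Gamma_filtration Ga mu n.+1.
  by rewrite cE // ?fv ?scaler0 // iterS fv (pi0r piM).
have chi_char : is_character Gam chi.
  split=> [|a b Ga Gb|a b Ga Gb|c a Ga]; apply: uniq_c.
  - by rewrite -chiE ?(uenv_act1 piM) ?scale1r //; apply: subalg_gen1.
  - rewrite -chiE //; last exact: subalg_genD.
    by rewrite (uenv_actDl piM) iter_piD !chiE // scalerDl.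
  - rewrite -chiE //; last exact: subalg_genM.
    rewrite (uenv_actM piM) (chiE a) //; first by rewrite chiE // scalerA.
      exact: Gamma_weight_vector.
    exact: GM.
  - rewrite -chiE //; last exact: subalg_genZ.
    by rewrite (uenv_actZl piM) iter_piZ chiE // scalerA.
exists (chi :: s) => v vmu fv; split=> // a Ga; apply: IH.
  move=> x; have amu := Gamma_weight_vector Ga vmu x.
  by rewrite -scaleNr (piDr piM) (piZr piM) amu vmu scalerDr !scalerA mulrC.
by rewrite iter_piB iter_piZ chiE // subrr.
Qed.

Lemma killed_by_scale s c v : killed_by s v -> killed_by s (c *: v).
Proof.
elim: s v => [|chi s IH] v /=; first by move=> ->; rewrite scaler0.
case=> chiP H; split=> // a Ga; have := IH _ (H a Ga).
by rewrite actZ scalerBr !scalerA [c * _]mulrC.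
Qed.

Lemma Gamma_shift_comm a b (c d : F) v : Gam a -> Gam b ->
  act a (act b v - d *: v) - c *: (act b v - d *: v) =
  act b (act a v - c *: v) - d *: (act a v - c *: v).
Proof.
move=> Ga Gb; rewrite -!act_sub_scalar act_comm //.
exact/sub_scalar_comm/Gamma_comm.
Qed.

Lemma killed_by_drop s1 chi s2 a v : Gam a -> killed_by (s1 ++ chi :: s2) v ->
  killed_by (s1 ++ s2) (act a v - chi a *: v).
Proof.
move=> Ga; elim: s1 v => [|psi s1 IH] v /=; first by case=> _; apply.
case=> psiP H; split=> // b Gb; rewrite Gamma_shift_comm //.
exact/IH/H.
Qed.

Local Notation GTc := (GT_component hs e h f pi).

(** If all characters of the list agree on Gamma, v is a generalized
    eigenvector.  Otherwise chi(a) <> psi(a) for two of them and some a, and v is a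
    combination of (a - chi(a)) v and (a - psi(a)) v, which are killed by shorter
    lists. *)
Lemma killed_by_split s v : killed_by s v ->
  sum_of (fun w => exists chi, is_character Gam chi /\ GTc chi w) v.
Proof.
elim: (size s) {-2}s v (leqnn (size s)) => {s} [|n IH] [|chi s] v //=.
- by move=> _ ->; apply: sum_of0.
- by move=> _ ->; apply: sum_of0.
rewrite ltnS => sn [chiP vP].
have [agree|/existsNP[psi /not_implyP[ps]]] := pselect (forall psi,
    (exists s1 s2, s = s1 ++ psi :: s2) -> forall a, Gam a -> psi a = chi a).
  apply: sum_of1; exists chi; split=> //; exists (size s).+1 => a Ga.
  rewrite exprSr (uenv_actM piM) act_sub_scalar.
  move: {vP}(act a v - chi a *: v) (vP a Ga) => w.
  elim: s agree w {sn} => [|psi s IHs] agree w; first by move=> ->; rewrite act0.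
  case=> _ wP; rewrite exprSr (uenv_actM piM) act_sub_scalar.
  have <- : psi a = chi a by apply: agree => //; exists [::], s.
  rewrite (agree psi) //; last by exists [::], s.
  apply: IHs.
    by move=> psi' [s1 [s2 sE]]; apply: agree; exists (psi :: s1), s2; rewrite sE.
  by rewrite -(agree psi) //; [apply: wP | exists [::], s].
move=> /existsNP[a /not_implyP[Ga /eqP neq]].
have [s1 [s2 sE]] := ps.
pose k := (psi a - chi a)^-1.
have k0 : psi a - chi a != 0 by rewrite subr_eq0.
have -> : v = k *: (act a v - chi a *: v) + (- k) *: (act a v - psi a *: v).
  rewrite scaleNr -scalerBr opprB addrC addrA subrK -scalerBl scalerA mulVf //.
  exact/esym/scale1r.
apply: sum_ofD.
  by apply: (IH s) => //; apply/killed_by_scale/vP.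
apply: (IH (chi :: s1 ++ s2)).
  by rewrite /= (leq_trans _ sn) // sE !size_cat /= addnS.
apply: killed_by_scale; split=> // b Gb; rewrite Gamma_shift_comm //.
by apply: killed_by_drop => //; rewrite -sE; apply: vP.
Qed.

Hypothesis weights_span : forall v, sum_of (fun w => exists mu, weight_vector mu w) v.
Hypothesis f_nilp : forall v, exists n, iter n (pi f) v = 0.

Lemma coprime_kernel (b : uenv g) (c d : F) m n v : c != d ->
  act ((b - c *: 1) ^+ m) v = 0 -> act ((b - d *: 1) ^+ n) v = 0 -> v = 0.
Proof.
move=> cd; elim: {m n}(m + n)%N {-2}m {-2}n v (leqnn (m + n)) => [|l IH] [|m] [|n] v //.
all: rewrite ?expr0 ?(uenv_act1 piM) // => le vm vn.
have comm : (b - c *: 1) * (b - d *: 1) = (b - d *: 1) * (b - c *: 1).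
  exact: sub_scalar_comm.
have commX i : (b - c *: 1) * (b - d *: 1) ^+ i = (b - d *: 1) ^+ i * (b - c *: 1).
  exact: commrX.
have commX' i : (b - d *: 1) * (b - c *: 1) ^+ i = (b - c *: 1) ^+ i * (b - d *: 1).
  by apply: commrX; apply/esym/comm.
have v1 : act (b - c *: 1) v = 0.
  apply: (IH m n.+1); first by rewrite -ltnS -addSn.
    by rewrite -(uenv_actM piM) -exprSr.
  by rewrite -(uenv_actM piM) -commX (uenv_actM piM) vn act0.
have v2 : act (b - d *: 1) v = 0.
  apply: (IH m.+1 n); first by rewrite -ltnS -addnS.
    by rewrite -(uenv_actM piM) -commX' (uenv_actM piM) vm act0.
  by rewrite -(uenv_actM piM) -exprSr.
move: v1 v2; rewrite !act_sub_scalar => /eqP; rewrite subr_eq0 => /eqP ->.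
by rewrite -scalerBl => /eqP; rewrite scaler_eq0 subr_eq0 (negPf cd) => /eqP.
Qed.

(** The sum is direct because a power of a - chi_l(a) kills the component of
    chi_l and is injective on the component of a character that differs from
    chi_l at a. *)
Lemma pi_theta_GT : theta_GT_module hs e h f pi.
Proof.
split=> [v|n chi w wP sep w0 i].
  have : sum_of (fun w => exists chi, is_character Gam chi /\ GTc chi w) v.
    apply: sum_of_bind (weights_span v) => w [mu wmu].
    have [n fw] := f_nilp w; have [s sP] := weight_killed mu n.
    exact: killed_by_split (sP w wmu fw).
  elim=> {v} [|w v [chi [chiP wP]] _ [n [chis [ws [H ->]]]]].
    exists 0%N, (fun _ _ => 0), (fun _ => 0); split=> [[]//|].
    by rewrite big_ord0.
  exists n.+1, (fun i => if unlift ord0 i is Some j then chis j else chi),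
    (fun i => if unlift ord0 i is Some j then ws j else w); split=> [i|].
    by case: unliftP => [j _|_]; [apply: H | split].
  rewrite big_ord_recl unlift_none; congr (_ + _); apply: eq_bigr => j _.
  by rewrite liftK.
pose Pc (j : 'I_n) (v : M) := GTc (chi j) v.
apply: (@independent_components _ _ Pc _ (index_enum 'I_n) w) => //;
  rewrite ?index_enum_uniq ?mem_index_enum //; last first.
  by move=> j _; case: (wP j).
move=> j l x jl [k xk]; have [a Ga neq] := sep _ _ jl.
exists (act ((a - chi l a *: 1) ^+ k)); first exact: xk.
split=> [y y'|q y [k' yk]|y [k' yk] y0].
- exact: actD.
- exists k' => b Gb; rewrite act_comm ?yk ?act0 //.
  apply: commrX; apply/esym; apply: commrX; apply/esym.
  exact/sub_scalar_comm/Gamma_comm.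
- exact: coprime_kernel neq (yk a Ga) y0.
Qed.

End GelfandTsetlin.

(** * The module of the differential operators *)

Section ThetaModule.
Variables (F : numFieldType) (N : nat) (g : lieAlgType F) (hs : {vspace g}).
Variables (pos : N.-tuple (dual hs)) (f : N.-tuple g) (mu : dual hs) (th : 'I_N).
Variable pi : g -> {mpoly F[N]} -> {mpoly F[N]}.
Variables e_th h_th f_th : g.
Hypothesis hsC : cartan_subalgebra hs.
Hypothesis posP : positive_system pos.
Hypothesis fP : root_basis_opp pos f.
Hypothesis sl2 : sl2_triple (tnth pos th) e_th h_th f_th.
Hypothesis piM : is_lie_module pi.
Hypothesis pi_cartan : forall (x : subvs_of hs) m,
  pi (vsval x) 'X_[m] = (monomial_weight pos mu th m x : F) *: 'X_[m].
Hypothesis pi_max : forall p, pi (tnth f th) p = - mderiv th p.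

Lemma mderiv_nilpotent i (p : {mpoly F[N]}) : exists n, iter n (mderiv i) p = 0.
Proof.
have iterD l (q r : {mpoly F[N]}) : iter l (mderiv i) (q + r) =
    iter l (mderiv i) q + iter l (mderiv i) r.
  by elim: l => //= l ->; rewrite mderivD.
have iter0 l : iter l (mderiv i) 0 = 0 :> {mpoly F[N]}.
  by elim: l => //= l ->; rewrite mderiv0.
elim/mpolyind: p => [|k m p _ _ [n pn]]; first by exists 0%N.
have [l lE] : exists l, iter l (mderiv i) (k *: 'X_[m]) = 0 :> {mpoly F[N]}.
  move: {2}(m i) (erefl (m i)) => d; elim: d m k => [|d IH] m k md.
    by exists 1%N; rewrite /= mderivZ mderivX md scale0r scaler0.
  have [|l lE] := IH (m - U_(i))%MM (k * (m i)%:R).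
    by rewrite mnmBE mnm1E eqxx md subn1.
  by exists l.+1; rewrite iterSr mderivZ mderivX scalerA.
exists (l + n)%N; rewrite iterD [X in X + _](_ : _ = 0).
  by rewrite addrC addr0 ssrnat.iterD pn iter0.
by rewrite addnC ssrnat.iterD lE iter0.
Qed.

Lemma theta_GT_of_explicit : theta_GT_module hs e_th h_th f_th pi.
Proof.
have [ht [m htP]] := height_exists posP.
have [e0 ea fa _] := sl2.
have [c f_thE] := rootsp_opp_line posP htP fP fa.
apply: (pi_theta_GT piM hsC sl2) => v.
- elim/mpolyind: v => [|k m' v _ _ IH]; first exact: sum_of0.
  apply: sum_ofD IH; apply: sum_of1; exists (monomial_weight pos mu th m') => x.
  by rewrite (piZr piM) pi_cartan !scalerA mulrC.
- have [n vn] := mderiv_nilpotent th v; exists n.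
  have -> : iter n (pi f_th) v = (- c) ^+ n *: iter n (mderiv th) v.
    elim: (n) => [|l IH]; first by rewrite scale1r.
    rewrite iterS IH f_thE (piZl piM) (piZr piM) pi_max iterS.
    by rewrite exprS mulNr scaleNr -scalerA !scalerN.
  by rewrite vn scaler0.
Qed.
End ThetaModule.

Theorem diff_op_module (F : numFieldType) (N : nat) (g : lieAlgType F)
    (hs : {vspace g}) (pos : N.-tuple (dual hs)) (f : N.-tuple g) (mu : dual hs)
    (th : 'I_N) (e_th h_th f_th : g) :
  simple_lie g -> cartan_subalgebra hs -> positive_system pos ->
  root_basis_opp pos f -> maximal_root pos (tnth pos th) ->
  sl2_triple (tnth pos th) e_th h_th f_th ->
  let pi a := fourier (pred1 th) (diff_op pos f mu a) in
  [/\ is_lie_module pi, cyclic_lie_module pi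
    & theta_GT_module hs e_th h_th f_th pi].
Proof.
move=> g_simple hsC posP fP thmax sl2 pi.
have [K TK] := nilpotent_bound hsC posP fP.
have piM : is_lie_module pi.
  apply: fourier_lie_module => [c a b|a b].
  - exact: (diff_op_linear pos mu TK).
  - exact: (diff_op_lie mu TK g_simple hsC posP fP).
have [ht [m htP]] := height_exists posP.
have [_ _ fa _] := sl2.
have [c f_thE] := rootsp_opp_line posP htP fP fa.
have pi_cartan := act_cartan mu th hsC posP fP.
have pi_root := act_root_vector mu hsC posP fP thmax.
have pi_max := act_maximal_root mu hsC posP fP thmax.
split=> //.
- exact: (pi_cyclic (pi := pi) hsC posP piM pi_cartan pi_root pi_max sl2 f_thE).
- exact: (theta_GT_of_explicit (pi := pi) hsC posP fP sl2 piM pi_cartan pi_max).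
Qed.

Theorem mainTheorem1 (R : realType) (g : lieAlgType R[i]) (hs : {vspace g})
    (N : nat) (pos : N.-tuple (dual hs)) (f : N.-tuple g) (th : 'I_N)
    (e_th h_th f_th : g) (lambda : dual hs) :
  simple_lie g ->
  cartan_subalgebra hs ->
  positive_system pos ->
  root_basis_opp pos f ->
  maximal_root pos (tnth pos th) ->
  sl2_triple (tnth pos th) e_th h_th f_th ->
  let pi (a : g) : {mpoly R[i][N]} -> {mpoly R[i][N]} :=
    gt_act th (diff_op pos f (lambda + 2%:R *: rho pos) a) in
  [/\ is_lie_module pi, cyclic_lie_module pi
    & theta_GT_module hs e_th h_th f_th pi].
Proof.
move=> g_simple hsC posP fP thmax sl2 pi.
have -> : pi = fun a => fourier (pred1 th) (diff_op pos f (lambda + 2%:R *: rho pos) a).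
  by apply/funext => a; apply/funext => p; apply: gt_actE.
exact: (diff_op_module (lambda + 2%:R *: rho pos) g_simple hsC posP fP thmax sl2).
Qed.
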